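(* Fix $(\theta,\beta)\in(0,1)^2$ and $\alpha>0$ such that $\alpha<\tilde\eta^{clu}_\theta(\beta)$, and consider the clustering problem in the ARW model with parameters $(\alpha,\beta,\theta)$. As $p\to\infty$: (i) $\mathrm{Hamm}_p(\hat\ell^{(sa)}_*,\alpha,\beta,\theta)\to0$ if $0<\beta<(1-\theta)/2$; (ii) $\mathrm{Hamm}_p(\hat\ell^{(if)}_*,\alpha,\beta,\theta)\to0$ if $(1-\theta)/2<\beta<1/2$; (iii) $\mathrm{Hamm}_p(\hat\ell^{(if)}_q,\alpha,\beta,\theta)\to0$ if $1/2<\beta<1$ and we take $q\ge3$.
   Context: ARW model. For each $p$ let $n=n_p=p^\theta$ (treated as an integer), $\epsilon_p=p^{-\beta}$, $\tau_p=p^{-\alpha}$. The labels $\ell_1,\dots,\ell_n$ are i.i.d. uniform on $\{-1,1\}$; the coordinates of $\mu\in\mathbb R^p$ are i.i.d., equal to $\tau_p$ with probability $\epsilon_p$ and to $0$ with probability $1-\epsilon_p$; $Z$ is an $n\times p$ matrix with i.i.d. $N(0,1)$ entries; $\ell,\mu,Z$ are independent. One observes $X=\ell\mu'+Z=[x_1,\dots,x_p]\in\mathbb R^{n\times p}$ (columns $x_j\in\mathbb R^n$). Clustering error. $\mathrm{Hamm}_p(\hat\ell,\alpha,\beta,\theta)=n^{-1}\inf_{\pi\in\Pi}\sum_{i=1}^n P(\hat\ell_i\ne\pi(\ell_i))$, where $\Pi$ is the set of the two permutations of $\{-1,1\}$ and $P$ is over $(\mu,\ell,Z)$. Methods ($\mathrm{sgn}$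 acts entrywise). Simple Aggregation: $\hat\ell^{(sa)}_*=\mathrm{sgn}(\sum_{j=1}^p x_j)$. IF-PCA with fixed tuning parameter $q>0$: let $Q(j)=(\|x_j\|^2-n)/\sqrt{2n}$, $\hat S^{(if)}_q=\{1\le j\le p:Q(j)\ge\sqrt{2q\log p}\}$, let $X^{(q)}$ be the submatrix of $X$ consisting of the columns with indices in $\hat S^{(if)}_q$, let $\xi^{(q)}$ be the first left singular vector of $X^{(q)}$, and set $\hat\ell^{(if)}_q=\mathrm{sgn}(\xi^{(q)})$. Classical PCA: $\hat\ell^{(if)}_*=\mathrm{sgn}(\xi)$ where $\xi$ is the first left singular vector of $X$ itself (no feature selection). The curve $\tilde\eta^{clu}_\theta$: $$\tilde\eta^{clu}_\theta(\beta)=\begin{cases}(1-2\beta)/2,&\beta\le(1-\theta)/2,\\ (1+\theta-2\beta)/4,&(1-\theta)/2\le\beta\le1/2,\\ \theta/4,&1/2\le\beta\le1-\theta/2,\\ (1-\beta)/2,&1-\theta/2\le\beta<1.\end{cases}$$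
   Formalization: In (ii) and (iii) the singular vector's sign is undetermined and, with the infimum outside P, the claim fails for some sign choices; so for every Borel choice of the vector, convergence is stated after multiplying by a suitable Borel sign that depends on the data X only (and may depend on α). *)

(* Defs.v *)
From mathcomp Require Import all_boot all_order all_algebra.
From mathcomp Require Import all_classical all_reals all_analysis.

Set Implicit Arguments.
Unset Strict Implicit.
Unset Printing Implicit Defensive.

Import Order.TTheory GRing.Theory Num.Theory.
Import numFieldNormedType.Exports.

Local Open Scope classical_set_scope.
Local Open Scope ring_scope.

Section Model.
Context {d : measure_display} {T : measurableType d} {R : realType}.
Variable P : probability T R.

(* Taking B i = setT for i outside J gives the product rule for every
   subfamily J. *)
Definition mutually_independent (I : finType) (X : I -> T -> R) : Prop :=
  forall B : I -> set R, (forall i, measurable (B i)) ->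
    P (\bigcap_(i in [set: I]) (X i @^-1` B i)) =
    (\prod_(i : I) P (X i @^-1` B i))%E.

Variables n p : nat.

Definition arw_family (ell : 'I_n -> {RV P >-> R}) (mu : 'I_p -> {RV P >-> R})
    (Z : 'I_n -> 'I_p -> {RV P >-> R}) (k : 'I_n + 'I_p + 'I_n * 'I_p)
    : T -> R :=
  match k with
  | inl (inl i) => ell i
  | inl (inr j) => mu j
  | inr (i, j) => Z i j
  end.

Record arw_model (eps tau : R) (ell : 'I_n -> {RV P >-> R})
    (mu : 'I_p -> {RV P >-> R}) (Z : 'I_n -> 'I_p -> {RV P >-> R}) : Prop := {
  arw_ellN1 : forall i, P (ell i @^-1` [set -1]) = (2^-1)%:E;
  arw_ell1 : forall i, P (ell i @^-1` [set 1]) = (2^-1)%:E;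
  arw_mu_tau : forall j, P (mu j @^-1` [set tau]) = eps%:E;
  arw_mu_0 : forall j, P (mu j @^-1` [set 0]) = (1 - eps)%:E;
  arw_Z : forall i j (B : set R), measurable B ->
    distribution P (Z i j) B = normal_prob 0 1 B;
  arw_indep : mutually_independent (arw_family ell mu Z)
}.

Definition arw_data (ell : 'I_n -> {RV P >-> R}) (mu : 'I_p -> {RV P >-> R})
    (Z : 'I_n -> 'I_p -> {RV P >-> R}) (w : T) : 'M[R]_(n, p) :=
  (\col_i ell i w) *m (\row_j mu j w) + \matrix_(i, j) Z i j w.

(* The two permutations of {-1, 1} are the restrictions of id and of
   x |-> - x. *)
Definition hamm (ell : 'I_n -> {RV P >-> R}) (lhat : T -> 'cV[R]_n) : R :=
  n%:R^-1 *
  inf [set \sum_(i < n) fine (P [set w | lhat w i 0 != pi (ell i w)])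
      | pi in [set idfun; (-%R : R -> R)]].

End Model.

Section Estimators.
Context {R : realType}.

Definition sgn_mx m n (A : 'M[R]_(m, n)) : 'M[R]_(m, n) := map_mx Num.sg A.

Definition is_svd m n (A : 'M[R]_(m, n))
    (U : 'M[R]_m) (D : 'M[R]_(m, n)) (V : 'M[R]_n) : Prop :=
  [/\ U^T *m U = 1%:M, V^T *m V = 1%:M, A = U *m D *m V^T,
      (forall (i : 'I_m) (j : 'I_n), (i : nat) <> j -> D i j = 0) /\
      (forall i j, 0 <= D i j)
    & forall (i : 'I_m) (j : 'I_n) (i' : 'I_m) (j' : 'I_n), (i : nat) = j ->
        (i' : nat) = j' -> (i <= i')%N -> D i' j' <= D i j].

(* A relation, since the vector is at best unique up to sign.  When A has no
   column, every unit vector qualifies. *)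
Definition first_left_singular_vector m n (A : 'M[R]_(m, n)) (xi : 'cV[R]_m)
    : Prop :=
  exists U D V, is_svd A U D V /\
    forall i : 'I_m, (i : nat) = 0%N -> xi = col i U.

(* Borel functions of a matrix: the Borel sets of R^(m x n) are generated by
   the coordinate cylinders. *)
Definition mx_cylinders m n : set (set 'M[R]_(m, n)) :=
  [set C | exists (i : 'I_m) (j : 'I_n) (B : set R),
    measurable B /\ C = [set A : 'M[R]_(m, n) | B (A i j)]].

Definition mx_borel_fun m n (f : 'M[R]_(m, n) -> R) : Prop :=
  forall B : set R, measurable B -> <<s @mx_cylinders m n >> (f @^-1` B).

Definition mx_borel_vec m n k (f : 'M[R]_(m, n) -> 'cV[R]_k) : Prop :=
  forall i, mx_borel_fun (fun A => f A i 0).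

(* A global sign depending on the data only, used to fix the sign left
   undetermined in a singular vector. *)
Definition sign_rule m n (s : 'M[R]_(m, n) -> R) : Prop :=
  (forall A, s A = 1 \/ s A = -1) /\ mx_borel_fun s.

Definition simple_aggregation n p (X : 'M[R]_(n, p)) : 'cV[R]_n :=
  sgn_mx (\sum_(j < p) col j X).

Definition if_stat n p (X : 'M[R]_(n, p)) (j : 'I_p) : R :=
  (\sum_(i < n) X i j ^+ 2 - n%:R) / Num.sqrt (2 * n%:R).

Definition if_selected (q : R) n p (X : 'M[R]_(n, p)) : {set 'I_p} :=
  [set j | Num.sqrt (2 * q * ln p%:R) <= if_stat X j]%SET.

Definition if_submx (q : R) n p (X : 'M[R]_(n, p))
    : 'M[R]_(n, #|if_selected q X|) :=
  colsub (fun k : 'I_#|if_selected q X| => enum_val k) X.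

Definition eta_clu (theta beta : R) : R :=
  if beta <= (1 - theta) / 2 then (1 - 2 * beta) / 2
  else if beta <= 1 / 2 then (1 + theta - 2 * beta) / 4
  else if beta <= 1 - theta / 2 then theta / 4
  else (1 - beta) / 2.

End Estimators.

(* Main.v *)
Require Import Defs.
From mathcomp Require Import all_boot all_order all_algebra.
From mathcomp Require Import all_classical all_reals all_analysis.
From mathcomp Require Import measurable_realfun.
From mathcomp Require Import ring lra zify.

Set Implicit Arguments.
Unset Strict Implicit.
Unset Printing Implicit Defensive.

Import Order.TTheory GRing.Theory Num.Theory.
Import numFieldNormedType.Exports.

Local Open Scope classical_set_scope.
Local Open Scope ring_scope.

(* Write u = ell / sqrt n, s = |supp mu| and let F be the set of retained columns
   (all of them for classical PCA; with high probability exactly supp mu for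
   IF-PCA, by chi-square tails and union bounds).  The first left singular vector xi
   maximises the Rayleigh quotient |X_F' v|^2, so comparing xi with u bounds
   n s tau^2 (1 - <xi, u>^2) by the cross terms plus sup |Z_F' xi|^2 - |Z_F' u|^2.
   The supremum is at most |F| + o(n s tau^2), by a union bound over a fine grid
   with exp(O(n ln p)) points, and |Z_F' u|^2 concentrates around |F|; hence
   <xi, u>^2 tends to 1, and an entry of xi with the wrong sign costs at least 1/n
   in |xi -+ u|^2.  All tail bounds follow from exponential moments.

   The global sign is recovered by a vote: X' xi = <xi, ell> mu + Z' xi, whose
   signal entries have size sqrt n tau, a positive power of p, and, uniformly in
   xi, fewer than s / 4 entries of Z' xi reach a quarter of that size.

   Labels and means take finitely many values, so one may condition on them: under
   the restriction of P to {ell = l, mu = tau 1_S}, the noise is still Gaussian. *)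

(** * Integrals of independent families *)

(** In [hamm] the permutation is chosen outside the probability, so it cannot depend on the sample:
    a vector with the right direction but a random sign could still err about half the time. Hence
    the need for a sign computed from the data and correct with high probability.

    Since xi depends on Z, the noise it meets must be controlled uniformly over unit vectors. The
    net costs exp(7 n ln p); the exponents that pay for it are of order n D, where D is a small
    power of p, so constants can be generous.

    The exponents come from the following balance. With N columns retained, the supremum of the
    noise energy exceeds N by about sqrt(n N) + n up to logarithms, against a signal n s tau^2. So N
    must be small against n s^2 tau^4, and s tau^2 must be large. With N = p the first condition
    reads alpha < (1 + theta - 2 beta) / 4. With N = s the second gives alpha < (1 - beta) / 2, and
    exact selection adds n tau^4 large against ln p, that is alpha < theta / 4. *)

Section Density.
Context d (T : measurableType d) d' (T' : measurableType d') (R : realType).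
Variables (Q : {measure set T -> \bar R}) (nu : {measure set T' -> \bar R}).
Variables (W : T -> R) (Y : T -> T') (C : R).
Hypotheses (mW : measurable_fun setT W) (W_ge0 : forall w, 0 <= W w).
Hypothesis mY : measurable_fun setT Y.
Hypothesis QW : forall B, measurable B ->
  (\int[Q]_w (W w * \1_B (Y w))%:E = C%:E * nu B)%E.

Import HBNNSimple.

(** Linearity extends [QW] from indicators to simple functions, monotone convergence to nonnegative
    ones. The weight [W] serves twice: as a normal density under Lebesgue measure, and as the
    product of the other factors when one member of an independent family is split off. *)
Lemma ge0_integral_density (f : T' -> R) : measurable_fun setT f ->
  (forall y, 0 <= f y) ->
  (\int[Q]_w (W w * f (Y w))%:E = C%:E * \int[nu]_y (f y)%:E)%E.
Proof.
move=> mf f0.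
have mEf : measurable_fun setT (EFin \o f) by exact/measurable_EFinP.
pose g := nnsfun_approx measurableT mEf.
have g_ge0 n y : 0 <= g n y by [].
have mWg n : measurable_fun setT (fun w => W w * g n (Y w)).
  by apply: measurable_funM => //; exact: measurableT_comp.
have step n :
    (\int[Q]_w (W w * g n (Y w))%:E = C%:E * \int[nu]_y (g n y)%:E)%E.
  have mI (k : R) : measurable_fun setT (fun y => \1_(g n @^-1` [set k]) y : R).
    by exact: measurable_indic.
  have mWI k : measurable_fun setT
      (fun w => W w * \1_(g n @^-1` [set k]) (Y w) : R).
    apply: measurable_funM => //.
    by apply: (measurableT_comp (mI k)).
  under eq_integral => w _.
    rewrite fimfunE mulrC mulr_fsuml -fsumEFin//.
    under eq_fsbigr do rewrite -mulrA [_ * W w]mulrC EFinM.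
    over.
  under [in RHS]eq_integral => y _.
    rewrite fimfunE -fsumEFin//.
    under eq_fsbigr do rewrite EFinM.
    over.
  rewrite !ge0_integral_fsum//.
  - rewrite ge0_mule_fsumr; last first.
      move=> k; case: (leP 0 k) => k0.
        by apply: integral_ge0 => y _; rewrite -EFinM lee_fin mulr_ge0.
      rewrite integral0_eq// => y _.
      by rewrite preimage_nnfun0// indicE in_set0 mule0.
    apply: eq_fsbigr => k /set_mem [y _ <-].
    rewrite ge0_integralZl_EFin//.
    + rewrite QW// ge0_integralZl_EFin//.
        by rewrite integral_indic// setIT muleCA.
      by apply/measurable_EFinP; exact: mI.
    + by move=> w _; rewrite lee_fin mulr_ge0.
    + by apply/measurable_EFinP; exact: mWI.
  - move=> k; apply/measurable_EFinP/measurable_funM => //.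
  - move=> k y _; exact: nnfun_muleindic_ge0.
  - by move=> k; apply/measurable_EFinP/measurable_funM.
  - move=> k w _; rewrite -EFinM lee_fin.
    have := nnfun_muleindic_ge0 (g n) k (Y w).
    by rewrite -EFinM lee_fin mulrCA => ?; rewrite mulr_ge0.
have gcvg y : (EFin \o (g ^~ y)) @ \oo --> (f y)%:E.
  by apply: (cvg_nnsfun_approx measurableT mEf) => // x _; rewrite lee_fin.
have ndg y : {homo g ^~ y : n m / (n <= m)%N >-> n <= m}.
  by move=> n m nm; exact/lefP/nd_nnsfun_approx.
have L : (\int[Q]_w (W w * g n (Y w))%:E)%E @[n --> \oo] -->
         (\int[Q]_w (W w * f (Y w))%:E)%E.
  have -> : (\int[Q]_w (W w * f (Y w))%:E =
            \int[Q]_w limn (fun n => (W w * g n (Y w))%:E))%E.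
    apply: eq_integral => w _; apply/esym/cvg_lim => //.
    have -> : (fun n => (W w * g n (Y w))%:E) =
              (fun n => ((W w)%:E * (EFin \o g ^~ (Y w)) n)%E) by [].
    by rewrite EFinM; apply: cvgeZl => //; exact: gcvg.
  apply: cvg_monotone_convergence => //.
  - by move=> n; exact/measurable_EFinP.
  - by move=> n w _; rewrite lee_fin mulr_ge0.
  - by move=> w _ n m nm; rewrite lee_fin ler_wpM2l// ndg.
have L' : (\int[nu]_y (g n y)%:E)%E @[n --> \oo] --> (\int[nu]_y (f y)%:E)%E.
  have -> : (\int[nu]_y (f y)%:E = \int[nu]_y limn (fun n => (g n y)%:E))%E.
    by apply: eq_integral => y _; apply/esym/cvg_lim => //; exact: gcvg.
  apply: cvg_monotone_convergence => //.
  - by move=> n; exact/measurable_EFinP.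
  - by move=> n w _; rewrite lee_fin.
  - by move=> w _ n m nm; rewrite lee_fin ndg.
have L2 : (C%:E * \int[nu]_y (g n y)%:E)%E @[n --> \oo] -->
          (C%:E * \int[nu]_y (f y)%:E)%E by exact: cvgeZl.
rewrite -(funext step) in L2.
exact: cvg_unique L L2.
Qed.

End Density.

Section Independence.
Context d (T : measurableType d) d' (S : measurableType d') (R : realType).
Context (K : finType).
Variables (Q : {measure set T -> \bar R}) (c : R) (X : K -> T -> S).
Variable nu : K -> probability S R.

(* [Q] is only a finite measure, of mass [c]: this covers the restriction of a
   probability to an event, without normalisation. *)
Definition indep_family : Prop :=
  forall B : K -> set S, (forall k, measurable (B k)) ->
    Q (\bigcap_(k in [set: K]) (X k @^-1` B k)) =
    (c%:E * \prod_(k : K) nu k (B k))%E.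

Hypothesis mX : forall k, measurable_fun setT (X k).
Hypothesis indX : indep_family.

(** Induction on the list [r] of indices whose factor need not be an indicator; with none left the
    claim is [indX]. For [a :: r], the induction hypothesis with [f a] replaced by [\1_B] is the
    hypothesis of [ge0_integral_density] for the weight [W], which then restores [f a]. *)
Let integral_prod_rec (r : seq K) (f : K -> S -> R) (I : K -> R) :
  (forall k, measurable_fun setT (f k)) -> (forall k x, 0 <= f k x) ->
  (forall k, (\int[nu k]_x (f k x)%:E = (I k)%:E)%E) ->
  (forall k, k \notin r -> exists2 B, measurable B & f k = \1_B) ->
  (\int[Q]_w (\prod_k f k (X k w))%:E = (c * \prod_k I k)%:E)%E.
Proof.
elim: r f I => [|a r IH] f I mf f0 fI fB.
  have [B BP] : {B : K -> set S & forall k, measurable (B k) /\ f k = \1_(B k)}.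
    apply: (@choice _ _ (fun k B => measurable B /\ f k = \1_B)) => k.
    by have [//|B mB fk] := fB k; exists B.
  have -> : (\int[Q]_w (\prod_k f k (X k w))%:E =
      \int[Q]_w (\1_(\bigcap_(k in [set: K]) (X k @^-1` B k)) w)%:E)%E.
    apply: eq_integral => w _; congr EFin.
    rewrite (eq_bigr (fun k => \1_(B k) (X k w))); last first.
      by move=> k _; rewrite (BP k).2.
    rewrite [RHS]indicE; have [/set_mem wB|/negP wB] := boolP (w \in _).
      rewrite big1// => k _; rewrite indicE mem_set//; exact: wB.
    have [k wk] : exists k, ~ B k (X k w).
      by apply/existsNP => h; apply: wB; apply/mem_set => k _; exact: h.
    by rewrite (bigD1 k)//= indicE memNset// mul0r.
  have mBX : measurable (\bigcap_(k in [set: K]) (X k @^-1` B k)).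
    apply: fin_bigcap_measurable => // k _.
    rewrite -[X in measurable X]setTI; apply: mX => //; exact: (BP k).1.
  rewrite integral_indic// setIT indX; last by move=> k; exact: (BP k).1.
  rewrite EFinM; congr *%E; rewrite -prodEFin; apply: eq_bigr => k _.
  rewrite -fI (BP k).2 integral_indic ?setIT//; exact: (BP k).1.
pose W w := \prod_(k | k != a) f k (X k w).
have I0 k : 0 <= I k.
  by rewrite -lee_fin -fI; apply: integral_ge0 => x _; rewrite lee_fin.
have mfX k : measurable_fun setT (fun w => f k (X k w)).
  exact: measurableT_comp.
have mW : measurable_fun setT W.
  rewrite /W; under eq_fun do rewrite -big_filter.
  by apply: measurable_prod => k _.
have W0 w : 0 <= W w by apply: prodr_ge0.
have QW B : measurable B -> (\int[Q]_w (W w * \1_B (X a w))%:E =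
    (c * \prod_(k | k != a) I k)%:E * nu a B)%E.
  move=> mB.
  pose f' k := if k == a then \1_B else f k.
  pose I' k := if k == a then fine (nu a B) else I k.
  have := IH f' I'.
  rewrite (bigD1 a)//= {2}/I' eqxx.
  rewrite (eq_bigr I); last by move=> k /negPf ka; rewrite /I' ka.
  have -> : (\int[Q]_w (\prod_k f' k (X k w))%:E =
             \int[Q]_w (W w * \1_B (X a w))%:E)%E.
    apply: eq_integral => w _; rewrite (bigD1 a)//= {1}/f' eqxx mulrC.
    congr (_ * _)%:E; apply: eq_bigr => k /negPf ka; by rewrite /f' ka.
  move=> ->.
  - by rewrite mulrCA mulrC EFinM fineK// fin_num_measure.
  - by move=> k; rewrite /f'; case: ifP => // _; exact: measurable_indic.
  - by move=> k x; rewrite /f'; case: ifP => // _; rewrite indicE.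
  - move=> k; rewrite /f' /I'; case: eqP => [->|//].
    by rewrite integral_indic// setIT fineK// fin_num_measure.
  - move=> k kr; rewrite /f'; case: eqP => [_|ka]; first by exists B.
    by apply: fB; rewrite inE negb_or kr andbT; apply/eqP.
have := ge0_integral_density mW W0 (mX a) QW (mf a) (f0 a).
rewrite fI -EFinM => H.
rewrite (bigD1 a)//= mulrCA mulrC -H.
by apply: eq_integral => w _; rewrite (bigD1 a)//= mulrC.
Qed.

Lemma ge0_integral_indep (f : K -> S -> R) (I : K -> R) :
  (forall k, measurable_fun setT (f k)) -> (forall k x, 0 <= f k x) ->
  (forall k, (\int[nu k]_x (f k x)%:E = (I k)%:E)%E) ->
  (\int[Q]_w (\prod_k f k (X k w))%:E = (c * \prod_k I k)%:E)%E.
Proof.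
move=> mf f0 fI; apply: (@integral_prod_rec (enum K)) => // k.
by rewrite mem_enum.
Qed.

End Independence.

(** * Exponential moments of the standard normal law *)

Section GaussianIntegrals.
Context (R : realType).
Local Notation gamma := (normal_prob (0 : R) 1).

Lemma integral_normal_prob (f : R -> R) : measurable_fun setT f ->
  (forall x, 0 <= f x) ->
  (\int[gamma]_x (f x)%:E =
   \int[lebesgue_measure]_x (normal_pdf 0 1 x * f x)%:E)%E.
Proof.
move=> mf f0; rewrite -[LHS]mul1e; apply/esym.
apply: (@ge0_integral_density _ _ _ _ _ lebesgue_measure gamma
  (normal_pdf 0 1) id 1) => //.
- exact: measurable_normal_pdf.
- by move=> x; exact: normal_pdf_ge0.
move=> B mB; rewrite mul1e /normal_prob [RHS]integral_mkcond.
apply: eq_integral => x _; rewrite patchE indicE; case: (x \in B); by rewrite ?mulr1 ?mulr0.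
Qed.

Lemma normal_pdf01E (x : R) :
  normal_pdf 0 1 x = (Num.sqrt (pi *+ 2))^-1 * expR (- x ^+ 2 / 2).
Proof.
rewrite normal_pdfE ?oner_eq0//; rewrite /normal_peak /normal_fun subr0.
by rewrite expr1n mul1r.
Qed.

Lemma integral_gauss_expR (h : R) :
  (\int[gamma]_x (expR (h * x))%:E = (expR (h ^+ 2 / 2))%:E)%E.
Proof.
rewrite integral_normal_prob; last 2 first.
- by apply: measurableT_comp => //; exact: measurable_funM.
- by move=> x; exact: expR_ge0.
(* Completing the square: the tilted density is a multiple of that of N(h, 1). *)
transitivity (\int[lebesgue_measure]_x
    ((expR (h ^+ 2 / 2))%:E * (normal_pdf h 1 x)%:E))%E; last first.
  rewrite ge0_integralZl_EFin//= ?integral_normal_pdf ?mule1//.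
  - by move=> x _; rewrite lee_fin normal_pdf_ge0.
  - by apply/measurable_EFinP; exact: measurable_normal_pdf.
apply: eq_integral => x _; rewrite -EFinM; congr EFin.
rewrite normal_pdf01E normal_pdfE ?oner_eq0// /normal_peak /normal_fun.
rewrite expr1n mul1r mulrCA -!mulrA; congr (_ * _).
by rewrite -!expRD; congr expR; field.
Qed.

Lemma measurable_expR_sqr (l : R) :
  measurable_fun setT (fun x : R => expR (l * x ^+ 2)).
Proof.
by apply: measurableT_comp => //; exact: measurable_funM.
Qed.

Lemma integral_gauss_expR_sqr (l : R) : l < 2^-1 ->
  (\int[gamma]_x (expR (l * x ^+ 2))%:E = ((Num.sqrt (1 - 2 * l))^-1)%:E)%E.
Proof.
move=> l2; have l0 : 0 < 1 - 2 * l by lra.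
rewrite integral_normal_prob//; last exact: measurable_expR_sqr.
(* The tilted density is [s] times that of N(0, s^2). *)
pose s := (Num.sqrt (1 - 2 * l))^-1.
have s0 : 0 < s by rewrite invr_gt0 sqrtr_gt0.
have s2 : s ^+ 2 = (1 - 2 * l)^-1.
  by rewrite exprVn sqr_sqrtr// ltW.
transitivity (\int[lebesgue_measure]_x (s%:E * (normal_pdf 0 s x)%:E))%E; last first.
  rewrite ge0_integralZl_EFin//= ?integral_normal_pdf ?mule1//.
  - by move=> x _; rewrite lee_fin normal_pdf_ge0.
  - by apply/measurable_EFinP; exact: measurable_normal_pdf.
  - exact: ltW.
apply: eq_integral => x _; rewrite -EFinM; congr EFin.
rewrite normal_pdf01E normal_pdfE ?gt_eqF// /normal_peak /normal_fun subr0.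
rewrite -mulrnAr sqrtrM ?sqr_ge0// sqrtr_sqr gtr0_norm// invfM.
rewrite !mulrA divff ?gt_eqF// mul1r -!mulrA; congr (_ * _).
rewrite -expRD; congr expR.
rewrite s2 -[X in _ = X]mulr1.
by field; rewrite gt_eqF.
Qed.

End GaussianIntegrals.

(** * Gaussian tail bounds *)

Section Exponential.
Context (R : realType).
Implicit Types x : R.

(** Square of [1 + x / 2 <= expR (x / 2)]. This quadratic growth is what later lets a power of p
    beat ln p. *)
Lemma expR_ge_sqr x : 0 <= x -> (1 + x / 2) ^+ 2 <= expR x.
Proof.
move=> x0; rewrite {2}(splitr x) expRD -expr2 lerXn2r ?nnegrE ?expR_ge0//.
- by rewrite addr_ge0// divr_ge0.
- exact: expR_ge1Dx.
Qed.

(** Bounds the chi-square moment generating function. After squaring, the claim is 1 <= (1 - 2x)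
    exp(2x + 4x^2). For x < 0 the linear bound on exp suffices, since (1 - 2x)(1 + 2x + 4x^2) = 1 -
    8x^3; for x >= 0 the quadratic one is used. *)
Lemma inv_sqrt_le_expR x : - 8^-1 <= x -> x <= 8^-1 ->
  (Num.sqrt (1 - 2 * x))^-1 <= expR (x + 2 * x ^+ 2).
Proof.
move=> xl xu; have x1 : 0 < 1 - 2 * x by lra.
have E0 := expR_gt0 (x + 2 * x ^+ 2).
suff h : 1 <= (1 - 2 * x) * expR (2 * (x + 2 * x ^+ 2)).
  rewrite -(@ler_pXn2r _ 2) ?nnegrE ?invr_ge0 ?sqrtr_ge0 ?(ltW E0)//.
  rewrite exprVn sqr_sqrtr ?(ltW x1)// -[X in X <= _]mul1r ler_pdivrMr//.
  by rewrite mulrC -expRM_natl.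
have [x0|x0] := leP 0 x.
  apply: (le_trans _ (ler_wpM2l (ltW x1) (expR_ge_sqr _))); last by nra.
  by nra.
apply: (le_trans _ (ler_wpM2l (ltW x1) (expR_ge1Dx _))).
by nra.
Qed.

Lemma inv_sqrt_ge_expR x : x < 2^-1 -> expR x <= (Num.sqrt (1 - 2 * x))^-1.
Proof.
move=> x2; have x1 : 0 < 1 - 2 * x by lra.
rewrite -[leLHS]invrK lef_pV2 ?posrE ?sqrtr_gt0 ?invr_gt0 ?expR_gt0//.
rewrite -(@ler_pXn2r _ 2) ?nnegrE ?sqrtr_ge0 ?invr_ge0 ?expR_ge0//.
rewrite sqr_sqrtr ?(ltW x1)// -expRN -expRM_natl.
apply: le_trans (expR_ge1Dx _).
by lra.
Qed.

End Exponential.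

Section Chernoff.
Context d (T : measurableType d) (R : realType) (Q : {measure set T -> \bar R}).

Lemma measurable_ge_set (f : T -> R) (a : R) : measurable_fun setT f ->
  measurable [set w | a <= f w].
Proof.
move=> mf; rewrite (_ : [set _ | _] = setT `&` f @^-1` `[a, +oo[%classic).
  exact: mf.
by rewrite setTI; apply/seteqP; split => w; rewrite /= in_itv/= andbT.
Qed.

Lemma markov_measure (f : T -> R) (M a : R) : measurable_fun setT f ->
  (forall w, 0 <= f w) -> 0 < a -> (\int[Q]_w (f w)%:E <= M%:E)%E ->
  (Q [set w | (a <= f w)%R] <= (M / a)%:E)%E.
Proof.
move=> mf f0 a0 fM; pose A := [set w | a <= f w].
have mA : measurable A by exact: measurable_ge_set.
rewrite EFinM -lee_pdivrMr ?invr_gt0// invrK.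
apply: le_trans fM; rewrite muleC -/A -(integral_cst Q mA).
have mEf (D : set T) : measurable_fun D (EFin \o f).
  by apply/measurable_EFinP; exact: measurable_funTS.
apply: (@le_trans _ _ (\int[Q]_(w in A) (f w)%:E)%E).
  apply: ge0_le_integral => //.
  by move=> w _; rewrite lee_fin ltW.
apply: ge0_subset_integral => //.
by move=> w _; rewrite lee_fin.
Qed.

Lemma chernoff_measure (F : T -> R) (M r : R) : measurable_fun setT F ->
  (\int[Q]_w (expR (F w))%:E <= M%:E)%E ->
  (Q [set w | (r <= F w)%R] <= (M * expR (- r))%:E)%E.
Proof.
move=> mF FM; rewrite expRN.
have -> : [set w | r <= F w] = [set w | expR r <= expR (F w)].
  by apply/seteqP; split => w /=; rewrite ler_expR.
apply: markov_measure FM; rewrite ?expR_gt0//.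
exact: measurableT_comp.
Qed.

End Chernoff.

Section GaussianFamily.
Context d (T : measurableType d) (R : realType) (K : finType).
Variables (Q : {finite_measure set T -> \bar R}) (c : R) (Z : K -> T -> R).
Hypotheses (c_ge0 : 0 <= c) (mZ : forall k, measurable_fun setT (Z k)).
Hypothesis gaussZ : @indep_family _ _ _ (measurableTypeR R) _ _ Q c Z (fun=> normal_prob 0 1).

Definition lin_comb (b : K -> R) (w : T) : R := \sum_k b k * Z k w.

Lemma measurable_lin_comb b : measurable_fun setT (lin_comb b).
Proof. by apply: measurable_sum => k; exact: measurable_funM. Qed.

Lemma lin_combD (b b' : K -> R) (t : R) w :
  lin_comb (fun k => b k + t * b' k) w = lin_comb b w + t * lin_comb b' w.
Proof.
rewrite /lin_comb mulr_sumr -big_split/=; apply: eq_bigr => k _.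
by rewrite mulrDl mulrA.
Qed.

Lemma gauss_mgf_lin (b : K -> R) :
  (\int[Q]_w (expR (lin_comb b w))%:E =
   (c * expR (2^-1 * \sum_k b k ^+ 2))%:E)%E.
Proof.
under eq_integral do rewrite expR_sum.
rewrite (@ge0_integral_indep _ _ _ (measurableTypeR R) _ _ _ _ _ _ mZ gaussZ
  (fun k x => expR (b k * x)) (fun k => expR (b k ^+ 2 / 2))).
- rewrite -expR_sum mulr_sumr; congr (_ * expR _)%:E.
  by apply: eq_bigr => k _; rewrite mulrC.
- by move=> k; apply: measurableT_comp => //; exact: measurable_funM.
- by move=> k x; exact: expR_ge0.
- by move=> k; exact: integral_gauss_expR.
Qed.

Lemma gauss_mgf_sum_sqr (l : K -> R) : (forall k, l k < 2^-1) ->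
  (\int[Q]_w (expR (\sum_k l k * Z k w ^+ 2))%:E =
   (c * \prod_k (Num.sqrt (1 - 2 * l k))^-1)%:E)%E.
Proof.
move=> l2; under eq_integral do rewrite expR_sum.
rewrite (@ge0_integral_indep _ _ _ (measurableTypeR R) _ _ _ _ _ _ mZ gaussZ
  (fun k x => expR (l k * x ^+ 2)) (fun k => (Num.sqrt (1 - 2 * l k))^-1)) //.
- by move=> k; exact: measurable_expR_sqr.
- by move=> k; exact: integral_gauss_expR_sqr.
Qed.

Section Orthogonal.
Variables (J : eqType) (C : J -> K -> R) (v : J -> R).
Hypothesis vE : forall j, \sum_k C j k ^+ 2 = v j.
Hypothesis orthC : forall i j, i != j -> \sum_k C i k * C j k = 0.

(* Linearisation [expR (l A^2) = E_g expR (sqrt(2 l) g A)], [g ~ N(0,1)]: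
   adjoining one auxiliary Gaussian at a time reduces the quadratic forms to
   the linear case, without knowing the joint law of the [lin_comb (C j)]. *)
Lemma gauss_mgf_quad (l : R) (r : seq J) (b : K -> R) : 0 <= l ->
  uniq r -> (forall j, j \in r -> l * v j < 2^-1) ->
  (forall j, j \in r -> \sum_k C j k * b k = 0) ->
  (\int[Q]_w (expR (\sum_(j <- r) l * lin_comb (C j) w ^+ 2 + lin_comb b w))%:E
   = (c * (\prod_(j <- r) (Num.sqrt (1 - 2 * (l * v j)))^-1
           * expR (2^-1 * \sum_k b k ^+ 2)))%:E)%E.
Proof.
move=> l0; elim: r b => [|j r IH] b.
  move=> _ _ _; rewrite big_nil mul1r.
  by under eq_integral do rewrite big_nil add0r; exact: gauss_mgf_lin.
move=> /=/andP[jr ur] lv bC.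
pose s := Num.sqrt (2 * l).
have s2 : s ^+ 2 = 2 * l by rewrite sqr_sqrtr// mulr_ge0.
pose f (x : T * R) := expR (\sum_(j <- r) l * lin_comb (C j) x.1 ^+ 2
  + lin_comb (fun k => b k + (s * x.2) * C j k) x.1).
have mf : measurable_fun setT f.
  apply: measurableT_comp => //; apply: measurable_funD.
    apply: measurable_sum => i; apply: measurable_funM => //.
    apply: measurable_funX; apply: measurableT_comp => //.
    exact: measurable_lin_comb.
  under eq_fun do rewrite lin_combD.
  apply: measurable_funD.
    by apply: measurableT_comp => //; exact: measurable_lin_comb.
  apply: measurable_funM.
    by apply: measurable_funM => //.
  by apply: measurableT_comp => //; exact: measurable_lin_comb.
transitivity (\int[Q]_w \int[normal_prob (0 : R) 1]_g (f (w, g))%:E)%E.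
  apply: eq_integral => w _.
  transitivity (\int[normal_prob (0 : R) 1]_g
      ((expR (\sum_(j <- r) l * lin_comb (C j) w ^+ 2 + lin_comb b w))%:E
       * (expR ((s * lin_comb (C j) w) * g))%:E))%E; last first.
    apply: eq_integral => g _; rewrite -EFinM -expRD /f/= lin_combD.
    by congr (expR _)%:E; rewrite -addrA; congr (_ + (_ + _)); ring.
  rewrite ge0_integralZl_EFin//=.
  - rewrite integral_gauss_expR -EFinM -expRD exprMn s2 big_cons.
    by congr (expR _)%:E; field.
  - by apply/measurable_EFinP; apply: measurableT_comp => //; exact: measurable_funM.
rewrite (@fubini_tonelli _ _ _ _ _ Q (normal_prob 0 1) (EFin \o f))//; last 2 first.
- exact/measurable_EFinP.
- by move=> x; rewrite lee_fin expR_ge0.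
have vj : l * v j < 2^-1 by apply: lv; rewrite inE eqxx.
pose p := \prod_(j <- r) (Num.sqrt (1 - 2 * (l * v j)))^-1.
pose S := 2^-1 * \sum_k b k ^+ 2.
(* For fixed [g] the tilt [s * g * C j] is orthogonal to the remaining forms, so the induction
   hypothesis applies; it is also orthogonal to [b], so the squared norm has no cross term and
   contributes [l * v j * g ^+ 2]. *)
have fE g : (\int[Q]_w (f (w, g))%:E =
    (c * (p * expR S))%:E * (expR ((l * v j) * g ^+ 2))%:E)%E.
  rewrite /f/= (IH (fun k => b k + s * g * C j k) ur); last 2 first.
  - by move=> i ir; apply: lv; rewrite inE ir orbT.
  - move=> i ir; under eq_bigr do rewrite mulrDr mulrCA.
    rewrite big_split/= -mulr_sumr bC ?inE ?ir ?orbT// orthC ?mulr0 ?addr0//.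
    by apply: contraNneq jr => <-.
  rewrite -EFinM -!mulrA -expRD -/p; congr (_ * (_ * expR _))%:E.
  under eq_bigr do rewrite sqrrD exprMn.
  rewrite !big_split/= /S.
  have -> : \sum_k b k * (s * g * C j k) = 0.
    rewrite (eq_bigr (fun k => s * g * (C j k * b k))).
      by rewrite -mulr_sumr bC ?inE ?eqxx// mulr0.
    by move=> k _; rewrite mulrCA [b k * _]mulrC.
  by rewrite -mulr_sumr vE exprMn s2; field.
under eq_integral => g _ do rewrite /= fE.
rewrite ge0_integralZl_EFin//=.
- by rewrite integral_gauss_expR_sqr// -EFinM big_cons -/p; congr EFin; ring.
- by apply/measurable_EFinP; exact: measurable_expR_sqr.
- rewrite !mulr_ge0 ?expR_ge0//.
  by apply: prodr_ge0 => i _; rewrite invr_ge0 sqrtr_ge0.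
Qed.

End Orthogonal.
End GaussianFamily.

Lemma prodr_const_seq (R : pzSemiRingType) (I : Type) (r : seq I) (x : R) :
  \prod_(i <- r) x = x ^+ size r.
Proof. by rewrite big_const_seq count_predT iter_mulr_1. Qed.

Section GaussianTails.
Context d (T : measurableType d) (R : realType).
Variables (Q : {finite_measure set T -> \bar R}) (c : R).
Hypothesis c_ge0 : 0 <= c.

Section Family.
Variables (K : finType) (Z : K -> T -> R).
Hypothesis mZ : forall k, measurable_fun setT (Z k).
Hypothesis gaussZ :
  @indep_family _ _ _ (measurableTypeR R) _ _ Q c Z (fun=> normal_prob 0 1).

Lemma gauss_mass : Q setT = c%:E.
Proof.
have := gauss_mgf_lin mZ gaussZ (fun=> 0).
rewrite big1 ?mulr0 ?expR0 ?mulr1; last by move=> k _; rewrite expr0n.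
move=> <-; rewrite -[LHS]mul1e -integral_cst//; apply: eq_integral => w _.
by rewrite /lin_comb big1 ?expR0// => k _; rewrite mul0r.
Qed.

Lemma gauss_tail_lin (b : K -> R) (V t : R) : \sum_k b k ^+ 2 <= V ->
  0 < V -> 0 <= t ->
  (Q [set w | (t <= lin_comb Z b w)%R] <= (c * expR (- t ^+ 2 / (2 * V)))%:E)%E.
Proof.
(* [h] minimises h^2 V / 2 - h t. At [t = 0] it vanishes and cannot rescale the event; there the
   bound is the total mass. *)
move=> bV V0 t0; pose h := t / V.
have [->|tn0] := eqVneq t 0.
  rewrite expr0n/= oppr0 mul0r expR0 mulr1 -gauss_mass.
  apply: le_measure; rewrite ?inE//.
  exact/measurable_ge_set/measurable_lin_comb.
have tp : 0 < t by rewrite lt0r tn0.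
have h0 : 0 < h by rewrite divr_gt0.
have -> : [set w | (t <= lin_comb Z b w)%R] =
    [set w | (h * t <= lin_comb Z (fun k => h * b k) w)%R].
  have E w : lin_comb Z (fun k => h * b k) w = h * lin_comb Z b w.
    by rewrite /lin_comb mulr_sumr; apply: eq_bigr => k _; rewrite mulrA.
  by apply/seteqP; split => w /=; rewrite E ler_pM2l.
have H := gauss_mgf_lin mZ gaussZ (fun k => h * b k).
have H' : (\int[Q]_w (expR (lin_comb Z (fun k => h * b k) w))%:E <=
    (c * expR (2^-1 * \sum_k (h * b k) ^+ 2))%:E)%E by rewrite H.
apply: le_trans (chernoff_measure (h * t) (measurable_lin_comb mZ _) H') _.
rewrite lee_fin -mulrA ler_wpM2l// -expRD ler_expR.
under eq_bigr do rewrite exprMn.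
rewrite -mulr_sumr.
apply: (@le_trans _ _ (2^-1 * (h ^+ 2 * V) - h * t)).
  by rewrite lerD2r ler_wpM2l// ler_wpM2l// sqr_ge0.
rewrite le_eqVlt; apply/orP; left; apply/eqP; rewrite /h.
by field; rewrite gt_eqF.
Qed.

Section Orthogonal.
Variables (J : eqType) (C : J -> K -> R) (v : J -> R).
Hypothesis vE : forall j, \sum_k C j k ^+ 2 = v j.
Hypothesis orthC : forall i j, i != j -> \sum_k C i k * C j k = 0.

Definition sum_sqr (r : seq J) (w : T) := \sum_(j <- r) lin_comb Z (C j) w ^+ 2.

Lemma measurable_sum_sqr r : measurable_fun setT (sum_sqr r).
Proof.
apply: measurable_sum => j; apply: measurable_funX.
exact: measurable_lin_comb.
Qed.

Lemma gauss_mgf_sum_sqr_orth (l : R) (r : seq J) : 0 <= l -> uniq r ->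
  (forall j, j \in r -> l * v j < 2^-1) ->
  (\int[Q]_w (expR (l * sum_sqr r w))%:E =
   (c * \prod_(j <- r) (Num.sqrt (1 - 2 * (l * v j)))^-1)%:E)%E.
Proof.
move=> l0 ur lv.
have := @gauss_mgf_quad _ _ _ _ _ _ _ c_ge0 mZ gaussZ _ _ _ vE orthC l r
  (fun=> 0) l0 ur lv.
rewrite [X in expR (_ * X)]big1 ?mulr0 ?expR0 ?mulr1; last first.
  by move=> k _; rewrite expr0n.
move=> <-; last by move=> j _; rewrite big1// => k _; rewrite mulr0.
apply: eq_integral => w _; rewrite /lin_comb [X in _ + X]big1 ?addr0 ?mulr_sumr//.
by move=> k _; rewrite mul0r.
Qed.

Lemma gauss_tail_sum_sqr (l v0 t : R) (r : seq J) : 0 <= l -> uniq r ->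
  (forall j, v j <= v0) -> 0 <= v0 -> l * v0 <= 8^-1 ->
  (Q [set w | (t <= sum_sqr r w)%R] <=
   (c * expR ((size r)%:R * (l * v0 + 2 * (l * v0) ^+ 2) - l * t))%:E)%E.
Proof.
move=> l0 ur vv0 v00 lv0.
have [l0'|ln0] := eqVneq l 0.
  rewrite l0' !mul0r expr0n mulr0 addr0 mulr0 subr0 expR0 mulr1 -gauss_mass.
  by apply: le_measure; rewrite ?inE//; exact/measurable_ge_set/measurable_sum_sqr.
have lp : 0 < l by rewrite lt0r ln0.
have lv j : l * v j <= l * v0 by rewrite ler_wpM2l.
have vj0 j : 0 <= l * v j by rewrite mulr_ge0// -vE sumr_ge0// => k _; exact: sqr_ge0.
have -> : [set w | (t <= sum_sqr r w)%R] = [set w | (l * t <= l * sum_sqr r w)%R].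
  by apply/seteqP; split => w /=; rewrite ler_pM2l.
rewrite expRD mulrA; apply: chernoff_measure.
  by apply: measurable_funM => //; exact: measurable_sum_sqr.
rewrite gauss_mgf_sum_sqr_orth//; last first.
  by move=> j _; apply: le_lt_trans (lv j) _; apply: le_lt_trans lv0 _; lra.
rewrite lee_fin ler_wpM2l// expRM_natl -prodr_const_seq.
apply: ler_prod => j _; rewrite invr_ge0 sqrtr_ge0/=.
apply: le_trans (inv_sqrt_le_expR _ _) _.
- by apply: le_trans (vj0 j); lra.
- exact: le_trans lv0.
by rewrite ler_expR lerD// ler_wpM2l// lerXn2r ?nnegrE// (le_trans (vj0 j)).
Qed.

(* Chebyshev's inequality for [expR (l (A - N))] around [1]: a lower tail
   bound that only uses exponential moments of positive order. *)
Lemma gauss_lower_tail_sum_sqr (l t : R) (r : seq J) : 0 <= l -> l <= 16^-1 ->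
  uniq r -> (forall j, v j = 1) -> ln 2 <= l * t ->
  (Q [set w | (sum_sqr r w <= (size r)%:R - t)%R] <=
   (c * (4 * (expR (8 * l ^+ 2 * (size r)%:R) - 1)))%:E)%E.
Proof.
move=> l0 l16 ur v1 lt2.
pose N : R := (size r)%:R.
pose W w := expR (l * sum_sqr r w - l * N).
have mW : measurable_fun setT W.
  apply: measurableT_comp => //; apply: measurable_funB => //.
  by apply: measurable_funM => //; exact: measurable_sum_sqr.
have W0 w : 0 <= W w by exact: expR_ge0.
have IW (k : R) : 0 <= k -> k < 2^-1 ->
    (\int[Q]_w (expR (k * sum_sqr r w - k * N))%:E =
     (c * ((Num.sqrt (1 - 2 * k))^-1 ^+ size r * expR (- (k * N))))%:E)%E.
  move=> k0 k2; under eq_integral do rewrite expRD mulrC EFinM.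
  rewrite ge0_integralZl_EFin ?expR_ge0//=; last first.
    apply/measurable_EFinP; apply: measurableT_comp => //.
    by apply: measurable_funM => //; exact: measurable_sum_sqr.
  rewrite gauss_mgf_sum_sqr_orth//; last by move=> j _; rewrite v1 mulr1.
  under eq_bigr do rewrite v1 mulr1.
  by rewrite prodr_const_seq -EFinM; congr EFin; ring.
have m1 : 1 <= (Num.sqrt (1 - 2 * l))^-1 ^+ size r * expR (- (l * N)).
  have h : expR l ^+ size r <= (Num.sqrt (1 - 2 * l))^-1 ^+ size r.
    rewrite lerXn2r ?nnegrE ?expR_ge0 ?invr_ge0 ?sqrtr_ge0//.
    by apply: inv_sqrt_ge_expR; lra.
  apply: le_trans (ler_wpM2r (expR_ge0 _) h).
  by rewrite -expRM_natl -expRD -/N mulrC subrr expR0.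
(* The second moment doubles the parameter: [l <= 16^-1] keeps [2 * l] within the range of
   [inv_sqrt_le_expR]. *)
have m2 : (Num.sqrt (1 - 2 * (2 * l)))^-1 ^+ size r * expR (- (2 * l * N)) <=
    expR (8 * l ^+ 2 * N).
  have h : (Num.sqrt (1 - 2 * (2 * l)))^-1 ^+ size r <=
      expR (2 * l + 2 * (2 * l) ^+ 2) ^+ size r.
    rewrite lerXn2r ?nnegrE ?expR_ge0 ?invr_ge0 ?sqrtr_ge0//.
    by apply: inv_sqrt_le_expR; lra.
  apply: le_trans (ler_wpM2r (expR_ge0 _) h) _.
  by rewrite -expRM_natl -expRD -/N ler_expR; lra.
have mW2 : measurable_fun setT (fun w => (W w - 1) ^+ 2).
  by apply: measurable_funX; exact: measurable_funB.
have I2 : (\int[Q]_w ((W w - 1) ^+ 2)%:E <=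
    (c * (expR (8 * l ^+ 2 * N) - 1))%:E)%E.
  (* Integrating (W - 1)^2 + 2 W = W^2 + 1 keeps every integrand nonnegative; the subtraction
     happens once all the values are real. *)
  have EW : (\int[Q]_w ((W w - 1) ^+ 2)%:E + \int[Q]_w (2 * W w)%:E =
      \int[Q]_w (expR (2 * l * sum_sqr r w - 2 * l * N))%:E + \int[Q]_w (cst 1%:E w))%E.
    rewrite -ge0_integralD//; last 4 first.
    - by move=> w _; rewrite lee_fin sqr_ge0.
    - exact/measurable_EFinP.
    - by move=> w _; rewrite lee_fin mulr_ge0.
    - by apply/measurable_EFinP; exact: measurable_funM.
    rewrite -ge0_integralD//; last first.
      apply/measurable_EFinP; apply: measurableT_comp => //.
      by apply: measurable_funB => //; apply: measurable_funM => //; exact: measurable_sum_sqr.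
    apply: eq_integral => w _; rewrite -!EFinD; congr EFin.
    have -> : expR (2 * l * sum_sqr r w - 2 * l * N) = W w ^+ 2.
      by rewrite /W -expRM_natl; congr expR; ring.
    by ring.
  have I1 : (\int[Q]_w (cst 1%:E w) = c%:E)%E.
    by rewrite -gauss_mass -[RHS]mul1e; exact: integral_cst.
  move: EW; rewrite I1; under [X in (_ + X = _)%E]eq_integral do rewrite EFinM.
  rewrite ge0_integralZl_EFin//=; last 2 first.
  - by move=> w _; rewrite lee_fin.
  - exact/measurable_EFinP.
  rewrite IW; [|lra|lra].
  rewrite IW; [|lra|lra].
  rewrite -!EFinM -EFinD.
  case: (\int[Q]_w _)%E => [x| |]//=.
  rewrite -EFinD => -[]; rewrite lee_fin => H.
  have : x = c * ((Num.sqrt (1 - 2 * (2 * l)))^-1 ^+ size r * expR (- (2 * l * N))) + c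
     - 2 * (c * ((Num.sqrt (1 - 2 * l))^-1 ^+ size r * expR (- (l * N)))) by lra.
  move=> ->.
  have := ler_wpM2l c_ge0 m1; have := ler_wpM2l c_ge0 m2.
  by rewrite mulr1; lra.
rewrite -/N.
have -> : c * (4 * (expR (8 * l ^+ 2 * N) - 1)) = (c * (expR (8 * l ^+ 2 * N) - 1)) / 4^-1.
  by rewrite invrK; ring.
have q0 : 0 < 4^-1 :> R by [].
apply: le_trans (markov_measure mW2 (fun w => sqr_ge0 _) q0 I2).
apply: le_measure; rewrite ?inE.
- rewrite (_ : [set _ | _] = [set w | - (N - t) <= - sum_sqr r w]).
    by apply: measurable_ge_set; apply: measurableT_comp => //; exact: measurable_sum_sqr.
  by apply/seteqP; split => w /=; rewrite lerN2.
- exact: measurable_ge_set.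
move=> w /= hw.
(* On the event, [ln 2 <= l * t] forces W <= 1/2, so (W - 1)^2 >= 1/4; this is the factor 4 of the
   bound. *)
have : W w <= 2^-1.
  rewrite -[leRHS](@lnK _ 2^-1) ?posrE// lnV ?posrE// ler_expR.
  rewrite -mulrBr.
  apply: (@le_trans _ _ (l * (- t))); last by rewrite mulrN lerN2.
  by apply: ler_wpM2l => //; lra.
have := W0 w; nra.
Qed.

End Orthogonal.

Lemma gauss_mgf_col_le (A : {set K}) (l : R) : - 8^-1 <= l -> l <= 8^-1 ->
  (\int[Q]_w (expR (l * \sum_(k in A) Z k w ^+ 2))%:E <=
   (c * expR (#|A|%:R * (l + 2 * l ^+ 2)))%:E)%E.
Proof.
move=> l1 l2.
pose g k := if k \in A then l else 0.
have gl k : g k < 2^-1 by rewrite /g; case: ifP => _; lra.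
have := gauss_mgf_sum_sqr mZ gaussZ gl.
have -> : (\int[Q]_w (expR (\sum_k g k * Z k w ^+ 2))%:E =
    \int[Q]_w (expR (l * \sum_(k in A) Z k w ^+ 2))%:E)%E.
  apply: eq_integral => w _; rewrite mulr_sumr [in RHS]big_mkcond.
  congr (expR _)%:E; apply: eq_bigr => k _; rewrite /g.
  by case: ifP => // _; rewrite mul0r.
move=> ->; rewrite lee_fin ler_wpM2l// expRM_natl -prodr_const.
rewrite [leRHS]big_mkcond; apply: ler_prod => k _.
rewrite invr_ge0 sqrtr_ge0/= /g; case: ifP => _.
  exact: inv_sqrt_le_expR.
by rewrite mulr0 subr0 sqrtr1 invr1.
Qed.

End Family.
End GaussianTails.

(** * Tail bounds for a Gaussian matrix *)

Section GaussianMatrix.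
Context d (T : measurableType d) (R : realType).
Variables (Q : {finite_measure set T -> \bar R}) (c : R) (n p : nat).
Variable Z : 'I_n -> 'I_p -> T -> R.
Hypotheses (c_ge0 : 0 <= c) (mZ : forall i j, measurable_fun setT (Z i j)).
Let ZZ (k : 'I_n * 'I_p) := Z k.1 k.2.
Hypothesis gaussZ :
  @indep_family _ _ _ (measurableTypeR R) _ _ Q c ZZ (fun=> normal_prob 0 1).

Let mZZ k : measurable_fun setT (ZZ k). Proof. exact: mZ. Qed.

Let lin_combE (b : 'I_n * 'I_p -> R) w :
  lin_comb ZZ b w = \sum_i \sum_j b (i, j) * Z i j w.
Proof. by rewrite /lin_comb pair_bigA; apply: eq_bigr => -[]. Qed.

Lemma gauss_matrix_tail (b : 'I_n -> 'I_p -> R) (V t : R) :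
  \sum_i \sum_j b i j ^+ 2 <= V -> 0 < V -> 0 <= t ->
  (Q [set w | (t <= \sum_i \sum_j b i j * Z i j w)%R] <=
   (c * expR (- t ^+ 2 / (2 * V)))%:E)%E.
Proof.
move=> bV V0 t0.
have := @gauss_tail_lin _ _ _ _ _ c_ge0 _ _ mZZ gaussZ
  (fun k => b k.1 k.2) V t _ V0 t0.
by rewrite (funext (lin_combE _)) -(pair_bigA _ (fun i j => b i j ^+ 2)); apply.
Qed.

Lemma gauss_col_tail (u : 'I_n -> R) (j : 'I_p) (V t : R) :
  \sum_i u i ^+ 2 <= V -> 0 < V -> 0 <= t ->
  (Q [set w | (t <= \sum_i u i * Z i j w)%R] <=
   (c * expR (- t ^+ 2 / (2 * V)))%:E)%E.
Proof.
move=> uV V0 t0; pose b i k := if k == j then u i else 0.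
have E (f : R -> 'I_n -> 'I_p -> R) i : (forall i k, f 0 i k = 0) ->
    \sum_k f (b i k) i k = f (u i) i j.
  move=> f0; rewrite (bigD1 j)//= big1 ?addr0 /b ?eqxx// => k /negPf ->.
  exact: f0.
have bE : \sum_i \sum_k b i k ^+ 2 <= V.
  rewrite (eq_bigr (fun i => u i ^+ 2))// => i _.
  by apply: (E (fun x _ _ => x ^+ 2)) => *; rewrite expr0n.
have ZE w : \sum_i u i * Z i j w = \sum_i \sum_k b i k * Z i k w.
  apply: eq_bigr => i _; rewrite (E (fun x i k => x * Z i k w))// => *.
  by rewrite mul0r.
have -> : [set w | t <= \sum_i u i * Z i j w] =
    [set w | t <= \sum_i \sum_k b i k * Z i k w].
  by apply/seteqP; split => w /=; rewrite ZE.
exact: gauss_matrix_tail.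
Qed.

Section Columns.
Variable y : 'I_n -> R.
(** Distinct columns give coefficients with disjoint supports, hence orthogonal families. *)
Let C (j : 'I_p) (k : 'I_n * 'I_p) := if k.2 == j then y k.1 else 0.

Let lin_combC j w : lin_comb ZZ (C j) w = \sum_i y i * Z i j w.
Proof.
rewrite lin_combE; apply: eq_bigr => i _.
rewrite (bigD1 j)//= big1 ?addr0 /C/= ?eqxx// => k /negPf ->.
by rewrite mul0r.
Qed.

Let vC j : \sum_k C j k ^+ 2 = \sum_i y i ^+ 2.
Proof.
rewrite -(pair_bigA _ (fun i k => C j (i, k) ^+ 2)); apply: eq_bigr => i _ /=.
rewrite (bigD1 j)//= big1 ?addr0 /C/= ?eqxx// => k /negPf ->.
by rewrite expr0n.
Qed.

Let orthC i j : i != j -> \sum_k C i k * C j k = 0.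
Proof.
move=> ij; rewrite big1// => k _; rewrite /C; case: eqP => [->|].
  by rewrite (negPf ij) mulr0.
by rewrite mul0r.
Qed.

Let sumC (F : {set 'I_p}) w : sum_sqr ZZ C (enum F) w =
  \sum_(j in F) (\sum_i y i * Z i j w) ^+ 2.
Proof. by rewrite /sum_sqr big_enum/=; apply: eq_bigr => j _; rewrite lin_combC. Qed.

Lemma gauss_cols_upper_tail (F : {set 'I_p}) (l t : R) : 0 <= l -> l <= 8^-1 ->
  \sum_i y i ^+ 2 <= 1 ->
  (Q [set w | (t <= \sum_(j in F) (\sum_i y i * Z i j w) ^+ 2)%R] <=
   (c * expR (#|F|%:R * (l + 2 * l ^+ 2) - l * t))%:E)%E.
Proof.
move=> l0 l8 y1.
have := @gauss_tail_sum_sqr _ _ _ _ _ c_ge0 _ _ mZZ gaussZ _ C _ vC orthC l 1 t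
  (enum F) l0 (enum_uniq _) (fun=> y1) ler01.
by rewrite mulr1 -cardE (funext (sumC _)); apply.
Qed.

Lemma gauss_cols_lower_tail (F : {set 'I_p}) (l t : R) : 0 <= l -> l <= 16^-1 ->
  \sum_i y i ^+ 2 = 1 -> ln 2 <= l * t ->
  (Q [set w | (\sum_(j in F) (\sum_i y i * Z i j w) ^+ 2 <= #|F|%:R - t)%R] <=
   (c * (4 * (expR (8 * l ^+ 2 * #|F|%:R) - 1)))%:E)%E.
Proof.
move=> l0 l16 y1 lt2.
have := @gauss_lower_tail_sum_sqr _ _ _ _ _ c_ge0 _ _ mZZ gaussZ _ C _ vC orthC
  l t (enum F) l0 l16 (enum_uniq _) (fun=> y1) lt2.
by rewrite -cardE (funext (sumC _)).
Qed.

End Columns.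

(** After Cauchy-Schwarz, the interaction of signal and noise is governed by the norm of the sum of
    the signal columns of [Z]. Its n entries have variance [#|S|], and the parameter 1 / (8 [#|S|])
    is the largest one allowed. *)
Lemma gauss_rows_upper_tail (S : {set 'I_p}) (t : R) : (0 < #|S|)%N ->
  (Q [set w | (t <= \sum_i (\sum_(j in S) Z i j w) ^+ 2)%R] <=
   (c * expR (n%:R - t / (8 * #|S|%:R)))%:E)%E.
Proof.
move=> S0; have s0 : 0 < #|S|%:R :> R by rewrite ltr0n.
pose D (i : 'I_n) (k : 'I_n * 'I_p) : R := if k.1 == i then (k.2 \in S)%:R else 0.
have lD i w : lin_comb ZZ (D i) w = \sum_(j in S) Z i j w.
  rewrite lin_combE (bigD1 i)//= [X in _ + X]big1 ?addr0.
    rewrite [RHS]big_mkcond; apply: eq_bigr => j _; rewrite /D/= eqxx.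
    by case: (j \in S); rewrite ?mul1r ?mul0r.
  by move=> k ki; rewrite big1// => j _; rewrite /D/= (negPf ki) mul0r.
have vD i : \sum_k D i k ^+ 2 = #|S|%:R.
  rewrite -(pair_bigA _ (fun i' k => D i (i', k) ^+ 2)) (bigD1 i)//=.
  rewrite [X in _ + X]big1 ?addr0.
    rewrite -sum1_card natr_sum [RHS]big_mkcond; apply: eq_bigr => j _.
    by rewrite /D/= eqxx; case: (j \in S); rewrite ?expr1n ?expr0n.
  by move=> k ki; rewrite big1// => j _; rewrite /D/= (negPf ki) expr0n.
have oD i k : i != k -> \sum_x D i x * D k x = 0.
  move=> ik; rewrite big1// => x _; rewrite /D; case: eqP => [->|].
    by rewrite (negPf ik) mulr0.
  by rewrite mul0r.
pose l : R := (8 * #|S|%:R)^-1.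
have l0 : 0 <= l by rewrite invr_ge0 mulr_ge0.
have ls : l * #|S|%:R = 8^-1 by rewrite /l invfM mulfVK ?gt_eqF.
have lsle : l * #|S|%:R <= 8^-1 by rewrite ls.
have := @gauss_tail_sum_sqr _ _ _ _ _ c_ge0 _ _ mZZ gaussZ _ D _ vD oD l
  #|S|%:R t (enum 'I_n) l0 (enum_uniq _) (fun=> lexx _) (ler0n _ _) lsle.
rewrite size_enum_ord ls.
have -> : [set w | t <= sum_sqr ZZ D (enum 'I_n) w] =
    [set w | t <= \sum_i (\sum_(j in S) Z i j w) ^+ 2].
  have E w : sum_sqr ZZ D (enum 'I_n) w = \sum_i (\sum_(j in S) Z i j w) ^+ 2.
    by rewrite /sum_sqr big_enum/=; apply: eq_bigr => i _; rewrite lD.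
  by apply/seteqP; split => w /=; rewrite E.
move/le_trans; apply; rewrite lee_fin ler_wpM2l// ler_expR /l.
rewrite [in leRHS]mulrC lerD2r ler_piMr//; lra.
Qed.

Let colset (j : 'I_p) : {set 'I_n * 'I_p} := [set k | k.2 == j]%SET.

Let sum_colset j (f : 'I_n * 'I_p -> R) :
  \sum_(k in colset j) f k = \sum_i f (i, j).
Proof.
rewrite big_mkcond.
transitivity (\sum_i \sum_k if (i, k) \in colset j then f (i, k) else 0).
  by rewrite pair_bigA; apply: eq_bigr => -[].
apply: eq_bigr => i _ /=; rewrite (bigD1 j)//= inE/= eqxx big1 ?addr0// => k.
by move=> /negPf kj; rewrite inE/= kj.
Qed.

Let card_colset j : #|colset j|%:R = n%:R :> R.
Proof.
rewrite -sum1_card natr_sum (sum_colset j (fun=> 1%:R)).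
by rewrite -natr_sum sum1_card card_ord.
Qed.

Let mcol (l : R) j : measurable_fun setT (fun w => l * \sum_i Z i j w ^+ 2).
Proof.
apply: measurable_funM => //; apply: measurable_sum => i.
exact: measurable_funX.
Qed.

Let mgf_col j (l : R) : - 8^-1 <= l -> l <= 8^-1 ->
  (\int[Q]_w (expR (l * \sum_i Z i j w ^+ 2))%:E <=
   (c * expR (n%:R * (l + 2 * l ^+ 2)))%:E)%E.
Proof.
move=> l1 l2.
have := gauss_mgf_col_le c_ge0 mZZ gaussZ (colset j) l1 l2.
rewrite card_colset; apply: le_trans.
rewrite le_eqVlt; apply/orP; left; apply/eqP; apply: eq_integral => w _.
by rewrite (sum_colset j (fun k => ZZ k w ^+ 2)).
Qed.

Lemma gauss_col_sqr_upper_tail j (l t : R) : 0 < l -> l <= 8^-1 ->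
  (Q [set w | (t <= \sum_i Z i j w ^+ 2)%R] <=
   (c * expR (n%:R * (l + 2 * l ^+ 2) - l * t))%:E)%E.
Proof.
move=> l0 l8; rewrite expRD mulrA.
have -> : [set w | t <= \sum_i Z i j w ^+ 2] =
    [set w | l * t <= l * \sum_i Z i j w ^+ 2].
  by apply/seteqP; split => w /=; rewrite ler_pM2l.
by apply: chernoff_measure; [exact: mcol|apply: mgf_col => //; lra].
Qed.

Lemma gauss_col_sqr_lower_tail j (l t : R) : 0 < l -> l <= 8^-1 ->
  (Q [set w | (\sum_i Z i j w ^+ 2 <= t)%R] <=
   (c * expR (n%:R * (- l + 2 * l ^+ 2) + l * t))%:E)%E.
Proof.
move=> l0 l8; rewrite expRD mulrA -[l * t]opprK -mulNr -[in leRHS]sqrrN.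
have -> : [set w | \sum_i Z i j w ^+ 2 <= t] =
    [set w | - l * t <= - l * \sum_i Z i j w ^+ 2].
  by apply/seteqP; split => w /=; rewrite ler_nM2l// oppr_lt0.
by apply: chernoff_measure; [exact: mcol|apply: mgf_col; lra].
Qed.

End GaussianMatrix.

(** * The Rayleigh quotient of a spiked matrix *)

Section Deterministic.
Context (R : realType).

Lemma cauchy_schwarz_sum (I : finType) (a b : I -> R) :
  (\sum_i a i * b i) ^+ 2 <= (\sum_i a i ^+ 2) * (\sum_i b i ^+ 2).
Proof.
have E (x y : R) : \sum_i (a i * x - y * b i) ^+ 2 =
    x ^+ 2 * (\sum_i a i ^+ 2) - 2 * x * y * (\sum_i a i * b i)
    + y ^+ 2 * (\sum_i b i ^+ 2).
  by rewrite !mulr_sumr -sumrB -big_split/=; apply: eq_bigr => i _; ring.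
set D := \sum_i a i * b i; set A := \sum_i a i ^+ 2; set B := \sum_i b i ^+ 2.
have B0 : 0 <= B by apply: sumr_ge0 => i _; exact: sqr_ge0.
have [Bp|Bz] := ltP 0 B; last first.
  have /eqP Bz' : B == 0 by rewrite eq_le Bz.
  have b0 i : b i = 0.
    apply/eqP; rewrite -sqrf_eq0; apply/eqP.
    by apply: (psumr_eq0P (fun i _ => sqr_ge0 (b i)) Bz').
  by rewrite /D big1 ?expr0n ?Bz' ?mulr0// => i _; rewrite b0 mulr0.
have : 0 <= \sum_i (a i * B - D * b i) ^+ 2 by apply: sumr_ge0 => i _; exact: sqr_ge0.
have -> : \sum_i (a i * B - D * b i) ^+ 2 = B * (A * B - D ^+ 2).
  by rewrite E -/A -/B -/D; ring.
by rewrite pmulr_rge0// subr_ge0.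
Qed.

Section Spike.
Variables (n p : nat) (l : 'I_n -> R) (S F : {set 'I_p}) (tau : R).
Variables (Z : 'I_n -> 'I_p -> R) (xi : 'I_n -> R).
Hypotheses (n_gt0 : (0 < n)%N) (S_gt0 : (0 < #|S|)%N) (tau_gt0 : 0 < tau).
Hypotheses (l_sign : forall i, l i = 1 \/ l i = - 1) (SF : S \subset F).
Hypothesis xi_unit : \sum_i xi i ^+ 2 = 1.

Let n0 : 0 < n%:R :> R. Proof. by rewrite ltr0n. Qed.
Let s0 : 0 < #|S|%:R :> R. Proof. by rewrite ltr0n. Qed.
Let l2 i : l i ^+ 2 = 1.
Proof. by have [->|->] := l_sign i; rewrite ?sqrrN expr1n. Qed.
Let suml2 : \sum_i l i ^+ 2 = n%:R.
Proof. by under eq_bigr do rewrite l2; rewrite sumr_const card_ord. Qed.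

Let mu (j : 'I_p) : R := if j \in S then tau else 0.
Definition spiked i j := l i * mu j + Z i j.

Local Notation k := (\sum_i xi i * l i).
Local Notation G := (n%:R * #|S|%:R * tau ^+ 2).

Let k2_le : k ^+ 2 <= n%:R.
Proof. by have := cauchy_schwarz_sum xi l; rewrite xi_unit suml2 mul1r. Qed.

Let spiked_proj (u : 'I_n -> R) j :
  \sum_i u i * spiked i j = (\sum_i u i * l i) * mu j + \sum_i u i * Z i j.
Proof.
rewrite mulr_suml -big_split/=; apply: eq_bigr => i _.
by rewrite /spiked mulrDr mulrA.
Qed.

Let sum_spiked (u : 'I_n -> R) :
  \sum_(j in F) (\sum_i u i * spiked i j) ^+ 2 =
  (\sum_i u i * l i) ^+ 2 * (#|S|%:R * tau ^+ 2)
  + 2 * (\sum_i u i * l i) * tau * (\sum_i u i * (\sum_(j in S) Z i j))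
  + \sum_(j in F) (\sum_i u i * Z i j) ^+ 2.
Proof.
under eq_bigr do rewrite spiked_proj.
move: (\sum_i u i * l i) => ul.
have E1 : \sum_(j in F) mu j ^+ 2 = #|S|%:R * tau ^+ 2.
  rewrite (big_setID S)/= (finset.setIidPr SF) [X in _ + X]big1 ?addr0; last first.
    by move=> j; rewrite inE /mu => /andP[/negPf -> _]; rewrite expr0n.
  rewrite -sumr_const mulr_suml.
  by apply: eq_bigr => j jS; rewrite /mu jS mul1r.
have E2 : \sum_(j in F) mu j * \sum_i u i * Z i j =
    tau * \sum_i u i * \sum_(j in S) Z i j.
  rewrite (big_setID S)/= (finset.setIidPr SF) [X in _ + X]big1 ?addr0; last first.
    by move=> j; rewrite inE /mu => /andP[/negPf -> _]; rewrite mul0r.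
  under [in RHS]eq_bigr do rewrite mulr_sumr.
  rewrite exchange_big/= mulr_sumr.
  by apply: eq_bigr => j jS; rewrite /mu jS.
rewrite -E1 -[2 * ul * tau * _]mulrA -E2 !mulr_sumr -!big_split/=.
by apply: eq_bigr => j _; ring.
Qed.

(* The first left singular vector beats [l / sqrt n] in the Rayleigh quotient;
   expanding both sides, the signal term [G (n - k^2)] is dominated by the
   fluctuations of the noise. *)
Lemma spike_alignment (eta : R) : 0 < eta ->
  \sum_(j in F) (\sum_i l i * spiked i j) ^+ 2 <=
    n%:R * \sum_(j in F) (\sum_i xi i * spiked i j) ^+ 2 ->
  16 * n%:R * tau ^+ 2 * (\sum_i (\sum_(j in S) Z i j) ^+ 2) <= (eta * G) ^+ 2 ->
  \sum_(j in F) (\sum_i xi i * Z i j) ^+ 2 <= #|F|%:R + 2 * (eta * G) ->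
  n%:R * (#|F|%:R - eta * G) <= \sum_(j in F) (\sum_i l i * Z i j) ^+ 2 ->
  (1 - 4 * eta) * n%:R <= k ^+ 2.
Proof.
move=> eta0; rewrite !sum_spiked => opt hy ha hb.
set a := \sum_(j in F) (\sum_i xi i * Z i j) ^+ 2 in opt ha *.
set b := \sum_(j in F) (\sum_i l i * Z i j) ^+ 2 in opt hb *.
pose y i := \sum_(j in S) Z i j.
set xy := \sum_i xi i * \sum_(j in S) Z i j in opt *.
set ly := \sum_i l i * \sum_(j in S) Z i j in opt *.
have G0 : 0 < G by rewrite !mulr_gt0// exprn_gt0.
have ll : \sum_i l i * l i = n%:R.
  by rewrite -suml2; apply: eq_bigr => i _; rewrite expr2.
rewrite ll in opt.
have xy2 : xy ^+ 2 <= \sum_i y i ^+ 2.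
  by have := cauchy_schwarz_sum xi y; rewrite xi_unit mul1r.
have ly2 : ly ^+ 2 <= n%:R * \sum_i y i ^+ 2.
  by have := cauchy_schwarz_sum l y; rewrite suml2.
set h := \sum_i y i ^+ 2 in hy xy2 ly2.
have eG0 : 0 < eta * G by rewrite mulr_gt0.
have c1 : 4 * (k * tau * xy) <= eta * G.
  rewrite (le_trans (ler_norm _))// -(@ler_pXn2r _ 2) ?nnegrE ?(ltW eG0)//.
  rewrite real_normK ?num_real//; apply: le_trans hy.
  have -> : (4 * (k * tau * xy)) ^+ 2 = 16 * tau ^+ 2 * (k ^+ 2 * xy ^+ 2) by ring.
  have -> : 16 * n%:R * tau ^+ 2 * h = 16 * tau ^+ 2 * (n%:R * h) by ring.
  by rewrite ler_pM2l ?mulr_gt0 ?exprn_gt0// ler_pM ?sqr_ge0.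
have c2 : 4 * (- (tau * ly)) <= eta * G.
  rewrite (le_trans (ler_norm _))// -(@ler_pXn2r _ 2) ?nnegrE ?(ltW eG0)//.
  rewrite real_normK ?num_real//; apply: le_trans hy.
  have -> : (4 * (- (tau * ly))) ^+ 2 = 16 * tau ^+ 2 * ly ^+ 2 by ring.
  have -> : 16 * n%:R * tau ^+ 2 * h = 16 * tau ^+ 2 * (n%:R * h) by ring.
  by rewrite ler_pM2l ?mulr_gt0 ?exprn_gt0.
have c1' := ler_wpM2l (ltW n0) c1; have c2' := ler_wpM2l (ltW n0) c2.
have ha' := ler_wpM2l (ltW n0) ha.
(* Up to a factor n, the two cross terms cost [eta * G / 2] each, the noise of [xi] costs
   [2 * eta * G] above its mean and that of [l] costs [eta * G] below: [4 * eta * G] in all. *)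
have : G * (n%:R - k ^+ 2) <= G * (4 * eta * n%:R) by nra.
by rewrite ler_pM2l//; lra.
Qed.

Lemma sign_mismatch_card (eta e : R) : e = 1 \/ e = -1 -> 0 <= e * k ->
  (1 - 4 * eta) * n%:R <= k ^+ 2 ->
  #|[set i | Num.sg (e * xi i) != l i]%SET|%:R <= 8 * eta * n%:R.
Proof.
move=> e1 ek kn; pose r := Num.sqrt n%:R : R.
have r2 : r ^+ 2 = n%:R by rewrite sqr_sqrtr// ltW.
have r0 : 0 <= r by exact: sqrtr_ge0.
have e2 : e ^+ 2 = 1 by case: e1 => ->; rewrite ?sqrrN expr1n.
have ekr : e * k <= r.
  rewrite -(@ler_pXn2r _ 2) ?nnegrE// exprMn e2 mul1r r2; exact: k2_le.
(* The squared distance is 2n - 2 sqrt(n) e k; replacing sqrt(n) e k by the smaller k^2 leaves at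
   most 8 eta n. *)
have kk : k ^+ 2 <= r * (e * k).
  have -> : k ^+ 2 = (e * k) ^+ 2 by rewrite exprMn e2 mul1r.
  by rewrite expr2 ler_wpM2r.
apply: (@le_trans _ _ (\sum_i (r * (e * xi i) - l i) ^+ 2)).
  rewrite -sum1_card natr_sum big_mkcond/=; apply: ler_sum => i _.
  case: ifP => [|_]; last exact: sqr_ge0.
  rewrite inE => mism.
  have h : (e * xi i) * l i <= 0.
    case: (sgrP (e * xi i)) mism => [->|x0|x0].
    - by rewrite mul0r.
    - by case: (l_sign i) => ->; rewrite ?eqxx// mulrN1 oppr_le0 ltW.
    - by case: (l_sign i) => ->; rewrite ?eqxx// mulr1 ltW.
  have := mulr_ge0_le0 r0 h; have := sqr_ge0 (r * (e * xi i)).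
  have -> : (r * (e * xi i) - l i) ^+ 2 =
      (r * (e * xi i)) ^+ 2 - 2 * (r * (e * xi i * l i)) + l i ^+ 2 by ring.
  rewrite l2; lra.
have -> : \sum_i (r * (e * xi i) - l i) ^+ 2 =
    r ^+ 2 * e ^+ 2 * (\sum_i xi i ^+ 2) - 2 * (r * (e * k)) + \sum_i l i ^+ 2.
  rewrite !mulr_sumr -sumrB -big_split/=; apply: eq_bigr => i _; ring.
rewrite xi_unit suml2 e2 r2; lra.
Qed.

(** Here |k| >= sqrt(n) / 2, so a signal entry of the projection has size |k| tau >= 2 [th]. Off
    [Bad] the noise is below [th]: all of [S :\: Bad] votes for the sign of k, and opposite votes
    come only from [Bad], which has fewer than a quarter as many columns as [S]. *)
Lemma spike_vote (th : R) : 16 * th ^+ 2 = n%:R * tau ^+ 2 -> 0 < th ->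
  n%:R <= 4 * k ^+ 2 ->
  (4 * #|[set j | (th <= `| \sum_i xi i * Z i j |)%R]%SET| < #|S|)%N ->
  let pos := #|[set j | (th < \sum_i xi i * spiked i j)%R]%SET| in
  let neg := #|[set j | (\sum_i xi i * spiked i j < - th)%R]%SET| in
  (0 < k -> (neg < pos)%N) /\ (k < 0 -> (pos < neg)%N).
Proof.
move=> th2 th0 kn; set Bad := [set j | _]%SET => badS pos neg.
have kt : (2 * th) ^+ 2 <= (k * tau) ^+ 2.
  have := ler_wpM2r (sqr_ge0 tau) kn.
  have -> : (2 * th) ^+ 2 = (16 * th ^+ 2) / 4 by field.
  rewrite th2 [(k * tau) ^+ 2]exprMn.
  by move: (k ^+ 2) (tau ^+ 2) => x y; lra.
have SB : (#|S| - #|Bad| <= #|S :\: Bad|)%N.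
  by rewrite cardsD leq_sub2l// subset_leq_card// subsetIr.
have key (P1 P2 : {set 'I_p}) : P1 \subset Bad -> S :\: Bad \subset P2 ->
    (#|P1| < #|P2|)%N.
  move=> /subset_leq_card h1 /subset_leq_card h2.
  apply: leq_ltn_trans h1 (leq_trans _ (leq_trans SB h2)).
  rewrite ltn_subRL; apply: leq_trans badS; rewrite ltnS.
  by rewrite addnn -mul2n leq_mul2r orbT.
split=> k0.
  have ktt : 2 * th <= k * tau.
    rewrite -(@ler_pXn2r _ 2) ?nnegrE//; first by rewrite mulr_ge0// ltW.
    by rewrite mulr_ge0// ltW.
  apply: key; apply/fintype.subsetP => j; rewrite !inE spiked_proj /mu.
    case: (j \in S) => h; rewrite ler_normr; apply/orP; right; lra.
  case/andP; rewrite -ltNge ltr_norml => /andP[h1 h2] jS; rewrite jS; lra.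
have ktt : 2 * th <= - (k * tau).
  rewrite -(@ler_pXn2r _ 2) ?nnegrE ?sqrrN//; first by rewrite mulr_ge0// ltW.
  by rewrite -mulNr mulr_ge0 ?oppr_ge0// ltW.
apply: key; apply/fintype.subsetP => j; rewrite !inE spiked_proj /mu.
  case: (j \in S) => h; rewrite ler_normr; apply/orP; left; lra.
case/andP; rewrite -ltNge ltr_norml => /andP[h1 h2] jS; rewrite jS; lra.
Qed.

End Spike.
End Deterministic.

(** * Uniform control of the noise *)

Section UnionBound.
Context d (T : measurableType d) (R : realType) (Q : {measure set T -> \bar R}).

Lemma finite_union_bound (I : finType) (A : I -> set T) :
  (forall i, measurable (A i)) ->
  measurable (\bigcup_i A i) /\ (Q (\bigcup_i A i) <= \sum_i Q (A i))%E.
Proof.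
move=> mA.
have -> : \bigcup_i A i = \big[setU/set0]_(i <- enum I) A i.
  rewrite -bigcup_seq; congr bigcup; apply/seteqP; split => // i _ /=.
  by rewrite mem_enum.
rewrite -(big_enum _ _ xpredT)/=; elim: (enum I) => [|i r [mr IH]].
  by rewrite !big_nil measure0.
rewrite !big_cons; split; first exact: measurableU.
have h := @measureU2 _ _ _ Q _ _ (mA i) mr.
apply: (le_trans h).
exact: leeD2l.
Qed.

Lemma finite_union_bound_cst (I : finType) (A : I -> set T) (c x : R) :
  (forall i, measurable (A i)) -> (forall i, (Q (A i) <= (c * x)%:E)%E) ->
  (Q (\bigcup_i A i) <= (c * (#|I|%:R * x))%:E)%E.
Proof.
move=> mA Ax; apply: le_trans (finite_union_bound mA).2 _.
apply: (@le_trans _ _ (\sum_(i : I) (c * x)%:E)%E); first exact: lee_sum.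
by rewrite sumEFin sumr_const lee_fin mulrCA mulr_natl.
Qed.

End UnionBound.

Section Net.
Context (R : realType).

(** Multiples of 1/M in [-1, 1], coded by integers shifted by [M], so that the net is a finite
    type. *)
Definition grid (n M : nat) (g : {ffun 'I_n -> 'I_(2 * M).+1}) (i : 'I_n) : R :=
  ((g i : nat)%:R - M%:R) / M%:R.

(** Each coordinate is rounded towards 0: the rounded vector is then no longer than [xi] and stays
    in the unit ball, where the tail bounds apply. *)
Lemma grid_approx (n M : nat) (xi : 'I_n -> R) : (0 < M)%N ->
  (forall i, `|xi i| <= 1) ->
  exists g : {ffun 'I_n -> 'I_(2 * M).+1},
    forall i, `|xi i - grid g i| <= M%:R^-1 /\ `|grid g i| <= `|xi i|.
Proof.
move=> M0 xi1; have Mp : 0 < M%:R :> R by rewrite ltr0n.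
suff [g gP] : {g : 'I_n -> 'I_(2 * M).+1 & forall i,
    `|xi i - ((g i : nat)%:R - M%:R) / M%:R| <= M%:R^-1 /\
    `|((g i : nat)%:R - M%:R) / M%:R| <= `|xi i|}.
  by exists [ffun i => g i] => i; rewrite /grid ffunE; exact: gP.
apply: (@choice _ _ (fun i (k : 'I_(2 * M).+1) =>
  `|xi i - ((k : nat)%:R - M%:R) / M%:R| <= M%:R^-1 /\
    `|((k : nat)%:R - M%:R) / M%:R| <= `|xi i|)) => i.
pose x := `|xi i| * M%:R; have x0 : 0 <= x by rewrite mulr_ge0.
pose m := Num.truncn x.
have /andP[m1 m2] : m%:R <= x < m.+1%:R by rewrite truncn_itv.
have mM : (m <= M)%N.
  by rewrite -(ler_nat R) (le_trans m1)// /x -[leRHS]mul1r ler_pM2r.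
have m1' : m%:R / M%:R <= `|xi i| by rewrite ler_pdivrMr.
have m2' : `|xi i| - M%:R^-1 <= m%:R / M%:R.
  by rewrite lerBlDr -[X in _ + X]mul1r -mulrDl natr1 ler_pdivlMr// ltW.
have [xi0|xi0] := leP 0 (xi i).
  have km : (M + m < (2 * M).+1)%N by lia.
  exists (Ordinal km) => /=; rewrite natrD addrAC subrr add0r.
  rewrite [X in _ /\ X <= _]ger0_norm ?divr_ge0//; split=> //.
  rewrite ger0_norm// in m1' m2'.
  by rewrite ger0_norm ?subr_ge0//; lra.
have km : (M - m < (2 * M).+1)%N by lia.
exists (Ordinal km) => /=; rewrite natrB// addrAC subrr add0r mulNr normrN opprK.
rewrite [X in _ /\ X <= _]ger0_norm ?divr_ge0//; split=> //.
rewrite ltr0_norm// in m1' m2'.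
by rewrite ler_norml; apply/andP; split; lra.
Qed.

Section Transfer.
Variables (n p : nat) (Z : 'I_n -> 'I_p -> R) (xi y : 'I_n -> R).
Hypotheses (p_gt0 : (0 < p)%N) (np : (n <= p)%N).
Hypothesis ZB : forall i j, `|Z i j| <= p%:R.
Hypotheses (xi1 : forall i, `|xi i| <= 1) (yxi : forall i, `|y i| <= `|xi i|).
Hypothesis xy : forall i, `|xi i - y i| <= (p ^ 5)%:R^-1.

Let P0 : 0 < p%:R :> R. Proof. by rewrite ltr0n. Qed.

Let bound (u : 'I_n -> R) (e : R) j : 0 <= e -> (forall i, `|u i| <= e) ->
  `|\sum_i u i * Z i j| <= p%:R ^+ 2 * e.
Proof.
move=> e0 ue; apply: le_trans (ler_norm_sum _ _ _) _.
apply: (@le_trans _ _ (\sum_(i < n) e * p%:R)).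
  by apply: ler_sum => i _; rewrite normrM ler_pM.
rewrite sumr_const card_ord -[leLHS]mulr_natl expr2 [e * _]mulrC mulrA.
by rewrite ler_wpM2r// ler_wpM2r ?ler_nat// ltW.
Qed.

Lemma net_entry j :
  `|\sum_i xi i * Z i j - \sum_i y i * Z i j| <= (p ^ 3)%:R^-1.
Proof.
rewrite -sumrB; under eq_bigr do rewrite -mulrBl.
apply: le_trans (bound _ _ xy) _; first by rewrite invr_ge0.
rewrite le_eqVlt; apply/orP; left; apply/eqP.
by rewrite !natrX; field; rewrite gt_eqF.
Qed.

(** The mesh p^-5 is chosen here. With entries at most p and n <= p, rounding changes a projection
    by at most p^-3, its square by at most 2/p, and the sum over at most p columns by at most 2. *)
Lemma net_sum_sqr (F : {set 'I_p}) :
  \sum_(j in F) (\sum_i xi i * Z i j) ^+ 2 <=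
  \sum_(j in F) (\sum_i y i * Z i j) ^+ 2 + 2.
Proof.
rewrite -lerBlDl -sumrB.
apply: (@le_trans _ _ (\sum_(j in F) (2 / p%:R))).
  apply: ler_sum => j _; rewrite subr_sqr.
  apply: le_trans (ler_norm _) _; rewrite normrM.
  have -> : 2 / p%:R = (p ^ 3)%:R^-1 * (2 * p%:R ^+ 2) :> R.
    by rewrite natrX; field; rewrite gt_eqF.
  apply: ler_pM => //; first exact: net_entry.
  apply: le_trans (ler_normD _ _) _; rewrite mulr_natl mulr2n.
  by apply: lerD; rewrite -[leRHS]mulr1; apply: bound => // i; exact: le_trans (yxi i) _.
rewrite sumr_const -[leLHS]mulr_natl mulrCA -[leRHS]mulr1 ler_wpM2l// ler_pdivrMr// mul1r.
by rewrite ler_nat -[leqRHS]card_ord max_card.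
Qed.

End Transfer.
End Net.

(** Binomial theorem, used to sum a union bound over all sets of columns carrying large noise. *)
Lemma sum_subsets_expr (R : comPzRingType) (I : finType) (x : R) :
  \sum_(J : {set I}) x ^+ #|J| = (1 + x) ^+ #|I|.
Proof.
rewrite addrC -[RHS](prodr_const (I : predArgType)) bigA_distr.
by apply: eq_bigr => J _; rewrite -prodr_const [LHS]big_mkcond.
Qed.

Lemma le_set_measurable d (T : measurableType d) (R : realType) (f : T -> R) (a : R) :
  measurable_fun setT f -> measurable [set w | f w <= a].
Proof.
move=> mf; rewrite (_ : [set _ | _] = [set w | - a <= - f w]).
  by apply: measurable_ge_set; exact: measurableT_comp.
by apply/seteqP; split => w /=; rewrite lerN2.
Qed.

Section NoiseEvents.
Context d (T : measurableType d) (R : realType).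
Variables (Q : {finite_measure set T -> \bar R}) (c : R) (n p : nat).
Variable Z : 'I_n -> 'I_p -> T -> R.
Hypotheses (c_ge0 : 0 <= c) (mZ : forall i j, measurable_fun setT (Z i j)).
Hypothesis gaussZ : @indep_family _ _ _ (measurableTypeR R) _ _ Q c
  (fun k : 'I_n * 'I_p => Z k.1 k.2) (fun=> normal_prob 0 1).
Hypotheses (n_gt0 : (0 < n)%N) (np : (n <= p)%N) (p_gt1 : (1 < p)%N).

Let P0 : 0 < p%:R :> R. Proof. by rewrite ltr0n ltnW. Qed.

Let mproj (u : 'I_n -> R) j : measurable_fun setT (fun w => \sum_i u i * Z i j w).
Proof. by apply: measurable_sum => i; exact: measurable_funM. Qed.

Let mprojs (u : 'I_n -> R) (F : {set 'I_p}) :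
  measurable_fun setT (fun w => \sum_(j in F) (\sum_i u i * Z i j w) ^+ 2).
Proof.
under eq_fun do rewrite -big_enum/=; apply: measurable_sum => j.
exact: measurable_funX.
Qed.

(** A crude bound on the entries, enough to pass from the net to the sphere. *)
Lemma entries_event (kappa : R) :
  p%:R ^+ 2 * (2 * expR (- p%:R ^+ 2 / 2)) <= kappa ->
  exists B, [/\ measurable B, (Q B <= (c * kappa)%:E)%E &
    forall w, ~ B w -> forall i j, `|Z i j w| <= p%:R].
Proof.
move=> hk.
pose A (k : 'I_n * 'I_p) : set T := [set w | p%:R <= Z k.1 k.2 w] `|`
  [set w | p%:R <= - Z k.1 k.2 w].
have mA k : measurable (A k).
  by apply: measurableU; apply: measurable_ge_set => //; exact: measurableT_comp.
have tail (s : R) i j : s ^+ 2 = 1 ->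
    (Q [set w | p%:R <= s * Z i j w]%R <= (c * expR (- p%:R ^+ 2 / 2))%:E)%E.
  move=> s1; pose u k := if k == i then s else 0 : R.
  have u2 : \sum_k u k ^+ 2 <= 1.
    rewrite (bigD1 i)//= big1 ?addr0 /u ?eqxx ?s1// => k /negPf ->.
    by rewrite expr0n.
  have := @gauss_col_tail _ _ _ _ _ _ _ _ c_ge0 mZ gaussZ u j 1 p%:R u2 ltr01 (ltW P0).
  rewrite mulr1; congr (Q _ <= _)%E; apply/seteqP; split => w /=;
  by rewrite (bigD1 i)//= big1 ?addr0 /u ?eqxx// => k /negPf ->; rewrite mul0r.
have AQ k : (Q (A k) <= (c * (2 * expR (- p%:R ^+ 2 / 2)))%:E)%E.
  have -> : c * (2 * expR (- p%:R ^+ 2 / 2)) =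
      c * expR (- p%:R ^+ 2 / 2) + c * expR (- p%:R ^+ 2 / 2) by ring.
  apply: (le_trans (@measureU2 _ _ _ Q _ _ _ _)).
  - exact: measurable_ge_set.
  - by apply: measurable_ge_set; exact: measurableT_comp.
  rewrite EFinD; apply: leeD.
    have := tail 1 k.1 k.2 (expr1n _ _); congr (Q _ <= _)%E.
    by apply/seteqP; split => w /=; rewrite mul1r.
  have := tail (-1) k.1 k.2; rewrite sqrrN expr1n => /(_ erefl).
  by congr (Q _ <= _)%E; apply/seteqP; split => w /=; rewrite mulN1r.
have [mU _] := @finite_union_bound _ _ _ Q _ _ mA.
exists (\bigcup_k A k); split => //.
  apply: le_trans (finite_union_bound_cst mA AQ) _.
  rewrite lee_fin ler_wpM2l//; apply: le_trans hk.
  rewrite ler_wpM2r ?mulr_ge0 ?expR_ge0// card_prod !card_ord natrM expr2.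
  by rewrite ler_wpM2r ?ler_nat// ltW.
move=> w wB i j; rewrite ler_norml; apply/andP; split.
  rewrite lerNl leNgt; apply/negP => h; apply: wB; exists (i, j) => //.
  by right; exact: ltW.
rewrite leNgt; apply/negP => h; apply: wB; exists (i, j) => //.
by left; exact: ltW.
Qed.

Let M := (p ^ 5)%N.
Local Notation grids := {ffun 'I_n -> 'I_(2 * M).+1}.
Local Notation grid := (@grid R n M).

(** Each coordinate takes 2 p^5 + 1 <= p^7 values because p >= 2; this is the 7 in all later
    exponents. *)
Let card_grids : #|grids|%:R <= expR (7 * n%:R * ln p%:R) :> R.
Proof.
rewrite card_ffun !card_ord.
have -> : expR (7 * n%:R * ln p%:R) = ((p ^ 7) ^ n)%:R :> R.
  rewrite [7 * _]mulrC -mulrA expRM_natl expRM_natl lnK ?posrE//.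
  by rewrite !natrX.
rewrite ler_nat leq_exp2r//.
rewrite /M (_ : 7 = 2 + 5)%N// expnD.
have p5 : (0 < p ^ 5)%N by rewrite expn_gt0 ltnW.
have p2 : (4 <= p ^ 2)%N by rewrite (@leq_exp2r 2 p 2).
nia.
Qed.

Definition in_ball (y : 'I_n -> R) := \sum_i y i ^+ 2 <= 1.

Lemma net_union_event (A : grids -> set T) (x : R) :
  (forall g, measurable (A g)) ->
  (forall g, in_ball (grid g) -> (Q (A g) <= (c * x)%:E)%E) -> 0 <= x ->
  exists B, [/\ measurable B, (Q B <= (c * (expR (7 * n%:R * ln p%:R) * x))%:E)%E &
    forall w, ~ B w -> forall g, in_ball (grid g) -> ~ A g w].
Proof.
move=> mA Ax x0.
(* Grid points outside the ball have no tail bound; their events are emptied, as roundings of unit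
   vectors never reach them. *)
pose A' g := if `[< in_ball (grid g) >] then A g else set0.
have mA' g : measurable (A' g) by rewrite /A'; case: ifP.
have AQ g : (Q (A' g) <= (c * x)%:E)%E.
  rewrite /A'; case: asboolP => h; first exact: Ax.
  by rewrite measure0 lee_fin mulr_ge0.
have [mU _] := @finite_union_bound _ _ _ Q _ _ mA'.
exists (\bigcup_g A' g); split => //.
  apply: le_trans (finite_union_bound_cst mA' AQ) _.
  by rewrite lee_fin ler_wpM2l// ler_wpM2r.
move=> w wB g gb Agw; apply: wB; exists g => //; rewrite /A'.
by case: asboolP.
Qed.

Lemma net_point (xi : 'I_n -> R) : \sum_i xi i ^+ 2 = 1 ->
  exists2 g : grids, in_ball (grid g) &
    [/\ forall i, `|xi i| <= 1, forall i, `|grid g i| <= `|xi i| &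
    forall i, `|xi i - grid g i| <= (p ^ 5)%:R^-1].
Proof.
move=> xi1.
have xin i : `|xi i| <= 1.
  rewrite -(@ler_pXn2r _ 2) ?nnegrE// real_normK ?num_real// expr1n -xi1.
  by rewrite (bigD1 i)//= lerDl sumr_ge0// => k _; exact: sqr_ge0.
have M0 : (0 < M)%N by rewrite expn_gt0 ltnW.
have [g gP] := grid_approx M0 xin.
have g2 i : `|grid g i| <= `|xi i| by have [] := gP i.
exists g.
  rewrite /in_ball -xi1; apply: ler_sum => i _.
  by rewrite -[leLHS]real_normK ?num_real// -[leRHS]real_normK ?num_real// lerXn2r ?nnegrE.
by split=> // i; have [] := gP i.
Qed.

(** The Chernoff parameter [lam] is left free because its best value depends on how [t] compares
    with [#|F|]. The extra 2 is the rounding error of [net_sum_sqr]. *)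
Lemma noise_energy_event (F : {set 'I_p}) (lam t kappa : R) :
  0 <= lam -> lam <= 8^-1 ->
  expR (7 * n%:R * ln p%:R + (2 * #|F|%:R * lam ^+ 2 - lam * t)) <= kappa ->
  exists B, [/\ measurable B, (Q B <= (c * kappa)%:E)%E &
    forall w, ~ B w -> (forall i j, `|Z i j w| <= p%:R) ->
    forall xi, \sum_i xi i ^+ 2 = 1 ->
    \sum_(j in F) (\sum_i xi i * Z i j w) ^+ 2 <= #|F|%:R + t + 2].
Proof.
move=> lam0 lam8 hk.
pose A (g : grids) := [set w | #|F|%:R + t <= \sum_(j in F) (\sum_i grid g i * Z i j w) ^+ 2].
have mA g : measurable (A g) by exact: measurable_ge_set.
have AQ g : in_ball (grid g) ->
    (Q (A g) <= (c * expR (2 * #|F|%:R * lam ^+ 2 - lam * t))%:E)%E.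
  move=> gb; have := gauss_cols_upper_tail c_ge0 mZ gaussZ F (#|F|%:R + t) lam0 lam8 gb.
  congr (_ <= (c * expR _)%:E)%E; ring.
have [B [mB QB HB]] := net_union_event mA AQ (expR_ge0 _).
exists B; split => //.
  apply: le_trans QB _; rewrite lee_fin ler_wpM2l//.
  by rewrite -expRD.
move=> w wB ZB xi xi1.
have [g gb [xin gxi xig]] := net_point xi1.
apply: le_trans (net_sum_sqr (ltnW p_gt1) np ZB xin gxi xig F) _.
rewrite lerD2r leNgt; apply/negP => /ltW h.
exact: HB wB _ gb h.
Qed.

(** No single projection is small uniformly in [xi], which may align with one column and reach about
    sqrt(n); only the number of large projections is controlled. If J collects them, the energy of
    the grid point on J is at least [#|J|%:R * t ^+ 2], which is unlikely even after a union over J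
    and the net. *)
Lemma large_entries_event (s : nat) (t kappa : R) : 1 <= t ->
  2 * ln p%:R <= t ^+ 2 / 8 - 1 ->
  expR (7 * n%:R * ln p%:R + (1 - (t ^+ 2 / 8 - 1) * s%:R / 8)) <= kappa ->
  (0 < s)%N ->
  exists B, [/\ measurable B, (Q B <= (c * kappa)%:E)%E &
    forall w, ~ B w -> (forall i j, `|Z i j w| <= p%:R) ->
    forall xi, \sum_i xi i ^+ 2 = 1 ->
    (4 * #|[set j | (2 * t <= `|\sum_i xi i * Z i j w|)%R]%SET| < s)%N].
Proof.
move=> t1; set a := t ^+ 2 / 8 - 1 => ap hk s0.
have lnp0 : 0 <= ln p%:R :> R by rewrite ln_ge0// ler1n ltnW.
have a0 : 0 <= a by apply: le_trans ap; rewrite mulr_ge0.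
pose A (g : grids) (J : {set 'I_p}) : set T := if (s <= 4 * #|J|)%N then
  [set w | #|J|%:R * t ^+ 2 <= \sum_(j in J) (\sum_i grid g i * Z i j w) ^+ 2]
  else set0.
have mA g J : measurable (A g J).
  by rewrite /A; case: ifP => // _; exact: measurable_ge_set.
(* The tail for J is at most exp(-a |J|). Half of the exponent gives exp(-a s / 8), since |J| >= s /
   4; the other half is [x ^+ #|J|], whose sum over J is (1 + x)^p <= e because p x <= 1. *)
pose x := expR (- a / 2).
have AQ g J : in_ball (grid g) ->
    (Q (A g J) <= (c * (expR (- a * s%:R / 8) * x ^+ #|J|))%:E)%E.
  move=> gb; rewrite /A; case: ifPn => sJ; last first.
    by rewrite measure0 lee_fin !mulr_ge0 ?expR_ge0 ?exprn_ge0 ?expR_ge0.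
  have h8 : 0 <= 8^-1 :> R by [].
  apply: le_trans (gauss_cols_upper_tail c_ge0 mZ gaussZ J _ h8 (lexx _) gb) _.
  rewrite lee_fin ler_wpM2l// /x -expRM_natl -expRD ler_expR.
  have sJ' : s%:R <= 4 * #|J|%:R :> R by rewrite -natrM ler_nat.
  have J0 : 0 <= #|J|%:R :> R by [].
  have as4 : a * s%:R <= 4 * (a * #|J|%:R) by rewrite mulrCA ler_wpM2l.
  have aJ0 := mulr_ge0 a0 J0.
  have aJ : a * #|J|%:R = #|J|%:R * t ^+ 2 / 8 - #|J|%:R by rewrite /a; ring.
  rewrite [#|J|%:R * (- a / 2)](_ : _ = - (a * #|J|%:R) / 2); last by ring.
  rewrite mulNr expr2; lra.
have mU g := (finite_union_bound Q (mA g)).1.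
have AQg g : in_ball (grid g) ->
    (Q (\bigcup_J A g J) <= (c * expR (1 - a * s%:R / 8))%:E)%E.
  move=> gb; apply: le_trans (finite_union_bound Q (mA g)).2 _.
  apply: (le_trans (lee_sum _ (fun J _ => AQ g J gb))).
  rewrite sumEFin lee_fin -mulr_sumr ler_wpM2l// -mulr_sumr sum_subsets_expr.
  have -> : expR (1 - a * s%:R / 8) = expR (- a * s%:R / 8) * expR 1.
    by rewrite -expRD; congr expR; ring.
  rewrite ler_wpM2l ?expR_ge0//.
  rewrite card_ord; have xp : p%:R * x <= 1.
    rewrite -[X in X * x](@lnK _ p%:R) ?posrE// /x -expRD -[leRHS]expR0 ler_expR; lra.
  have x0 : 0 <= x by exact: expR_ge0.
  apply: (@le_trans _ _ (expR x ^+ p)).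
    by rewrite lerXn2r ?nnegrE ?addr_ge0 ?expR_ge0// expR_ge1Dx.
  by rewrite -expRM_natl ler_expR.
have [B [mB QB HB]] := net_union_event mU AQg (expR_ge0 _).
exists B; split => //.
  by apply: le_trans QB _; rewrite lee_fin ler_wpM2l// -expRD.
move=> w wB ZB xi xi1.
have [g gb [xin gxi xig]] := net_point xi1.
rewrite ltnNge; apply/negP; set J := [set j | _]%SET => sJ.
apply: (HB _ wB _ gb); exists J => //; rewrite /A sJ /=.
rewrite mulr_natl -sumr_const; apply: ler_sum => j.
rewrite inE => tj.
rewrite -[leRHS]real_normK ?num_real// lerXn2r ?nnegrE ?(le_trans _ t1)//.
(* Rounding costs at most p^-3 <= 1 <= t, which is why [xi] is tested at [2 * t] and grid points at
   [t]. *)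
have h := net_entry (ltnW p_gt1) np ZB xig j.
have p31 : (p ^ 3)%:R^-1 <= 1 :> R.
  by rewrite invf_le1 ?ltr0n ?expn_gt0 ?(ltnW p_gt1)// ler1n expn_gt0 ltnW.
have := ler_normD (\sum_i xi i * Z i j w - \sum_i grid g i * Z i j w) (\sum_i grid g i * Z i j w).
rewrite subrK; lra.
Qed.

End NoiseEvents.

(** * The event on which alignment and vote succeed *)

Section SpikeEvent.
Context d (T : measurableType d) (R : realType).
Variables (Q : {finite_measure set T -> \bar R}) (c : R) (n p : nat).
Variable Z : 'I_n -> 'I_p -> T -> R.
Hypotheses (c_ge0 : 0 <= c) (mZ : forall i j, measurable_fun setT (Z i j)).
Hypothesis gaussZ : @indep_family _ _ _ (measurableTypeR R) _ _ Q c
  (fun k : 'I_n * 'I_p => Z k.1 k.2) (fun=> normal_prob 0 1).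
Hypotheses (n_gt0 : (0 < n)%N) (np : (n <= p)%N) (p_gt1 : (1 < p)%N).
Variables (l : 'I_n -> R) (S F : {set 'I_p}) (tau eta kappa D : R).
Hypotheses (l_sign : forall i, l i = 1 \/ l i = - 1) (SF : S \subset F).
Hypotheses (S_gt0 : (0 < #|S|)%N) (tau_gt0 : 0 < tau).
Hypotheses (eta_gt0 : 0 < eta) (eta_le1 : eta <= 1).
Hypotheses (kappa_gt0 : 0 < kappa) (kappa_le1 : kappa <= 1).

Local Notation s := (#|S|%:R : R).
Local Notation N := (#|F|%:R : R).
Local Notation G := (n%:R * s * tau ^+ 2).

(* [D] is a common lower bound for the signal-to-noise ratios of the problem;
   the conditions require it to dominate [ln p]. *)
Hypothesis D_large : 16 ^+ 4 / eta ^+ 2 * (1 + ln p%:R + kappa^-1) <= D.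
Hypotheses (D_s : D <= s * tau ^+ 2) (D_n : D <= n%:R * tau ^+ 2).
Hypothesis D_N : D * N <= n%:R * s ^+ 2 * tau ^+ 4.
Hypothesis p_large : 32 <= kappa * p%:R ^+ 2.

Let lp0 : 0 <= ln p%:R :> R.
Proof. by rewrite ln_ge0// ler1n ltnW. Qed.
Let ki1 : 1 <= kappa^-1. Proof. by rewrite invf_ge1. Qed.
Let lnk : - ln kappa <= kappa^-1.
Proof.
rewrite -lnV ?posrE//; have := @le_ln1Dx R (kappa^-1 - 1).
have -> : 1 + (kappa^-1 - 1) = kappa^-1 by ring.
move=> h; apply: le_trans (h _) _; last by lra.
by rewrite ltrBrDl subrr invr_gt0.
Qed.

(** ln p pays for the net. The term [kappa^-1] dominates -ln kappa in the exponential bounds, and is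
    needed at full size in [eta2D], where Chebyshev's inequality only yields a failure probability
    of order 1 / (eta^2 D). *)
Let E := 1 + ln p%:R + kappa^-1.
Let E2 : 2 <= E. Proof. by rewrite /E; have := lp0; have := ki1; lra. Qed.
Let DE : 16 ^+ 4 * E <= eta ^+ 2 * D.
Proof.
have e2 : 0 < eta ^+ 2 by rewrite exprn_gt0.
by have := ler_wpM2l (ltW e2) D_large; rewrite mulrA mulrCA divff ?gt_eqF// mulr1.
Qed.
Let eta2 : eta ^+ 2 <= 1. Proof. by rewrite exprn_ile1// ltW. Qed.
Let D0 : 0 < D.
Proof.
have e2 : 0 < eta ^+ 2 by rewrite exprn_gt0.
by rewrite -(pmulr_rgt0 _ e2); apply: lt_le_trans DE; have := E2; lra.
Qed.
Let DE' : 16 ^+ 4 * E <= D. Proof. by apply: le_trans DE _; rewrite ler_piMl// ltW. Qed.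
Let n1 : 1 <= n%:R :> R. Proof. by rewrite ler1n. Qed.
Let s1 : 1 <= s. Proof. by rewrite ler1n. Qed.
Let sN : s <= N. Proof. by rewrite ler_nat subset_leq_card. Qed.
Let N0 : 0 < N. Proof. exact: lt_le_trans (lt_le_trans ltr01 s1) sN. Qed.
Let GD : n%:R * D <= G. Proof. by rewrite -mulrA ler_wpM2l. Qed.
Let DG : D <= G. Proof. by apply: le_trans GD; rewrite ler_peMl// ltW. Qed.
Let G0 : 0 < G. Proof. exact: lt_le_trans DG. Qed.
Let GN : n%:R * D * N <= G ^+ 2.
Proof.
rewrite -mulrA (_ : G ^+ 2 = n%:R * (n%:R * s ^+ 2 * tau ^+ 4)); last by ring.
by rewrite ler_wpM2l.
Qed.

(** The extra factor n, harmless as ln kappa <= 0, matches the other terms of the exponents, all of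
    which scale with n. *)
Let exp_small x : x <= n%:R * (ln kappa) -> expR x <= kappa.
Proof.
move=> h; rewrite -[leRHS]lnK ?posrE// ler_expR; apply: le_trans h _.
have : ln kappa <= 0 by exact: ln_le0.
by have := n1; move: (ln kappa) => y; nra.
Qed.

Let event := exists B, [/\ measurable B, (Q B <= (c * (5 * kappa))%:E)%E &
  forall w, ~ B w -> forall xi, \sum_i xi i ^+ 2 = 1 ->
  \sum_(j in F) (\sum_i l i * spiked l S tau (fun i j => Z i j w) i j) ^+ 2 <=
    n%:R * \sum_(j in F) (\sum_i xi i * spiked l S tau (fun i j => Z i j w) i j) ^+ 2 ->
  (1 - 4 * eta) * n%:R <= (\sum_i xi i * l i) ^+ 2 /\
  (4 * #|[set j | (Num.sqrt n%:R * tau / 4 <= `|\sum_i xi i * Z i j w|)%R]%SET| < #|S|)%N].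

Let rows_event : exists B, [/\ measurable B, (Q B <= (c * kappa)%:E)%E &
  forall w, ~ B w -> 16 * n%:R * tau ^+ 2 * (\sum_i (\sum_(j in S) Z i j w) ^+ 2)
    <= (eta * G) ^+ 2].
Proof.
pose t := (eta * G) ^+ 2 / (16 * n%:R * tau ^+ 2).
have q0 : 0 < 16 * n%:R * tau ^+ 2 by rewrite !mulr_gt0 ?exprn_gt0 ?ltr0n.
exists [set w | t <= \sum_i (\sum_(j in S) Z i j w) ^+ 2]; split.
- apply: measurable_ge_set; apply: measurable_sum => i; apply: measurable_funX.
  by under eq_fun do rewrite -big_enum/=; exact: measurable_sum.
- apply: le_trans (gauss_rows_upper_tail c_ge0 mZ gaussZ t S_gt0) _.
  rewrite lee_fin ler_wpM2l//; apply: exp_small.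
  have -> : t / (8 * s) = eta ^+ 2 * G / 128.
    rewrite /t; field.
    by rewrite !pnatr_eq0 -!lt0n S_gt0 n_gt0 gt_eqF.
  have : eta ^+ 2 * (n%:R * D) <= eta ^+ 2 * G by rewrite ler_wpM2l ?exprn_ge0// ltW.
  have : n%:R * (16 ^+ 4 * E) <= n%:R * (eta ^+ 2 * D) by rewrite ler_wpM2l.
  have : n%:R * (- ln kappa) <= n%:R * E.
    by rewrite ler_wpM2l// (le_trans lnk)// /E; have := lp0; lra.
  have : n%:R * 2 <= n%:R * E by rewrite ler_wpM2l.
  by have := n1; rewrite mulrN [eta ^+ 2 * (_ * D)]mulrCA; lra.
move=> w /negP; rewrite -ltNge => /ltW; rewrite /t.
by rewrite ler_pdivlMr// mulrC.
Qed.

Let energy_event : exists B, [/\ measurable B, (Q B <= (c * kappa)%:E)%E &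
    forall w, ~ B w -> (forall i j, `|Z i j w| <= p%:R) ->
    forall xi, \sum_i xi i ^+ 2 = 1 ->
    \sum_(j in F) (\sum_i xi i * Z i j w) ^+ 2 <= N + 2 * (eta * G)].
Proof.
(* The minimiser of 2 N lam^2 - lam eta G, capped at the range of the chi-square bound. *)
pose lam := Num.min 8^-1 (eta * G / (4 * N)).
have lam0 : 0 <= lam.
  by rewrite /lam le_min; apply/andP; split=> //; rewrite divr_ge0 ?mulr_ge0// ltW.
have lam8 : lam <= 8^-1 by rewrite /lam ge_min lexx.
have lamN : 2 * N * lam ^+ 2 <= lam * (eta * G) / 2.
  have : lam <= eta * G / (4 * N) by rewrite /lam ge_min lexx orbT.
  rewrite ler_pdivlMr; last by rewrite mulr_gt0.
  move/(ler_wpM2l lam0); rewrite expr2; lra.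
(* With the cap active the gain is linear in G and [GD] applies; otherwise it is (eta G)^2 / (4 N)
   and [GN] applies. *)
have lamG : n%:R * (eta ^+ 2 * D) / 8 <= lam * (eta * G).
  rewrite /lam; have [_|_] := leP (8^-1) (eta * G / (4 * N)).
    have : eta ^+ 2 * (n%:R * D) <= eta * (G * 1).
      rewrite expr2 -mulrA ler_pM2l// mulr1.
      by apply: le_trans GD; rewrite ler_piMl// mulr_ge0// ltW.
    rewrite mulr1 [eta ^+ 2 * _]mulrCA; lra.
  have -> : eta * G / (4 * N) * (eta * G) = eta ^+ 2 * G ^+ 2 / (4 * N).
    by field; rewrite gt_eqF.
  rewrite ler_pdivlMr; last by rewrite mulr_gt0.
  have nD0 : 0 <= n%:R * D * N by rewrite !mulr_ge0// ltW.
  have := mulr_ge0 (exprn_ge0 2 (ltW eta_gt0)) nD0.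
  have := ler_wpM2l (ltW (exprn_gt0 2 eta_gt0)) GN; lra.
have hk : expR (7 * n%:R * ln p%:R + (2 * N * lam ^+ 2 - lam * (eta * G))) <= kappa.
  apply: exp_small.
  have : n%:R * (16 ^+ 4 * E) <= n%:R * (eta ^+ 2 * D) by rewrite ler_wpM2l.
  have : n%:R * (- ln kappa) <= n%:R * kappa^-1 by rewrite ler_wpM2l.
  have : 0 <= n%:R * ln p%:R :> R by rewrite mulr_ge0.
  have : 0 <= n%:R * kappa^-1 by rewrite mulr_ge0// invr_ge0 ltW.
  by have := n1; rewrite /E mulrN; lra.
have [B [mB QB HB]] := noise_energy_event c_ge0 mZ gaussZ n_gt0 np p_gt1 lam0 lam8 hk.
exists B; split=> // w wB ZB xi xi1.
apply: le_trans (HB w wB ZB xi xi1) _.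
(* The second [eta * G] in the bound absorbs the rounding error 2. *)
have : 2 <= eta * G.
  have := ler_wpM2l (ltW eta_gt0) DG.
  have : eta ^+ 2 * D <= eta * D by rewrite expr2 ler_wpM2r ?ler_piMl// ltW.
  have := DE; have := E2; lra.
lra.
Qed.

Let eta2D : 64 / (eta ^+ 2 * D) <= kappa.
Proof.
have e2D : 0 < eta ^+ 2 * D by rewrite mulr_gt0 ?exprn_gt0.
rewrite ler_pdivrMr// -ler_pdivrMl//.
by have := DE; have := lp0; have := ki1; rewrite /E; lra.
Qed.

Let lower_event : exists B, [/\ measurable B, (Q B <= (c * kappa)%:E)%E &
    forall w, ~ B w ->
    n%:R * (N - eta * G) <= \sum_(j in F) (\sum_i l i * Z i j w) ^+ 2].
Proof.
have eG : 16 <= eta * G.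
  have := ler_wpM2l (ltW eta_gt0) DG.
  have : eta ^+ 2 * D <= eta * D by rewrite expr2 ler_wpM2r ?ler_piMl// ltW.
  have := DE; have := E2; lra.
have eG0 : 0 < eta * G by rewrite mulr_gt0.
(* Makes [lam * t] equal to 1, above ln 2, while keeping lam^2 N at most 1 / (eta^2 D) through
   [GN]. *)
pose lam := (eta * G)^-1.
have lam0 : 0 <= lam by rewrite invr_ge0 ltW.
have lam16 : lam <= 16^-1 by rewrite lef_pV2 ?posrE.
pose r := Num.sqrt n%:R : R.
have r2 : r ^+ 2 = n%:R by rewrite sqr_sqrtr.
have rn0 : r != 0 by rewrite gt_eqF// sqrtr_gt0 ltr0n.
pose y i := r^-1 * l i.
have y1 : \sum_i y i ^+ 2 = 1.
  rewrite (eq_bigr (fun=> n%:R^-1)); last first.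
    move=> i _; rewrite /y exprMn exprVn r2.
    by have [->|->] := l_sign i; rewrite ?sqrrN expr1n mulr1.
  by rewrite sumr_const card_ord -[LHS]mulr_natr mulVf// pnatr_eq0 -lt0n.
have yE w : \sum_(j in F) (\sum_i y i * Z i j w) ^+ 2 =
    n%:R^-1 * \sum_(j in F) (\sum_i l i * Z i j w) ^+ 2.
  rewrite mulr_sumr; apply: eq_bigr => j _.
  under eq_bigr do rewrite -mulrA.
  by rewrite -mulr_sumr exprMn exprVn r2.
have ln2 : ln 2 <= lam * (eta * G).
  rewrite mulVf ?gt_eqF//; have := @le_ln1Dx R 1.
  by rewrite (_ : 1 + 1 = 2)//; apply; lra.
exists [set w | \sum_(j in F) (\sum_i y i * Z i j w) ^+ 2 <= N - eta * G]; split.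
- apply: le_set_measurable; under eq_fun do rewrite -big_enum/=.
  apply: measurable_sum => j; apply: measurable_funX; apply: measurable_sum => i.
  exact: measurable_funM.
- apply: le_trans (gauss_cols_lower_tail c_ge0 mZ gaussZ F lam0 lam16 y1 ln2) _.
  rewrite lee_fin ler_wpM2l//.
  have v8 : 8 * lam ^+ 2 * N <= 8 / (eta ^+ 2 * D).
    have en0 : eta != 0 by rewrite gt_eqF.
    have Gn0 : G != 0 by rewrite gt_eqF.
    have -> : 8 * lam ^+ 2 * N = 8 / eta ^+ 2 * (N / G ^+ 2).
      by move: (G) Gn0 @lam lam0 lam16 ln2 eG eG0 => g g0 lam *; rewrite /lam; field; rewrite g0.
    have -> : 8 / (eta ^+ 2 * D) = 8 / eta ^+ 2 * D^-1.
      by field; rewrite en0 gt_eqF.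
    rewrite ler_pM2l ?divr_gt0 ?exprn_gt0// ler_pdivrMr ?exprn_gt0//.
    rewrite mulrC ler_pdivlMr//; apply: le_trans GN.
    by rewrite [N * D]mulrC -mulrA ler_peMl// mulr_ge0// ltW.
  have v0 : 0 <= 8 * lam ^+ 2 * N by rewrite !mulr_ge0 ?exprn_ge0// ltW.
  have vk : 8 * (8 * lam ^+ 2 * N) <= kappa.
    apply: le_trans eta2D; have := ler_wpM2l (ler0n R 8) v8; lra.
  move: (8 * lam ^+ 2 * N) v0 vk => v v0 vk.
  have v2 : v <= 2^-1 by move: vk kappa_le1 v0; lra.
  (* For v <= 1/2 this gives exp(v) - 1 <= 2 v, so the failure probability is at most 8 v <=
     kappa. *)
  have : (1 - v) * expR v <= 1.
    rewrite -[leRHS](expRxMexpNx_1 v) mulrC ler_wpM2l ?expR_ge0//.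
    by have := expR_ge1Dx (- v); lra.
  have := expR_ge0 v; move: (expR v) => x; nra.
move=> w /negP; rewrite -ltNge yE => /ltW.
by rewrite [n%:R^-1 * _]mulrC ler_pdivlMr ?ltr0n// mulrC.
Qed.

Let vote_event : exists B, [/\ measurable B, (Q B <= (c * kappa)%:E)%E &
    forall w, ~ B w -> (forall i j, `|Z i j w| <= p%:R) ->
    forall xi, \sum_i xi i ^+ 2 = 1 ->
  (4 * #|[set j | (Num.sqrt n%:R * tau / 4 <= `|\sum_i xi i * Z i j w|)%R]%SET|
    < #|S|)%N].
Proof.
(* Half the voting threshold, because [large_entries_event] counts entries above [2 * t]. *)
pose t := Num.sqrt n%:R * tau / 8.
have t2 : t ^+ 2 = n%:R * tau ^+ 2 / 64.
  by rewrite /t !exprMn exprVn sqr_sqrtr//; field.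
have tp : 0 <= t by rewrite !mulr_ge0 ?sqrtr_ge0// ltW.
have t1 : 1 <= t.
  rewrite -(@ler_pXn2r _ 2) ?nnegrE// expr1n t2; have := DE'; have := E2; have := D_n; lra.
have tl : 2 * ln p%:R <= t ^+ 2 / 8 - 1.
  by rewrite t2; have := DE'; have := ki1; have := lp0; have := D_n; rewrite /E; lra.
have hk : expR (7 * n%:R * ln p%:R + (1 - (t ^+ 2 / 8 - 1) * s / 8)) <= kappa.
  apply: exp_small.
  have h1 : n%:R * D / 1024 <= (t ^+ 2 / 8 - 1) * s.
    apply: (@le_trans _ _ (n%:R * tau ^+ 2 / 1024 * s)).
      have := GD; lra.
    by rewrite ler_wpM2r// t2; have := DE'; have := E2; have := D_n; lra.
  have : n%:R * (16 ^+ 4 * E) <= n%:R * D by rewrite ler_wpM2l.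
  have : n%:R * (- ln kappa) <= n%:R * kappa^-1 by rewrite ler_wpM2l.
  have : 0 <= n%:R * ln p%:R :> R by rewrite mulr_ge0.
  have : 0 <= n%:R * kappa^-1 by rewrite mulr_ge0// invr_ge0 ltW.
  by have := n1; rewrite /E mulrN; lra.
have [B [mB QB HB]] :=
  large_entries_event c_ge0 mZ gaussZ n_gt0 np p_gt1 t1 tl hk S_gt0.
exists B; split=> // w wB ZB xi xi1.
have -> : Num.sqrt n%:R * tau / 4 = 2 * t by rewrite /t; field.
exact: HB.
Qed.

(** exp(p^2 / 2) >= (p^2 / 4)^2 reduces the left side to 32 / p^2, the source of the 32 in
    [p_large]. *)
Let entries_small : p%:R ^+ 2 * (2 * expR (- p%:R ^+ 2 / 2)) <= kappa.
Proof.
have p2 : 0 < p%:R ^+ 2 :> R by rewrite exprn_gt0// ltr0n ltnW.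
have h := @expR_ge_sqr R (p%:R ^+ 2 / 2) (divr_ge0 (ltW p2) (ler0n _ 2)).
rewrite mulNr expRN mulrA ler_pdivrMr ?expR_gt0//.
have k16 := ler_wpM2l (ltW kappa_gt0) h; apply: le_trans k16.
move: (p%:R ^+ 2 : R) p2 p_large => x x0 xk; nra.
Qed.

Lemma spike_event : event.
Proof.
have [B1 [m1 q1 h1]] := rows_event.
have [B2 [m2 q2 h2]] := energy_event.
have [B3 [m3 q3 h3]] := lower_event.
have [B4 [m4 q4 h4]] := vote_event.
have [B5 [m5 q5 h5]] := entries_event c_ge0 mZ gaussZ np p_gt1 entries_small.
exists (B1 `|` (B2 `|` (B3 `|` (B4 `|` B5)))).
have m45 := measurableU _ _ m4 m5.
have m345 := measurableU _ _ m3 m45.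
have m2345 := measurableU _ _ m2 m345.
split.
- exact: measurableU.
- have -> : c * (5 * kappa) = c * kappa + (c * kappa + (c * kappa + (c * kappa + c * kappa))).
    by ring.
  rewrite !EFinD.
  apply: (le_trans (@measureU2 _ _ _ Q _ _ m1 m2345)); apply: leeD => //.
  apply: (le_trans (@measureU2 _ _ _ Q _ _ m2 m345)); apply: leeD => //.
  apply: (le_trans (@measureU2 _ _ _ Q _ _ m3 m45)); apply: leeD => //.
  by apply: (le_trans (@measureU2 _ _ _ Q _ _ m4 m5)); apply: leeD.
move=> w /not_orP[w1] /not_orP[w2] /not_orP[w3] /not_orP[w4 w5] xi xi1 opt.
have ZB := h5 w w5; split; last exact: (h4 w w4 ZB xi xi1).
exact: (spike_alignment n_gt0 S_gt0 tau_gt0 l_sign SF xi1 eta_gt0 opt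
  (h1 w w1) (h2 w w2 ZB xi xi1) (h3 w w3)).
Qed.

End SpikeEvent.

(** * Singular vectors and Borel estimators *)

Section SingularVector.
Context (R : realType).

Let rowsq n (r : 'rV[R]_n) : (r *m r^T) 0 0 = \sum_k r 0 k ^+ 2.
Proof. by rewrite mxE; apply: eq_bigr => k _; rewrite mxE expr2. Qed.

(** In the orthonormal basis of columns of [U], |v A|^2 is the combination of the squared singular
    values [del i] with weights [(v *m U) 0 i ^+ 2], which sum to |v|^2; [xi] puts all its weight on
    the largest. This Rayleigh property and the unit norm are all that the analysis takes from the
    decomposition. *)
Lemma first_left_singular_vector_max m n (A : 'M[R]_(m, n)) (xi : 'cV[R]_m) :
  (0 < m)%N -> first_left_singular_vector A xi ->
  \sum_i xi i 0 ^+ 2 = 1 /\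
  forall v : 'I_m -> R, \sum_k (\sum_i v i * A i k) ^+ 2 <=
    (\sum_i v i ^+ 2) * \sum_k (\sum_i xi i 0 * A i k) ^+ 2.
Proof.
move=> m0 [U [D [V [[UU VV AE [D0 Dge0] Dmon] xiE]]]].
pose i0 := Ordinal m0.
have xiU : xi = col i0 U by exact: xiE.
have UU' : U *m U^T = 1%:M by apply: mulmx1C.
pose del i := \sum_k D i k ^+ 2.
have vA (v : 'rV[R]_m) : \sum_k (v *m A) 0 k ^+ 2 =
    \sum_i (v *m U) 0 i ^+ 2 * del i.
  rewrite -rowsq AE !mulmxA trmx_mul trmxK -mulmxA (mulmxA V^T) VV mul1mx rowsq.
  under [RHS]eq_bigr do rewrite mulr_sumr.
  rewrite exchange_big/=; apply: eq_bigr => k _; rewrite mxE.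
  move: (v *m U) => w.
  have [km|km] := ltnP k m.
    rewrite (bigD1 (Ordinal km))//= big1 ?addr0; last first.
      move=> i ik; rewrite D0 ?mulr0// => e; case/eqP: ik; exact: val_inj.
    rewrite [RHS](bigD1 (Ordinal km))//= big1 ?addr0 ?exprMn// => i ik.
    by rewrite D0 ?expr0n ?mulr0// => e; case/eqP: ik; exact: val_inj.
  rewrite !big1 ?expr0n// => i _; rewrite D0 ?expr0n ?mulr0// => e;
  by move: (ltn_ord i); rewrite e ltnNge km.
have vU (v : 'rV[R]_m) : \sum_i (v *m U) 0 i ^+ 2 = \sum_i v 0 i ^+ 2.
  by rewrite -!rowsq trmx_mul -mulmxA (mulmxA U) UU' mul1mx.
have delmax i : del i <= del i0.
  (* A row index beyond the number of columns meets no diagonal entry of [D], so [del i] is 0. *)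
  have [im|im] := ltnP i n; last first.
    rewrite {1}/del big1; first by apply: sumr_ge0 => k _; exact: sqr_ge0.
    by move=> k _; rewrite D0 ?expr0n// => e; move: (ltn_ord k); rewrite -e ltnNge im.
  have n0 : (0 < n)%N by exact: leq_ltn_trans im.
  rewrite /del (bigD1 (Ordinal im))//= big1 ?addr0; last first.
    move=> k ki; rewrite D0 ?expr0n// => e; case/eqP: ki; exact: val_inj.
  apply: (@le_trans _ _ (D i0 (Ordinal n0) ^+ 2)).
    by rewrite lerXn2r ?nnegrE// Dmon.
  by rewrite (bigD1 (Ordinal n0))//= lerDl sumr_ge0// => k _; exact: sqr_ge0.
have xiTU : (xi^T *m U) = \row_i (i == i0)%:R.
  apply/matrixP => a i; rewrite xiU ord1 !mxE.
  transitivity ((U^T *m U) i0 i); last by rewrite UU mxE eq_sym.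
  by rewrite mxE; apply: eq_bigr => k _; rewrite !mxE.
have row1 (f : 'I_m -> R) : \sum_i (\row_i (i == i0)%:R : 'rV[R]_m) 0 i ^+ 2 * f i = f i0.
  rewrite (bigD1 i0)//= big1 ?addr0 ?mxE ?eqxx ?expr1n ?mul1r// => i /negPf ii.
  by rewrite mxE ii expr0n mul0r.
have xiA : \sum_k (\sum_i xi i 0 * A i k) ^+ 2 = del i0.
  rewrite -(row1 del) -xiTU -vA; apply: eq_bigr => k _.
  by rewrite mxE; congr (_ ^+ 2); apply: eq_bigr => i _; rewrite mxE.
split.
  have h := vU xi^T; rewrite xiTU in h.
  transitivity (\sum_i xi^T 0 i ^+ 2); first by apply: eq_bigr => i _; rewrite mxE.
  by rewrite -h -[RHS](row1 (fun=> 1)); apply: eq_bigr => i _; rewrite mulr1.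
move=> v; rewrite xiA; pose vr : 'rV[R]_m := \row_i v i.
have -> : \sum_k (\sum_i v i * A i k) ^+ 2 = \sum_k (vr *m A) 0 k ^+ 2.
  apply: eq_bigr => k _; rewrite mxE; congr (_ ^+ 2).
  by apply: eq_bigr => i _; rewrite mxE.
rewrite vA; have -> : \sum_i v i ^+ 2 = \sum_i (vr *m U) 0 i ^+ 2.
  by rewrite vU; apply: eq_bigr => i _; rewrite mxE.
rewrite mulr_suml; apply: ler_sum => i _.
by rewrite ler_wpM2l// sqr_ge0.
Qed.

Lemma sum_if_submx q n p (A : 'M[R]_(n, p)) (f : 'I_n -> R) :
  \sum_k (\sum_i f i * if_submx q A i k) ^+ 2 =
  \sum_(j in if_selected q A) (\sum_i f i * A i j) ^+ 2.
Proof.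
rewrite [RHS]big_enum_val; apply: eq_bigr => k _; congr (_ ^+ 2).
by apply: eq_bigr => i _; rewrite mxE.
Qed.

End SingularVector.

(** * Borel measurability and the voted sign *)

Section MatrixMeasurability.
Context (R : realType) (m n : nat).
Local Notation gT := (g_sigma_algebraType (@mx_cylinders R m n)).

Lemma mx_borel_funP (f : 'M[R]_(m, n) -> R) :
  mx_borel_fun f <-> measurable_fun setT (f : gT -> R).
Proof.
split=> [bf _ B mB|mf B mB]; first by rewrite setTI; exact: bf.
have := mf measurableT B mB; by rewrite setTI.
Qed.

Lemma measurable_mx_entry i j : measurable_fun setT ((fun A => A i j) : gT -> R).
Proof.
by apply/mx_borel_funP => B mB; apply: sub_sigma_algebra; exists i, j, B.
Qed.

Lemma mx_borel_fun_comp d (T : measurableType d) (X : T -> 'M[R]_(m, n))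
    (f : 'M[R]_(m, n) -> R) :
  (forall i j, measurable_fun setT (fun w => X w i j)) -> mx_borel_fun f ->
  measurable_fun setT (fun w => f (X w)).
Proof.
move=> mX /mx_borel_funP mf; apply: (measurableT_comp mf).
apply: (@measurability _ _ T gT setT X (@mx_cylinders R m n)) => //.
move=> _ [_ [i [j [B [mB ->]]]] <-].
exact: mX.
Qed.

Section Vote.
Variables (th : R) (xi : 'M[R]_(m, n) -> 'cV[R]_m).
Hypothesis bxi : mx_borel_vec xi.

(* Positive for the correct orientation of [xi], because the feature means are
   nonnegative. *)
Definition vote (A : 'M[R]_(m, n)) : R :=
  \sum_j ((th < \sum_i xi A i 0 * A i j)%R%:R
    - (\sum_i xi A i 0 * A i j < - th)%R%:R).

(** A tie goes to 1, but the strict inequalities of [spike_vote] exclude ties on the good event. *)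
Definition vote_sign (A : 'M[R]_(m, n)) : R := if 0 <= vote A then 1 else - 1.

Lemma vote_sign_rule : sign_rule vote_sign.
Proof.
split=> [A|]; first by rewrite /vote_sign; case: ifP; [left|right].
have mproj j : measurable_fun setT ((fun A => \sum_i xi A i 0 * A i j) : gT -> R).
  apply: measurable_sum => i; apply: measurable_funM.
    by apply/mx_borel_funP; exact: bxi.
  exact: measurable_mx_entry.
have mb (b : gT -> bool) : measurable_fun setT b ->
    measurable_fun setT ((fun A => (b A)%:R) : gT -> R).
  move=> bm; rewrite (_ : (fun A => _) = (fun A => if b A then 1 else 0)).
    by apply: measurable_fun_ifT.
  by apply/funext => A; case: (b A).
have mvote : measurable_fun setT (vote : gT -> R).
  apply: measurable_sum => j; apply: measurable_funB; apply: mb;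
  exact: measurable_fun_ltr.
apply/mx_borel_funP; apply: measurable_fun_ifT => //.
exact: measurable_fun_ler.
Qed.

Lemma voteE A : vote A = #|[set j | (th < \sum_i xi A i 0 * A i j)%R]%SET|%:R
  - #|[set j | (\sum_i xi A i 0 * A i j < - th)%R]%SET|%:R.
Proof.
have natb (b : bool) : b%:R = if b then 1%:R else 0 :> R by case: b.
rewrite /vote sumrB; congr (_ - _); rewrite -sum1_card natr_sum [RHS]big_mkcond;
by apply: eq_bigr => j _; rewrite inE; exact: natb.
Qed.

End Vote.
End MatrixMeasurability.

Lemma measurable_sgr (R : realType) : measurable_fun setT (Num.sg : R -> R).
Proof.
rewrite (_ : Num.sg = fun x : R => if x == 0 then 0 else if x < 0 then -1 else 1).
  apply: measurable_fun_ifT => //; first exact: measurable_fun_eqr.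
  by apply: measurable_fun_ifT => //; exact: measurable_fun_ltr.
by apply/funext => x; case: (sgrP x).
Qed.

(** * Conditioning on labels and means *)

Section Hamming.
Context d (T : measurableType d) (R : realType) (P : probability T R) (n : nat).
Variables (ell : 'I_n -> {RV P >-> R}) (lhat : T -> 'cV[R]_n).

Lemma hamm_ge0 : 0 <= hamm ell lhat.
Proof.
rewrite /hamm mulr_ge0 ?invr_ge0//; apply: lb_le_inf.
  by exists (\sum_(i < n) fine (P [set w | lhat w i 0 != idfun (ell i w)])), idfun; [left|].
by move=> _ [pi _ <-]; apply: sumr_ge0 => i _; exact: fine_ge0.
Qed.

(** The sum of error probabilities is the expected number of errors: at most [delta * n%:R] off
    [Bad], and at most n on it. The identity permutation suffices for the infimum, since estimators
    come with their sign already fixed. *)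
Lemma hamm_le (delta x : R) (Bad : set T) : (0 < n)%N -> 0 <= delta ->
  (forall i, measurable_fun setT (fun w => lhat w i 0)) ->
  measurable Bad -> (P Bad <= x%:E)%E ->
  (forall w, ~ Bad w ->
    #|[set i | lhat w i 0 != ell i w]%SET|%:R <= delta * n%:R) ->
  hamm ell lhat <= delta + x.
Proof.
move=> n0 delta0 mlhat mBad PBad good.
have np : 0 < n%:R :> R by rewrite ltr0n.
pose E i := [set w | lhat w i 0 != ell i w].
have mE i : measurable (E i).
  rewrite (_ : E i = setT `&` (fun w => lhat w i 0 == ell i w) @^-1` [set false]).
    by apply: measurable_fun_eqr.
  by rewrite setTI; apply/seteqP; split => w; rewrite /E/=; case: (_ == _).
suff h : \sum_(i < n) fine (P (E i)) <= n%:R * (delta + x).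
  rewrite /hamm ler_pdivrMl//; apply: le_trans h; apply: ge_inf.
    by exists 0 => _ [pi _ <-]; apply: sumr_ge0 => i _; exact: fine_ge0.
  by exists idfun; [left|].
have fE i : (fine (P (E i)))%:E = P (E i) by rewrite fineK// fin_num_measure.
rewrite -lee_fin -sumEFin; under eq_bigr do rewrite fE.
have mI (A : set T) : measurable A ->
    measurable_fun setT (EFin \o (\1_A : T -> R)).
  by move=> mA; apply/measurable_EFinP; exact: measurable_indic.
under eq_bigr => i _ do rewrite -[X in P X]setIT -integral_indic//.
rewrite -ge0_integral_sum//; last by move=> i; exact: mI.
apply: (@le_trans _ _ (\int[P]_w ((delta * n%:R)%:E + n%:R%:E * (\1_Bad w)%:E))%E).
  apply: ge0_le_integral => //.
  - by move=> w _; apply: sume_ge0 => i _; rewrite lee_fin.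
  - by apply: emeasurable_sum => i; exact: mI.
  - apply: emeasurable_funD => //; apply: measurable_funeM; exact: mI.
  move=> w _; rewrite sumEFin -EFinM -EFinD lee_fin.
  have cardE : \sum_(i < n) \1_(E i) w = #|[set i | lhat w i 0 != ell i w]%SET|%:R :> R.
    rewrite -sum1_card natr_sum [RHS]big_mkcond; apply: eq_bigr => i _.
    rewrite inE indicE; case: ifPn => h; first by rewrite mem_set.
    by rewrite memNset// /E/=; apply/negP.
  rewrite cardE indicE; have [/set_mem wB|/negP wB] := boolP (w \in Bad).
    rewrite mulr1; apply: (@le_trans _ _ n%:R); last by rewrite lerDr mulr_ge0.
    by rewrite ler_nat -[leqRHS]card_ord max_card.
  by rewrite mulr0 addr0; apply: good => Bw; apply: wB; exact/mem_set.
rewrite ge0_integralD//; last 2 first.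
- by move=> w _; rewrite lee_fin mulr_ge0.
- by apply: measurable_funeM; exact: mI.
rewrite ge0_integralZl_EFin//; last exact: mI.
rewrite integral_indic// setIT (_ : \int[P]__ (delta * n%:R)%:E = (delta * n%:R)%:E)%E; last first.
  rewrite -[RHS]mule1 -(probability_setT P); exact: integral_cst.
rewrite mulrDr EFinD [delta * _]mulrC; apply: leeD => //.
by rewrite EFinM; apply: lee_wpmul2l.
Qed.

End Hamming.

Section Conditioning.
Context d (T : measurableType d) (R : realType) (P : probability T R).
Variables (n p : nat) (eps tau : R) (ell : 'I_n -> {RV P >-> R}).
Variables (mu : 'I_p -> {RV P >-> R}) (Z : 'I_n -> 'I_p -> {RV P >-> R}).
Hypothesis arw : arw_model eps tau ell mu Z.

Definition label_mean_event (A : 'I_n -> set R) (C : 'I_p -> set R) : set T :=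
  [set w | (forall i, A i (ell i w)) /\ (forall j, C j (mu j w))].

Lemma measurable_label_mean_event A C : (forall i, measurable (A i)) ->
  (forall j, measurable (C j)) -> measurable (label_mean_event A C).
Proof.
move=> mA mC.
have -> : label_mean_event A C =
    (\bigcap_(i in [set: 'I_n]) (ell i @^-1` A i)) `&`
    (\bigcap_(j in [set: 'I_p]) (mu j @^-1` C j)).
  by apply/seteqP; split => w [h1 h2]; split => i; [move=> _|move=> _| |];
    solve [exact: h1 | exact: h2].
apply: measurableI; apply: fin_bigcap_measurable => // i _;
exact: measurable_funPTI.
Qed.

Lemma label_mean_noise_indep A C (B : 'I_n -> 'I_p -> set R) :
  (forall i, measurable (A i)) -> (forall j, measurable (C j)) ->
  (forall i j, measurable (B i j)) ->
  P (label_mean_event A C `&` [set w | forall i j, B i j (Z i j w)]) =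
  ((\prod_i P (ell i @^-1` A i) * \prod_j P (mu j @^-1` C j)) *
   \prod_(k : 'I_n * 'I_p) normal_prob 0 1 (B k.1 k.2))%E.
Proof.
move=> mA mC mB.
pose D (k : 'I_n + 'I_p + 'I_n * 'I_p) : set R := match k with
  | inl (inl i) => A i | inl (inr j) => C j | inr (i, j) => B i j end.
have mD k : measurable (D k).
  by case: k => [[i|j]|[i j]]; [exact: mA|exact: mC|exact: mB].
have := arw_indep arw mD.
have -> : \bigcap_(k in [set: 'I_n + 'I_p + 'I_n * 'I_p]) (arw_family ell mu Z k @^-1` D k) =
    label_mean_event A C `&` [set w | forall i j, B i j (Z i j w)].
  apply/seteqP; split => w.
    move=> h; split; first by split=> [i|j]; [exact: (h (inl (inl i)))|exact: (h (inl (inr j)))].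
    by move=> i j; exact: (h (inr (i, j))).
  by move=> [[h1 h2] h3] [[i|j]|[i j]] _ /=; [exact: h1|exact: h2|exact: h3].
move=> ->; rewrite !big_sumType/=; congr (_ * _)%E.
apply: eq_bigr => -[i j] _ /=.
exact: (arw_Z arw).
Qed.

Lemma label_mean_eventE A C : (forall i, measurable (A i)) ->
  (forall j, measurable (C j)) ->
  P (label_mean_event A C) =
  (\prod_i P (ell i @^-1` A i) * \prod_j P (mu j @^-1` C j))%E.
Proof.
move=> mA mC.
have := @label_mean_noise_indep A C (fun _ _ => setT) mA mC (fun _ _ => measurableT).
rewrite (_ : [set w | _] = setT) ?setIT; last by apply/seteqP; split.
move=> ->; rewrite [X in (_ * X)%E]big1 ?mule1// => k _.
exact: probability_setT.
Qed.

(** Joint independence factors the labels and means out as a constant mass. Leaving the restriction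
    unnormalised avoids dividing by a mass that may vanish. *)
Lemma noise_gaussian_restr A C (mE : measurable (label_mean_event A C)) :
  (forall i, measurable (A i)) -> (forall j, measurable (C j)) ->
  @indep_family _ _ _ (measurableTypeR R) _ _ (mrestr P mE)
    (fine (P (label_mean_event A C))) (fun k : 'I_n * 'I_p => Z k.1 k.2)
    (fun=> normal_prob 0 1).
Proof.
move=> mA mC B mB; rewrite /= /mrestr setIC fineK ?fin_num_measure//.
rewrite label_mean_eventE//.
rewrite (eq_bigr (fun k => normal_prob 0 1 (B (k.1, k.2)))) => [|[]//].
rewrite -(@label_mean_noise_indep A C (fun i j => B (i, j)) mA mC (fun i j => mB (i, j))) /=.
  congr (P (_ `&` _)); apply/seteqP; split => w h.
    by move=> i j; exact: (h (i, j)).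
  by move=> [i j] _; exact: h.
Qed.

Lemma means_indep : @indep_family _ _ _ R _ _ P 1 (fun j => mu j : T -> R)
  (fun j => distribution P (mu j)).
Proof.
move=> B mB; rewrite mul1e.
have := @label_mean_eventE (fun=> setT) B (fun=> measurableT) mB.
rewrite [in X in _ = X -> _]big1 ?mul1e; last by move=> i _; rewrite preimage_setT probability_setT.
move=> <-; congr (P _); apply/seteqP; split => w h; first by split=> // j; exact: (h j).
by move=> j _; case: h => _; exact.
Qed.

End Conditioning.

(** * Support size and total probability *)

Section Decomposition.
Context d (T : measurableType d) (R : realType) (P : probability T R).
Variables (n p : nat) (eps tau : R) (ell : 'I_n -> {RV P >-> R}).
Variables (mu : 'I_p -> {RV P >-> R}) (Z : 'I_n -> 'I_p -> {RV P >-> R}).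
Hypothesis arw : arw_model eps tau ell mu Z.
Hypotheses (eps_ge0 : 0 <= eps) (eps_le1 : eps <= 1) (tau_gt0 : 0 < tau).

Definition signals (w : T) : {set 'I_p} := [set j | mu j w == tau]%SET.

Let msig j : measurable_fun setT (fun w => (mu j w == tau)%:R : R).
Proof.
rewrite (_ : (fun w => _) = fun w => if mu j w == tau then 1 else 0).
  by apply: measurable_fun_ifT => //; exact: measurable_fun_eqr.
by apply/funext => w; case: (_ == _).
Qed.

Let f (x : R) : R := expR (- (x == tau)%:R).

Let fE x : f x = expR (-1) * \1_[set tau] x + \1_(~` [set tau]) x.
Proof.
rewrite /f !indicE; case: eqP => [->|xt].
  by rewrite mem_set// memNset/= ?mulr1 ?addr0//; exact.
by rewrite memNset// mem_set// oppr0 expR0 mulr0 add0r.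
Qed.

Let mf : measurable_fun setT f.
Proof.
rewrite (funext fE); apply: measurable_funD.
  by apply: measurable_funM => //; exact: measurable_indic.
by apply: measurable_indic; exact: measurableC.
Qed.

Let intf j : (\int[distribution P (mu j)]_x (f x)%:E =
  (1 - (1 - expR (-1)) * eps)%:E)%E.
Proof.
under eq_integral do rewrite fE EFinD EFinM.
have mC : measurable (~` [set tau]) by exact: measurableC.
rewrite ge0_integralD//; last 2 first.
- by apply: measurable_funeM; apply/measurable_EFinP; exact: measurable_indic.
- by apply/measurable_EFinP; exact: measurable_indic.
rewrite ge0_integralZl_EFin ?expR_ge0//; last first.
  by apply/measurable_EFinP; exact: measurable_indic.
have Dt : distribution P (mu j) [set tau] = eps%:E by exact: (arw_mu_tau arw).
have Dc : distribution P (mu j) (~` [set tau]) = (1 - eps)%:E.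
  have -> : distribution P (mu j) (~` [set tau]) = (1 - distribution P (mu j) [set tau])%E.
    exact: (@probability_setC _ _ _ (distribution P (mu j))).
  by rewrite EFinB; congr (_ - _)%E.
rewrite !integral_indic// !setIT.
transitivity ((expR (-1))%:E * eps%:E + (1 - eps)%:E)%E.
  by congr (_ * _ + _)%E; [exact: Dt|exact: Dc].
by rewrite -EFinM -EFinD; congr EFin; ring.
Qed.

(** Chernoff bound for a binomial count at parameter -1. From exp(-1) <= 4/9, a consequence of
    (3/2)^2 <= e, the exponent is at most -(5/9 - 1/2) p eps = -p eps / 18. A lower bound on the
    support is the useful direction: the signal conditions of [spike_event] improve as the support
    grows. *)
Lemma few_signals : exists B, [/\ measurable B,
  (P B <= (expR (- (p%:R * eps) / 20))%:E)%E &
  forall w, ~ B w -> p%:R * eps < 2 * #|signals w|%:R].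
Proof.
pose F w : R := \sum_j - (mu j w == tau)%:R.
have mF : measurable_fun setT F.
  by apply: measurable_sum => j; exact: measurableT_comp.
have FE w : F w = - #|signals w|%:R.
  rewrite /F sumrN -sum1_card natr_sum [in RHS]big_mkcond; congr (- _).
  by apply: eq_bigr => j _; rewrite inE; case: (_ == _).
have mmu j : measurable_fun setT (mu j : T -> R) by [].
have f0 (x : R) : 0 <= f x by exact: expR_ge0.
have I := @ge0_integral_indep _ _ _ _ _ _ _ _ _ _ mmu (means_indep arw)
  (fun=> f) _ (fun=> mf) (fun=> f0) intf.
have e25 : expR (-1) <= 4 / 9 :> R.
  rewrite expRN -[leRHS]invrK lef_pV2 ?posrE ?expR_gt0//.
  apply: le_trans (@expR_ge_sqr R 1 ler01); lra.
have FI : (\int[P]_w (expR (F w))%:E <= (expR (- (5 / 9) * (p%:R * eps)))%:E)%E.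
  under eq_integral do rewrite /F expR_sum.
  rewrite I lee_fin mul1r prodr_const card_ord.
  have -> : - (5 / 9) * (p%:R * eps) = p%:R * (- (5 / 9) * eps) by ring.
  rewrite expRM_natl lerXn2r ?nnegrE ?expR_ge0//.
    have := mulr_ge0 (expR_ge0 (-1)) eps_ge0; have := eps_le1; lra.
  apply: le_trans (expR_ge1Dx _); have := ler_wpM2r eps_ge0 e25; lra.
exists [set w | - (p%:R * eps / 2) <= F w]; split.
- exact: measurable_ge_set.
- apply: le_trans (chernoff_measure _ mF FI) _; rewrite lee_fin -expRD ler_expR.
  have : 0 <= p%:R * eps by rewrite mulr_ge0.
  by lra.
by move=> w /= /negP; rewrite -ltNge FE; lra.
Qed.

Definition label_vec (b : {ffun 'I_n -> bool}) (i : 'I_n) : R := if b i then 1 else -1.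

Definition label_support_event (b : {ffun 'I_n -> bool}) (S : {set 'I_p}) : set T :=
  label_mean_event ell mu (fun i => [set label_vec b i])
    (fun j => [set if j \in S then tau else 0]).

Lemma measurable_label_support_event b S : measurable (label_support_event b S).
Proof. exact: measurable_label_mean_event. Qed.

Let null_event : exists B, [/\ measurable B, P B = 0%E &
  forall w, ~ B w -> (forall i, ell i w = 1 \/ ell i w = -1) /\
    (forall j, mu j w = tau \/ mu j w = 0)].
Proof.
have nul (Y : {RV P >-> R}) (x y q : R) : x != y ->
    P (Y @^-1` [set x]) = q%:E -> P (Y @^-1` [set y]) = (1 - q)%:E ->
    P (Y @^-1` (~` ([set x] `|` [set y]))) = 0%E.
  move=> xy Px Py; rewrite -preimage_setC probability_setC ?preimage_setU.
    rewrite measureU ?Px ?Py; last 3 first.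
    - exact: measurable_funPTI.
    - exact: measurable_funPTI.
    - rewrite -preimage_setI; apply/seteqP; split => w //= [-> e].
      by rewrite e eqxx in xy.
    transitivity (1 - (q + (1 - q))%:E)%E; last by rewrite -EFinB; congr EFin; ring.
    by rewrite EFinD -Px -Py.
  by apply: measurableU; exact: measurable_funPTI.
pose A (k : 'I_n + 'I_p) : set T := match k with
  | inl i => ell i @^-1` (~` ([set 1] `|` [set -1]))
  | inr j => mu j @^-1` (~` ([set tau] `|` [set 0])) end.
have m2 (x y : R) : measurable (~` ([set x] `|` [set y])).
  by apply: measurableC; exact: measurableU.
have mA k : measurable (A k) by case: k => ?; exact: measurable_funPTI.
have A0 k : P (A k) = 0%E.
  case: k => [i|j].
    apply: (@nul _ _ _ 2^-1); first by rewrite -addr_eq0 (_ : 1 + 1 = 2)// pnatr_eq0.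
      exact: (arw_ell1 arw).
    by rewrite (arw_ellN1 arw); congr EFin; field.
  apply: (@nul _ _ _ eps); [by rewrite gt_eqF|exact: (arw_mu_tau arw)|exact: (arw_mu_0 arw)].
have [mU PU] := finite_union_bound P mA.
exists (\bigcup_k A k); split=> //.
  apply/eqP; rewrite eq_le measure_ge0 andbT; apply: le_trans PU _.
  by rewrite big1// => k _; exact: A0.
move=> w wA; split=> i; apply: contrapT => h; apply: wA.
  by exists (inl i).
by exists (inr i).
Qed.

Let sum_label_support :
  \sum_(k : {ffun 'I_n -> bool} * {set 'I_p}) fine (P (label_support_event k.1 k.2)) = 1.
Proof.
have PE b S : fine (P (label_support_event b S)) =
    (\prod_(i < n) 2^-1) * \prod_(j < p) (if j \in S then eps else 1 - eps).
  rewrite /label_support_event (label_mean_eventE arw)//.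
  rewrite (eq_bigr (fun=> (2^-1)%:E)); last first.
    move=> i _; rewrite /label_vec; case: (b i); [exact: (arw_ell1 arw)|exact: (arw_ellN1 arw)].
  rewrite (eq_bigr (fun j => (if j \in S then eps else 1 - eps)%:E)); last first.
    move=> j _; case: (j \in S); [exact: (arw_mu_tau arw)|exact: (arw_mu_0 arw)].
  by rewrite !prodEFin -EFinM.
rewrite -(pair_bigA _ (fun b S => fine (P (label_support_event b S))))/=.
under eq_bigr do under eq_bigr do rewrite PE.
have SS : \sum_(S : {set 'I_p}) \prod_(j < p) (if j \in S then eps else 1 - eps) = 1.
  transitivity (\prod_(j < p) (eps + (1 - eps))); first by rewrite bigA_distr.
  by rewrite big1// => j _; ring.
under eq_bigr do rewrite -mulr_sumr SS mulr1.
rewrite sumr_const card_ffun card_bool card_ord prodr_const card_ord exprVn.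
by rewrite -[LHS]mulr_natr natrX mulVf// expf_neq0.
Qed.

(** Law of total probability. There are exponentially many pairs of labels and support, but each bad
    set is cut down to its own event and weighted by its mass; the masses sum to 1, so the union
    costs nothing. *)
Lemma conditional_union_event (x : R) (good : {ffun 'I_n -> bool} -> {set 'I_p} -> T -> Prop) :
  0 <= x ->
  (forall b (S : {set 'I_p}), p%:R * eps < 2 * #|S|%:R ->
    exists B : set T, [/\ measurable B,
    (P (B `&` label_support_event b S) <= (fine (P (label_support_event b S)) * x)%:E)%E &
    forall w, ~ B w -> good b S w]) ->
  exists B, [/\ measurable B, (P B <= (x + expR (- (p%:R * eps) / 20))%:E)%E &
    forall w, ~ B w -> exists b S, [/\ label_support_event b S w, good b S w &
      p%:R * eps < 2 * #|S|%:R]].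
Proof.
move=> x0 H.
have [Bn [mBn PBn hBn]] := null_event.
have [Bf [mBf PBf hBf]] := few_signals.
have H' (k : {ffun 'I_n -> bool} * {set 'I_p}) : exists B : set T, [/\ measurable B,
    (P (B `&` label_support_event k.1 k.2) <= (fine (P (label_support_event k.1 k.2)) * x)%:E)%E &
    p%:R * eps < 2 * #|k.2|%:R -> forall w, ~ B w -> good k.1 k.2 w].
  have [h|h] := boolP (p%:R * eps < 2 * #|k.2|%:R).
    by have [B [h1 h2 h3]] := H k.1 k.2 h; exists B; split.
  exists set0; split=> //; rewrite set0I measure0 lee_fin mulr_ge0//.
  exact: fine_ge0.
have [B BP] := choice H'.
pose A k := B k `&` label_support_event k.1 k.2.
have mA k : measurable (A k).
  apply: measurableI; first by have [] := BP k.
  exact: measurable_label_support_event.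
have [mU PU] := finite_union_bound P mA.
have mfU := measurableU _ _ mBf mU.
exists (Bn `|` (Bf `|` \bigcup_k A k)); split.
- exact: measurableU.
- apply: (le_trans (@measureU2 _ _ _ P _ _ mBn mfU)).
  rewrite -[leRHS]add0e; apply: leeD; first by rewrite -PBn.
  apply: (le_trans (@measureU2 _ _ _ P _ _ mBf mU)); rewrite addrC EFinD.
  apply: leeD => //; apply: le_trans PU _.
  apply: (@le_trans _ _ (\sum_k (fine (P (label_support_event k.1 k.2)) * x)%:E)%E).
    by apply: lee_sum => k _; have [] := BP k.
  by rewrite sumEFin -mulr_suml sum_label_support mul1r.
move=> w /not_orP[wn] /not_orP[wf wU].
have [hl hm] := hBn w wn; have hs := hBf w wf.
exists [ffun i => ell i w == 1], (signals w).
have wE : label_support_event [ffun i => ell i w == 1] (signals w) w.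
  split=> [i|j] /=.
    rewrite /label_vec ffunE; case: (hl i) => ->; first by rewrite eqxx.
    rewrite ifF//; apply/negbTE.
    by rewrite eq_sym -addr_eq0 (_ : 1 + 1 = 2)// pnatr_eq0.
  rewrite inE; case: (hm j) => ->; first by rewrite eqxx.
  by rewrite eq_sym gt_eqF.
split=> //; have [_ _ h] := BP ([ffun i => ell i w == 1], signals w).
by apply: h => // Bw; apply: wU; exists ([ffun i => ell i w == 1], signals w).
Qed.

End Decomposition.

(** * Error bounds at a fixed sample size *)

Section SingleSize.
Context d (T : measurableType d) (R : realType) (P : probability T R).
Variables (n p : nat) (eps tau : R) (ell : 'I_n -> {RV P >-> R}).
Variables (mu : 'I_p -> {RV P >-> R}) (Z : 'I_n -> 'I_p -> {RV P >-> R}).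
Hypothesis arw : arw_model eps tau ell mu Z.
Hypotheses (eps_ge0 : 0 <= eps) (eps_le1 : eps <= 1) (tau_gt0 : 0 < tau).
Hypotheses (n_gt0 : (0 < n)%N) (np : (n <= p)%N) (p_gt1 : (1 < p)%N).

Local Notation X := (arw_data ell mu Z).
Local Notation Om := (label_support_event tau ell mu).

Let n0 : 0 < n%:R :> R. Proof. by rewrite ltr0n. Qed.
Let p0 : 0 < p%:R :> R. Proof. by rewrite ltr0n ltnW. Qed.

Let arw_dataE w i j : X w i j = ell i w * mu j w + Z i j w.
Proof. by rewrite /arw_data !mxE big_ord1 !mxE. Qed.

Lemma measurable_arw_data i j : measurable_fun setT (fun w => X w i j).
Proof.
rewrite (funext (fun w => arw_dataE w i j)).
by apply: measurable_funD => //; exact: measurable_funM.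
Qed.

Let spikedE b S w : Om b S w ->
  forall i j, X w i j = spiked (label_vec R b) S tau (fun i j => Z i j w) i j.
Proof. by move=> [h1 h2] i j; rewrite arw_dataE /spiked h1 h2. Qed.

Let label_sign (b : {ffun 'I_n -> bool}) i : label_vec R b i = 1 \/ label_vec R b i = -1 :> R.
Proof. by rewrite /label_vec; case: (b i); [left|right]. Qed.

Let Q b S : {finite_measure set T -> \bar R} :=
  mrestr P (@measurable_label_support_event _ _ _ _ _ _ tau ell mu b S).
Let c b S := fine (P (Om b S)).
Let c_ge0 b S : 0 <= c b S. Proof. exact: fine_ge0. Qed.

Let gaussZ b S : @indep_family _ _ _ (measurableTypeR R) _ _ (Q b S) (c b S)
  (fun k : 'I_n * 'I_p => Z k.1 k.2 : T -> R) (fun=> normal_prob 0 1).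
Proof. by apply: (noise_gaussian_restr arw). Qed.

Let mZ i j : measurable_fun setT (Z i j : T -> R). Proof. by []. Qed.

Lemma simple_aggregation_hamm (x : R) :
  n%:R * (2 * expR (- (p%:R * (eps * tau) ^+ 2) / 8)) <= x ->
  hamm ell (fun w => simple_aggregation (X w)) <=
    x + expR (- (p%:R * eps) / 20).
Proof.
(* Lies below the signal [#|S|%:R * tau] of a row sum as soon as [#|S|] exceeds half its mean; if no
   noise row sum reaches it, every label is correct. *)
move=> hx; pose M := p%:R * eps * tau / 2.
have M0 : 0 <= M by rewrite !mulr_ge0// ltW.
have x0 : 0 <= x by apply: le_trans hx; rewrite !mulr_ge0 ?expR_ge0// ltW.
have rowt b S (s : R) i : s ^+ 2 = 1 -> (Q b S [set w | M <= s * \sum_j Z i j w]%R <=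
    (c b S * expR (- (p%:R * (eps * tau) ^+ 2) / 8))%:E)%E.
  move=> s1; pose u k (j : 'I_p) := if k == i then s else 0 : R.
  have u1 : \sum_k \sum_j u k j ^+ 2 <= p%:R.
    rewrite (bigD1 i)//= [X in _ + X]big1 ?addr0 => [|k /negPf ki].
      by rewrite /u eqxx s1 sumr_const card_ord.
    by rewrite big1// => j _; rewrite /u ki expr0n.
  have := gauss_matrix_tail (c_ge0 b S) mZ (@gaussZ b S) u1 p0 M0.
  have -> : - M ^+ 2 / (2 * p%:R) = - (p%:R * (eps * tau) ^+ 2) / 8.
    by rewrite /M; field; rewrite gt_eqF.
  congr (Q b S _ <= _)%E; apply/seteqP; split => w /=;
  rewrite (bigD1 i)//= [X in _ + X]big1 ?addr0 /u ?eqxx -?mulr_sumr// => k /negPf ki;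
  by rewrite big1// => j _; rewrite ki mul0r.
pose good (b : {ffun 'I_n -> bool}) (S : {set 'I_p}) w :=
  forall i, `|\sum_j Z i j w| < M.
have ev b (S : {set 'I_p}) : p%:R * eps < 2 * #|S|%:R -> exists B : set T,
    [/\ measurable B, (P (B `&` Om b S) <= (c b S * x)%:E)%E &
    forall w, ~ B w -> good b S w].
  move=> _; pose A i : set T := [set w | M <= 1 * \sum_j Z i j w] `|`
     [set w | M <= (-1) * \sum_j Z i j w].
  have mS (s : R) i : measurable [set w | M <= s * \sum_j Z i j w].
    apply: measurable_ge_set; apply: measurable_funM => //.
    exact: measurable_sum.
  have mA i : measurable (A i) by exact: measurableU.
  have AQ i : (Q b S (A i) <= (c b S * (2 * expR (- (p%:R * (eps * tau) ^+ 2) / 8)))%:E)%E.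
    rewrite (_ : c b S * (2 * _) = c b S * expR (- (p%:R * (eps * tau) ^+ 2) / 8) +
      c b S * expR (- (p%:R * (eps * tau) ^+ 2) / 8)); last by ring.
    rewrite EFinD.
    apply: (le_trans (@measureU2 _ _ _ (Q b S) _ _ (mS _ _) (mS _ _))).
    by apply: leeD; apply: rowt; rewrite ?sqrrN expr1n.
  exists (\bigcup_i A i); split.
  - by have [] := finite_union_bound (Q b S) mA.
  - apply: (le_trans (finite_union_bound_cst mA AQ)).
    by rewrite lee_fin ler_wpM2l// card_ord.
  move=> w wB i; rewrite ltr_norml; apply/andP; split.
    rewrite ltrNl ltNge; apply/negP => h; apply: wB; exists i => //; right.
    by rewrite /= mulN1r.
  rewrite ltNge; apply/negP => h; apply: wB; exists i => //; left.
  by rewrite /= mul1r.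
have [B [mB PB hB]] := conditional_union_event arw eps_ge0 eps_le1 tau_gt0 x0 ev.
rewrite -[leRHS]add0r; apply: (hamm_le n_gt0 _ _ mB PB) => //.
  move=> i; rewrite (_ : (fun w => _) = fun w => Num.sg (\sum_j X w i j)).
    apply: (measurableT_comp (@measurable_sgr R)).
    by apply: measurable_sum => j; exact: measurable_arw_data.
  by apply/funext => w; rewrite !mxE summxE; congr Num.sg; apply: eq_bigr => j _; rewrite mxE.
move=> w /hB [b [S [wO gw Sp]]].
rewrite mul0r (_ : [set i | _]%SET = finset.set0) ?cards0//; apply/setP => i.
rewrite !inE; apply/negbTE; rewrite negbK; apply/eqP.
rewrite !mxE summxE (eq_bigr (X w i)) => [|j _]; last by rewrite mxE.
under eq_bigr do rewrite (spikedE wO) /spiked.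
rewrite big_split/= -mulr_sumr.
have -> : \sum_(j < p) (if j \in S then tau else 0) = #|S|%:R * tau.
  by rewrite mulr_natl -sumr_const [RHS]big_mkcond.
have [h1 _] := wO; rewrite (h1 i).
have sM : M < #|S|%:R * tau.
  by rewrite /M mulrAC ltr_pM2r//; move: Sp; lra.
have := gw i; rewrite ltr_norml => /andP[g1 g2].
case: (label_sign b i) => ->.
  by rewrite gtr0_sg// mul1r; lra.
by rewrite ltr0_sg// mulN1r; lra.
Qed.

Section Spectral.
Variables (eta kappa D : R).
Hypotheses (eta_gt0 : 0 < eta) (eta_le : 16 * eta <= 3).
Hypotheses (kappa_gt0 : 0 < kappa) (kappa_le1 : kappa <= 1).
Hypothesis D_large : 16 ^+ 4 / eta ^+ 2 * (1 + ln p%:R + kappa^-1) <= D.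
Hypotheses (D_s : 2 * D <= p%:R * eps * tau ^+ 2) (D_n : D <= n%:R * tau ^+ 2).
Hypothesis p_large : 32 <= kappa * p%:R ^+ 2.

Let eta_le1 : eta <= 1. Proof. by have := eta_le; have := eta_gt0; lra. Qed.
Let th : R := Num.sqrt n%:R * tau / 4.

Let good_spike (F : {set 'I_p}) (b : {ffun 'I_n -> bool}) (S : {set 'I_p}) w :=
  forall xi, \sum_i xi i ^+ 2 = 1 ->
  \sum_(j in F) (\sum_i label_vec R b i * spiked (label_vec R b) S tau (fun i j => Z i j w) i j) ^+ 2 <=
    n%:R * \sum_(j in F) (\sum_i xi i * spiked (label_vec R b) S tau (fun i j => Z i j w) i j) ^+ 2 ->
  (1 - 4 * eta) * n%:R <= (\sum_i xi i * label_vec R b i) ^+ 2 /\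
  (4 * #|[set j | (th <= `|\sum_i xi i * Z i j w|)%R]%SET| < #|S|)%N.

Let support_gt0 (S : {set 'I_p}) : p%:R * eps < 2 * #|S|%:R -> (0 < #|S|)%N.
Proof.
move=> h; have : 0 <= p%:R * eps by rewrite mulr_ge0// ltW.
by move=> /le_lt_trans /(_ h); rewrite pmulr_rgt0// ltr0n.
Qed.

Let spike_good (F : {set 'I_p}) b (S : {set 'I_p}) : p%:R * eps < 2 * #|S|%:R -> S \subset F ->
  D * #|F|%:R <= n%:R * #|S|%:R ^+ 2 * tau ^+ 4 ->
  exists B : set T, [/\ measurable B,
    (P (B `&` Om b S) <= (c b S * (5 * kappa))%:E)%E &
    forall w, ~ B w -> good_spike F b S w].
Proof.
move=> Sp SF DF.
have Ds : D <= #|S|%:R * tau ^+ 2.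
  have t2 : 0 <= tau ^+ 2 by rewrite exprn_ge0// ltW.
  by have := ler_wpM2r t2 (ltW Sp); have := D_s; lra.
exact: (spike_event (c_ge0 b S) mZ (@gaussZ b S) n_gt0 np p_gt1 (label_sign b) SF
  (support_gt0 Sp) tau_gt0 eta_gt0 eta_le1 kappa_gt0 kappa_le1 D_large Ds D_n DF p_large).
Qed.

Let aligned_errors b (S : {set 'I_p}) w (A : 'M[R]_(n, p)) (F : {set 'I_p})
    (xi : 'M[R]_(n, p) -> 'cV[R]_n) :
  p%:R * eps < 2 * #|S|%:R ->
  (forall i j, A i j = spiked (label_vec R b) S tau (fun i j => Z i j w) i j) ->
  good_spike F b S w -> \sum_i xi A i 0 ^+ 2 = 1 ->
  (forall v : 'I_n -> R, \sum_(j in F) (\sum_i v i * A i j) ^+ 2 <=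
    (\sum_i v i ^+ 2) * \sum_(j in F) (\sum_i xi A i 0 * A i j) ^+ 2) ->
  #|[set i | sgn_mx (vote_sign th xi A *: xi A) i 0 != label_vec R b i]%SET|%:R
    <= 8 * eta * n%:R.
Proof.
move=> Sp AE gw xi1 opt; set l := label_vec R b.
have l2 : \sum_i l i ^+ 2 = n%:R.
  rewrite (eq_bigr (fun=> 1)) ?sumr_const ?card_ord// => i _.
  by case: (label_sign b i) => e; rewrite /l e ?sqrrN expr1n.
have AE' : A = \matrix_(i, j) spiked l S tau (fun i j => Z i j w) i j.
  by apply/matrixP => i j; rewrite mxE AE.
have opt' : \sum_(j in F) (\sum_i l i * spiked l S tau (fun i j => Z i j w) i j) ^+ 2 <=
    n%:R * \sum_(j in F) (\sum_i xi A i 0 * spiked l S tau (fun i j => Z i j w) i j) ^+ 2.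
  rewrite -l2; have := opt l; congr (_ <= _ * _);
  by apply: eq_bigr => j _; congr (_ ^+ 2); apply: eq_bigr => i _; rewrite AE.
have [k2 few] := gw (fun i => xi A i 0) xi1 opt'.
set k := \sum_i xi A i 0 * l i in k2.
(* [16 * eta <= 3] is exactly 1 - 4 eta >= 1/4, the overlap required by the vote. *)
have kn : n%:R <= 4 * k ^+ 2.
  have : (1 - 4 * eta) * n%:R <= k ^+ 2 by exact: k2.
  have h : 1 <= 4 * (1 - 4 * eta) by have := eta_le; lra.
  have := ler_wpM2r (ltW n0) h; lra.
have k0 : k != 0.
  by apply/eqP => e; move: kn; rewrite e expr0n mulr0 leNgt n0.
have th0 : 0 < th by rewrite !mulr_gt0// sqrtr_gt0.
have th2 : 16 * th ^+ 2 = n%:R * tau ^+ 2.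
  by rewrite /th !exprMn sqr_sqrtr ?(ltW n0)//; field.
have [vp vn] := spike_vote tau_gt0 th2 th0 kn few.
have ve : vote_sign th xi A = Num.sg k.
  rewrite /vote_sign voteE subr_ge0 ler_nat.
  have cE (f : R -> bool) : [set j | f (\sum_i xi A i 0 * A i j)]%SET =
      [set j | f (\sum_i xi A i 0 * spiked l S tau (fun i j => Z i j w) i j)]%SET.
    apply/setP => j; rewrite !inE; congr f.
    by apply: eq_bigr => i _; rewrite AE.
  rewrite (cE (fun x => th < x)) (cE (fun x => x < - th)).
  have [kp|kn'|e] := ltrgt0P k; last by rewrite e eqxx in k0.
    by rewrite gtr0_sg// ltnW// vp.
  by rewrite ltr0_sg// leqNgt vn.
have sk : Num.sg k = 1 \/ Num.sg k = -1.
  by have [kp|kn'|e] := ltrgt0P k; [left; exact: gtr0_sg|right; exact: ltr0_sg|rewrite e eqxx in k0].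
have nk : 0 <= Num.sg k * k by rewrite -normrEsg.
have := sign_mismatch_card (label_sign b) xi1 sk nk k2.
congr (#|pred_of_set _|%:R <= _); apply/setP => i.
by rewrite !inE !mxE ve.
Qed.

(** Common to both spectral methods. [F S] is a set fixed by the support, so after conditioning the
    noise bounds concern a deterministic set of columns; the random selection enters only through
    [sel], under which [xi] is optimal for [F S]. *)
Let spectral_hamm (x : R) (xi : 'M[R]_(n, p) -> 'cV[R]_n) (F : {set 'I_p} -> {set 'I_p})
    (sel : {ffun 'I_n -> bool} -> {set 'I_p} -> T -> Prop) : 0 <= x ->
  mx_borel_vec xi ->
  (forall S : {set 'I_p}, p%:R * eps < 2 * #|S|%:R -> S \subset F S /\
    D * #|F S|%:R <= n%:R * #|S|%:R ^+ 2 * tau ^+ 4) ->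
  (forall b (S : {set 'I_p}), p%:R * eps < 2 * #|S|%:R -> exists B : set T,
    [/\ measurable B, (P (B `&` Om b S) <= (c b S * x)%:E)%E &
    forall w, ~ B w -> sel b S w]) ->
  (forall b (S : {set 'I_p}) w, Om b S w -> sel b S w -> \sum_i xi (X w) i 0 ^+ 2 = 1 /\
    forall v : 'I_n -> R, \sum_(j in F S) (\sum_i v i * X w i j) ^+ 2 <=
    (\sum_i v i ^+ 2) * \sum_(j in F S) (\sum_i xi (X w) i 0 * X w i j) ^+ 2) ->
  hamm ell (fun w => sgn_mx (vote_sign th xi (X w) *: xi (X w))) <=
    8 * eta + (5 * kappa + x + expR (- (p%:R * eps) / 20)).
Proof.
move=> x0 bxi FP selP optP.
have ev b (S : {set 'I_p}) : p%:R * eps < 2 * #|S|%:R -> exists B : set T,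
    [/\ measurable B, (P (B `&` Om b S) <= (c b S * (5 * kappa + x))%:E)%E &
    forall w, ~ B w -> good_spike (F S) b S w /\ sel b S w].
  move=> Sp; have [SF DF] := FP S Sp.
  have [B1 [m1 q1 h1]] := spike_good b Sp SF DF.
  have [B2 [m2 q2 h2]] := selP b S Sp.
  exists (B1 `|` B2); split; first exact: measurableU.
    rewrite mulrDr EFinD.
    by apply: (le_trans (@measureU2 _ _ _ (Q b S) _ _ m1 m2)); apply: leeD.
  by move=> w /not_orP[w1 w2]; split; [exact: h1|exact: h2].
have x0' : 0 <= 5 * kappa + x by rewrite addr_ge0// mulr_ge0// ltW.
have [B [mB PB hB]] := conditional_union_event arw eps_ge0 eps_le1 tau_gt0 x0' ev.
apply: (hamm_le n_gt0 _ _ mB PB).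
- by rewrite mulr_ge0// ltW.
- move=> i; rewrite (_ : (fun w => _) =
      fun w => Num.sg (vote_sign th xi (X w) * xi (X w) i 0)); last first.
    by apply/funext => w; rewrite !mxE.
  apply: (measurableT_comp (@measurable_sgr R)); apply: measurable_funM.
    apply: mx_borel_fun_comp; first exact: measurable_arw_data.
    by have [] := vote_sign_rule th bxi.
  by apply: (mx_borel_fun_comp (f := fun A => xi A i 0)); [exact: measurable_arw_data|exact: bxi].
move=> w /hB [b [S [wO [gw sw] Sp]]].
have [xi1 opt] := optP b S w wO sw.
have := aligned_errors Sp (spikedE wO) gw xi1 opt.
congr (#|pred_of_set _|%:R <= _); apply/setP => i; rewrite !inE.
by have [h1 _] := wO; rewrite (h1 i).
Qed.

Lemma classical_pca_hamm (xi : 'M[R]_(n, p) -> 'cV[R]_n) :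
  4 * D * p%:R <= n%:R * (p%:R * eps) ^+ 2 * tau ^+ 4 ->
  (forall A, first_left_singular_vector A (xi A)) -> mx_borel_vec xi ->
  hamm ell (fun w => sgn_mx (vote_sign th xi (X w) *: xi (X w))) <=
    8 * eta + (5 * kappa + expR (- (p%:R * eps) / 20)).
Proof.
move=> Dp svd bxi; rewrite -[5 * kappa]addr0.
apply: (spectral_hamm (F := fun=> [set: 'I_p]%SET) (sel := fun _ _ _ => True)) => //.
- move=> S Sp; split; first exact: finset.subsetT.
  rewrite cardsT card_ord.
  have pe0 : 0 <= p%:R * eps by rewrite mulr_ge0// ltW.
  have nt0 : 0 <= n%:R * tau ^+ 4 by rewrite mulr_ge0 ?exprn_ge0 ?ltW.
  have h : (p%:R * eps) ^+ 2 <= (2 * #|S|%:R) ^+ 2.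
    by rewrite lerXn2r ?nnegrE ?(ltW Sp)// mulr_ge0.
  have := ler_wpM2l nt0 h; rewrite exprMn; lra.
- move=> b S _; exists set0; split=> //.
  by rewrite set0I measure0 mulr0.
move=> b S w _ _; have [xi1 opt] := first_left_singular_vector_max n_gt0 (svd (X w)).
have sT (f : 'I_p -> R) : \sum_(j in [set: 'I_p]%SET) f j = \sum_j f j.
  by apply: eq_bigl => j; rewrite inE.
by split=> // v; rewrite !sT; exact: opt.
Qed.

(** * Exact recovery of the support by selection *)

Section Selection.
Variable q : R.
Hypotheses (q_ge3 : 3 <= q) (tau_le1 : tau <= 1).
Hypothesis tau_large : 16 * q * ln p%:R <= n%:R * tau ^+ 4.
Hypothesis small_null : expR (- (ln p%:R / 2)) <= kappa.
Hypothesis small_signal : 2 * p%:R * expR (- (n%:R * tau ^+ 4) / 128) <= kappa.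

(** The threshold of [if_selected] rescaled to the excess of a squared column norm over n. *)
Let thr : R := 2 * Num.sqrt (n%:R * (q * ln p%:R)).
Let lnp0 : 0 < ln p%:R :> R. Proof. by rewrite ln_gt0// ltr1n. Qed.
Let qlnp0 : 0 < q * ln p%:R.
Proof. by rewrite mulr_gt0//; have := q_ge3; lra. Qed.
Let thr0 : 0 < thr. Proof. by rewrite mulr_gt0// sqrtr_gt0 mulr_gt0. Qed.
Let thr2 : thr ^+ 2 = 4 * (n%:R * (q * ln p%:R)).
Proof. by rewrite exprMn sqr_sqrtr -?natrX// mulr_ge0// ltW. Qed.

Let thrE (A : 'M[R]_(n, p)) j :
  (j \in if_selected q A) = (n%:R + thr <= \sum_(i < n) A i j ^+ 2).
Proof.
have s0 : 0 < Num.sqrt (2 * n%:R) :> R by rewrite sqrtr_gt0 mulr_gt0.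
rewrite inE /if_stat ler_pdivlMr// lerBrDl; congr (_ + _ <= _).
rewrite -sqrtrM; last by rewrite -mulrA mulr_ge0// ltW.
rewrite (_ : 2 * q * ln p%:R * (2 * n%:R) = 2 ^+ 2 * (n%:R * (q * ln p%:R))); last by ring.
by rewrite sqrtrM ?sqr_ge0// sqrtr_sqr ger0_norm.
Qed.

(** The optimal parameter thr / (4 n) gives p^(-q/2), at most p^-1 p^(-1/2) as q >= 3: the first
    factor pays for the union over columns, the second is below kappa. The 16 in [tau_large] makes
    that parameter at most 1/8. *)
Let null_event b (S : {set 'I_p}) (j : 'I_p) : exists B : set T, [/\ measurable B,
  (Q b S B <= (c b S * (p%:R^-1 * kappa))%:E)%E &
  forall w, ~ B w -> \sum_(i < n) Z i j w ^+ 2 < n%:R + thr].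
Proof.
exists [set w | n%:R + thr <= \sum_(i < n) Z i j w ^+ 2]; split.
- apply: measurable_ge_set; apply: measurable_sum => i; exact: measurable_funX.
- pose l := thr / (4 * n%:R).
  have l0 : 0 < l by rewrite divr_gt0// mulr_gt0.
  have l8 : l <= 8^-1.
    rewrite ler_pdivrMr ?mulr_gt0//.
    have n8 : 0 <= 8^-1 * (4 * n%:R) :> R by rewrite mulr_ge0// mulr_ge0// ltW.
    rewrite -(@ler_pXn2r _ 2) ?nnegrE ?n8 ?(ltW thr0)// thr2.
    have t4 : tau ^+ 4 <= 1 by rewrite exprn_ile1// ltW.
    have tl : 16 * q * ln p%:R <= n%:R.
      by apply: le_trans tau_large _; rewrite ler_piMr// ltW.
    have := ler_wpM2l (ltW n0) tl; rewrite !exprMn; lra.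
  apply: le_trans (gauss_col_sqr_upper_tail (c_ge0 b S) mZ (@gaussZ b S) j (n%:R + thr) l0 l8) _.
  rewrite lee_fin ler_wpM2l//.
  have -> : n%:R * (l + 2 * l ^+ 2) - l * (n%:R + thr) = - (q * ln p%:R / 2).
    have -> : n%:R * (l + 2 * l ^+ 2) - l * (n%:R + thr) = - (thr ^+ 2) / (8 * n%:R).
      by rewrite /l; field; rewrite gt_eqF.
    by rewrite thr2; field; rewrite gt_eqF.
  apply: (@le_trans _ _ (p%:R^-1 * expR (- (ln p%:R / 2)))); last first.
    by rewrite ler_wpM2l// invr_ge0 ltW.
  rewrite -[p%:R^-1 in leRHS]lnK ?posrE ?invr_gt0// lnV ?posrE// -expRD ler_expR.
  have := ler_wpM2r (ltW lnp0) q_ge3; lra.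
by move=> w /negP; rewrite -ltNge.
Qed.

(** A signal adds n tau^2 to the squared norm. The chi-square fluctuation and the cross term each
    lose at most a quarter of it, and the remaining half exceeds [thr] by [tau_large]. *)
Let signal_event b (S : {set 'I_p}) (j : 'I_p) : exists B : set T, [/\ measurable B,
  (Q b S B <= (c b S * (p%:R^-1 * kappa))%:E)%E &
  forall w, ~ B w -> n%:R + thr <=
    \sum_(i < n) (label_vec R b i * tau + Z i j w) ^+ 2].
Proof.
pose l := label_vec R b.
pose B1 := [set w | \sum_(i < n) Z i j w ^+ 2 <= n%:R - n%:R * tau ^+ 2 / 4].
pose B2 := [set w | n%:R * tau / 8 <= \sum_(i < n) (- l i) * Z i j w].
have m1 : measurable B1.
  by apply: le_set_measurable; apply: measurable_sum => i; exact: measurable_funX.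
have m2 : measurable B2.
  by apply: measurable_ge_set; apply: measurable_sum => i; exact: measurable_funM.
have t2 : 0 < tau ^+ 2 by rewrite exprn_gt0.
have t21 : tau ^+ 2 <= 1 by rewrite exprn_ile1// ltW.
have l2 : \sum_i (- l i) ^+ 2 <= n%:R.
  rewrite (eq_bigr (fun=> 1)) ?sumr_const ?card_ord// => i _.
  by case: (label_sign b i) => e; rewrite /l e ?sqrrN expr1n.
have q1 : (Q b S B1 <= (c b S * expR (- (n%:R * tau ^+ 4) / 128))%:E)%E.
  (* Minimises 2 n lam^2 - lam n tau^2 / 4, with value -n tau^4 / 128. *)
  pose lam := tau ^+ 2 / 16.
  have lam0 : 0 < lam by rewrite divr_gt0.
  have lam8 : lam <= 8^-1 by rewrite /lam; lra.
  apply: le_trans (gauss_col_sqr_lower_tail (c_ge0 b S) mZ (@gaussZ b S) j _ lam0 lam8) _.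
  rewrite lee_fin ler_wpM2l// ler_expR le_eqVlt; apply/orP; left; apply/eqP.
  by rewrite /lam; field.
have q2 : (Q b S B2 <= (c b S * expR (- (n%:R * tau ^+ 4) / 128))%:E)%E.
  have nt0 : 0 <= n%:R * tau / 8 by rewrite !mulr_ge0// ltW.
  apply: le_trans (gauss_col_tail (c_ge0 b S) mZ (@gaussZ b S) j l2 n0 nt0) _.
  rewrite lee_fin ler_wpM2l// ler_expR.
  have -> : - (n%:R * tau / 8) ^+ 2 / (2 * n%:R) = - (n%:R * tau ^+ 2) / 128.
    by field; rewrite gt_eqF.
  rewrite ler_pM2r ?invr_gt0// lerN2 ler_wpM2l ?(ltW n0)//.
  by rewrite (_ : tau ^+ 4 = tau ^+ 2 * tau ^+ 2) ?ler_piMl ?(ltW t2)//; ring.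
exists (B1 `|` B2); split; first exact: measurableU.
  apply: (le_trans (@measureU2 _ _ _ (Q b S) _ _ m1 m2)).
  apply: le_trans (leeD q1 q2) _; rewrite -EFinD lee_fin -mulrDr ler_wpM2l//.
  rewrite ler_pdivlMl//; apply: le_trans small_signal.
  by rewrite le_eqVlt; apply/orP; left; apply/eqP; ring.
move=> w /not_orP[/negP w1 /negP w2].
rewrite -ltNge in w1; rewrite -ltNge in w2.
have -> : \sum_(i < n) (l i * tau + Z i j w) ^+ 2 =
    n%:R * tau ^+ 2 - 2 * tau * (\sum_(i < n) (- l i) * Z i j w) + \sum_(i < n) Z i j w ^+ 2.
  have -> : n%:R * tau ^+ 2 = \sum_(i < n) tau ^+ 2.
    by rewrite sumr_const card_ord mulr_natl.
  rewrite mulr_sumr -sumrN -!big_split/=.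
  apply: eq_bigr => i _.
  by case: (label_sign b i) => e; rewrite /l e; ring.
have tn : thr <= n%:R * tau ^+ 2 / 2.
  rewrite -(@ler_pXn2r _ 2) ?nnegrE ?(ltW thr0)//; last by rewrite !mulr_ge0 ?(ltW t2)// ltW.
  rewrite thr2; have := ler_wpM2l (ltW n0) tau_large.
  have -> : (n%:R * tau ^+ 2 / 2) ^+ 2 = n%:R * (n%:R * tau ^+ 4) / 4 by field.
  lra.
have : 2 * tau * (\sum_(i < n) (- l i) * Z i j w) <= 2 * tau * (n%:R * tau / 8).
  by rewrite ler_wpM2l ?(ltW w2)// mulr_ge0// ltW.
rewrite (_ : 2 * tau * (n%:R * tau / 8) = n%:R * tau ^+ 2 / 4); last by field.
move: w1 tn; lra.
Qed.

Let selection_event b (S : {set 'I_p}) : exists B : set T, [/\ measurable B,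
  (P (B `&` Om b S) <= (c b S * kappa)%:E)%E &
  forall w, ~ B w -> Om b S w -> if_selected q (X w) = S].
Proof.
have H (j : 'I_p) : exists B : set T, [/\ measurable B,
    (Q b S B <= (c b S * (p%:R^-1 * kappa))%:E)%E &
    forall w, ~ B w -> Om b S w -> (j \in if_selected q (X w)) = (j \in S)].
  have [jS|jS] := boolP (j \in S).
    have [B [mB qB hB]] := signal_event b S j; exists B; split=> // w wB wO.
    rewrite thrE (eq_bigr (fun i => (label_vec R b i * tau + Z i j w) ^+ 2)); first exact: hB.
    by move=> i _; rewrite (spikedE wO) /spiked jS.
  have [B [mB qB hB]] := null_event b S j; exists B; split=> // w wB wO.
  rewrite thrE (eq_bigr (fun i => Z i j w ^+ 2)); first by rewrite leNgt hB.
  by move=> i _; rewrite (spikedE wO) /spiked (negbTE jS) mulr0 add0r.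
have [B BP] := choice H.
have mB j : measurable (B j) by have [] := BP j.
have qB j : (Q b S (B j) <= (c b S * (p%:R^-1 * kappa))%:E)%E by have [] := BP j.
exists (\bigcup_j B j); split.
- by have [] := finite_union_bound (Q b S) mB.
- apply: (le_trans (finite_union_bound_cst mB qB)).
  by rewrite card_ord (mulrA p%:R) divff ?gt_eqF// mul1r.
move=> w wB wO; apply/setP => j; have [_ _ h] := BP j; apply: h => // Bw.
by apply: wB; exists j.
Qed.

Lemma if_pca_hamm (xi : 'M[R]_(n, p) -> 'cV[R]_n) :
  2 * D <= n%:R * (p%:R * eps) * tau ^+ 4 ->
  (forall A, first_left_singular_vector (if_submx q A) (xi A)) -> mx_borel_vec xi ->
  hamm ell (fun w => sgn_mx (vote_sign th xi (X w) *: xi (X w))) <=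
    8 * eta + (5 * kappa + kappa + expR (- (p%:R * eps) / 20)).
Proof.
move=> Dp svd bxi.
apply: (spectral_hamm (F := id)
  (sel := fun b S w => Om b S w -> if_selected q (X w) = S)).
- exact: ltW.
- exact: bxi.
- move=> S Sp; split=> //.
  have nt0 : 0 <= n%:R * tau ^+ 4 by rewrite mulr_ge0 ?exprn_ge0 ?ltW.
  have h := ler_wpM2l nt0 (ltW Sp).
  have DS : D <= n%:R * #|S|%:R * tau ^+ 4 by lra.
  have := ler_wpM2r (ler0n R #|S|) DS; rewrite expr2; lra.
- by move=> b S _; exact: selection_event.
move=> b S w wO /(_ wO) sel.
have [xi1 opt] := first_left_singular_vector_max n_gt0 (svd (X w)).
by split=> // v; have := opt v; rewrite !sum_if_submx sel.
Qed.

End Selection.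
End Spectral.
End SingleSize.

(** * Asymptotics *)

Section Asymptotics.
Context (R : realType).

(** With l = ln p, the left side is at most 2 |C| l once l >= |A|, and p^delta >= (delta l / 2)^2
    exceeds this once l >= 8 |C| / delta^2. The other asymptotic comparisons reduce to this one. *)
Lemma near_powR_ge_ln (delta C A : R) : 0 < delta ->
  \forall p \near \oo, C * (A + ln p%:R) <= p%:R `^ delta.
Proof.
move=> d0; near=> p.
have p0 : 0 < p%:R :> R by near: p; exact: nbhs_infty_gtr.
have lnL (L : R) : expR L <= p%:R -> L <= ln p%:R.
  by move=> h; rewrite -ler_expR lnK ?posrE.
have l0 : 0 <= ln p%:R :> R.
  by apply: lnL; rewrite expR0; near: p; exact: nbhs_infty_ger.
have lA : `|A| <= ln p%:R by apply: lnL; near: p; exact: nbhs_infty_ger.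
have lC : 8 * `|C| / delta ^+ 2 <= ln p%:R.
  by apply: lnL; near: p; exact: nbhs_infty_ger.
rewrite /powR gt_eqF//; move: (ln p%:R) l0 lA lC => l l0 lA lC.
have dl0 : 0 <= delta * l by rewrite mulr_ge0// ltW.
apply: le_trans (expR_ge_sqr dl0).
apply: (@le_trans _ _ (`|C| * (2 * l))).
  apply: le_trans (ler_norm _) _; rewrite normrM ler_wpM2l//.
  apply: le_trans (ler_normD _ _) _; rewrite (ger0_norm l0); lra.
rewrite ler_pdivrMr ?exprn_gt0// in lC.
have := ler_wpM2r l0 lC; have := sqr_ge0 delta; nra.
Unshelve. all: by end_near. Qed.

Lemma near_powR_ge (delta K : R) : 0 < delta ->
  \forall p \near \oo, K <= p%:R `^ delta.
Proof.
move=> d0; near=> p.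
have p1 : 1 <= p%:R :> R by near: p; exact: nbhs_infty_ger.
apply: le_trans (_ : 1 * (K + ln p%:R) <= _).
  by rewrite mul1r lerDl ln_ge0.
by near: p; exact: near_powR_ge_ln.
Unshelve. all: by end_near. Qed.

Lemma near_expR_powR_le (delta k C kappa : R) : 0 < delta -> 0 < k -> 0 < kappa ->
  \forall p \near \oo, C * (p%:R * expR (- (p%:R `^ delta / k))) <= kappa.
Proof.
move=> d0 k0 kap0; pose C1 := `|C| + 1.
have C10 : 0 < C1 by rewrite ltr_wpDl.
near=> p.
have p0 : 0 < p%:R :> R by near: p; exact: nbhs_infty_gtr.
apply: (@le_trans _ _ (C1 * (p%:R * expR (- (p%:R `^ delta / k))))).
  rewrite ler_wpM2r ?mulr_ge0 ?expR_ge0 ?(ltW p0)//.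
  by rewrite (le_trans (ler_norm _))// lerDl.
have pE : p%:R = expR (ln p%:R) :> R by rewrite lnK ?posrE.
rewrite -ler_pdivlMl// [X in X * _]pE -expRD.
rewrite -[leRHS]lnK ?posrE ?mulr_gt0 ?invr_gt0// ler_expR.
have h : k * (- ln (C1^-1 * kappa) + ln p%:R) <= p%:R `^ delta.
  by near: p; exact: near_powR_ge_ln.
rewrite mulrC -ler_pdivlMr// in h.
move: (p%:R `^ delta / k) h => x; lra.
Unshelve. all: by end_near. Qed.

Lemma powR_expR (p : R) a : 0 < p -> p `^ a = expR (a * ln p).
Proof. by move=> p0; rewrite /powR gt_eqF. Qed.

Lemma powRX (p a : R) k : (p `^ a) ^+ k = p `^ (k%:R * a).
Proof. by rewrite -powR_mulrn ?powR_ge0// -powRrM mulrC. Qed.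

Section SampleSize.
Variables (theta : R) (n : nat -> nat).
Hypotheses (theta_gt0 : 0 < theta) (theta_lt1 : theta < 1).
Hypothesis n_round : forall p : nat, `|(n p)%:R - p%:R `^ theta| < 1.

(** The factor 2 absorbs the rounding of p^theta to an integer. *)
Lemma near_sample_size : \forall p \near \oo,
  [/\ (0 < n p)%N, (n p <= p)%N, (1 < p)%N & p%:R `^ theta <= 2 * (n p)%:R :> R].
Proof.
near=> p.
have p1 : (1 < p)%N by near: p; exact: nbhs_infty_gt.
have p0 : 0 < p%:R :> R by rewrite ltr0n ltnW.
have t2 : 2 <= p%:R `^ theta by near: p; exact: near_powR_ge.
have t1 : 2 <= p%:R `^ (1 - theta).
  by near: p; apply: near_powR_ge; rewrite subr_gt0.
have pE : p%:R = p%:R `^ (1 - theta) * p%:R `^ theta :> R.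
  by rewrite -powRD ?subrK ?powRr1 ?(ltW p0)// gt_eqF ?implybT.
have := n_round p; rewrite ltr_norml => /andP[n1 n2].
have np : (n p)%:R <= p%:R :> R.
  by rewrite pE; move: (p%:R `^ theta) (p%:R `^ (1 - theta)) t1 t2 n1 n2 => x y; nra.
split=> //; last by lra.
  by rewrite -(ltr_nat R); lra.
by rewrite -(ler_nat R).
Unshelve. all: by end_near. Qed.

End SampleSize.
End Asymptotics.

(** * Convergence in the three regimes *)

Section Regimes.
Variables (R : realType) (theta beta alpha : R).
Hypotheses (theta_gt0 : 0 < theta) (theta_lt1 : theta < 1).
Hypotheses (beta_gt0 : 0 < beta) (beta_lt1 : beta < 1) (alpha_gt0 : 0 < alpha).
Variable n : nat -> nat.
Hypothesis n_round : forall p : nat, `|(n p)%:R - p%:R `^ theta| < 1.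
Variables (d : nat -> measure_display) (T : forall p : nat, measurableType (d p)).
Variable P : forall p : nat, probability (T p) R.
Variable ell : forall p : nat, 'I_(n p) -> {RV (P p) >-> R}.
Variable mu : forall p : nat, 'I_p -> {RV (P p) >-> R}.
Variable Z : forall p : nat, 'I_(n p) -> 'I_p -> {RV (P p) >-> R}.
Hypothesis arw : forall p : nat,
  arw_model (p%:R `^ (- beta)) (p%:R `^ (- alpha)) (@ell p) (@mu p) (@Z p).

Local Notation X := (fun p w => arw_data (@ell p) (@mu p) (@Z p) w).

Let powR_neg_le1 (p : nat) (a : R) : (1 < p)%N -> 0 < a -> p%:R `^ (- a) <= 1 :> R.
Proof.
move=> p1 a0; rewrite -[leRHS](powRr0 p%:R); apply: ler_powR.
  by rewrite ler1n ltnW.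
by rewrite oppr_le0 ltW.
Qed.

Let hamm_cvg0 (lhat : forall p, T p -> 'cV[R]_(n p)) :
  (forall e : R, 0 < e -> \forall p \near \oo, hamm (@ell p) (lhat p) <= e) ->
  hamm (@ell p) (lhat p) @[p --> \oo] --> 0.
Proof.
move=> H; apply/cvgr0Pnorm_le => e e0; near=> p.
by rewrite ger0_norm ?hamm_ge0//; near: p; exact: H.
Unshelve. all: by end_near. Qed.

Let pepsE p : (1 < p)%N -> p%:R * p%:R `^ (- beta) = p%:R `^ (1 - beta) :> R.
Proof.
move=> p1; have p0 : 0 < p%:R :> R by rewrite ltr0n ltnW.
by rewrite powRD ?powRr1 ?(ltW p0)// (gt_eqF p0) implybT.
Qed.

Let near_few (e : R) : 0 < e ->
  \forall p \near \oo, expR (- (p%:R * p%:R `^ (- beta)) / 20) <= e.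
Proof.
move=> e0; near=> p.
have p1 : (1 < p)%N by near: p; exact: nbhs_infty_gt.
rewrite pepsE// mulNr.
apply: (@le_trans _ _ (1 * (p%:R * expR (- (p%:R `^ (1 - beta) / 20))))).
  by rewrite mul1r ler_peMl ?expR_ge0// ler1n ltnW.
by near: p; apply: near_expR_powR_le => //; rewrite subr_gt0.
Unshelve. all: by end_near. Qed.

Lemma simple_aggregation_cvg : alpha < (1 - 2 * beta) / 2 ->
  hamm (@ell p) (fun w => simple_aggregation (X p w)) @[p --> \oo] --> 0.
Proof.
move=> ab; apply: hamm_cvg0 => e e0; near=> p.
have [n0 np p1 _] : [/\ (0 < n p)%N, (n p <= p)%N, (1 < p)%N &
    p%:R `^ theta <= 2 * (n p)%:R :> R] by near: p; exact: near_sample_size.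
have p0 : 0 < p%:R :> R by rewrite ltr0n ltnW.
have h := simple_aggregation_hamm (arw p) (powR_ge0 _ _)
  (powR_neg_le1 p1 beta_gt0) (powR_gt0 _ p0) n0 p1.
have few : expR (- (p%:R * p%:R `^ (- beta)) / 20) <= e / 2.
  by near: p; apply: near_few; rewrite divr_gt0.
apply: le_trans (h (e / 2) _) _; last by lra.
have -> : p%:R * (p%:R `^ (- beta) * p%:R `^ (- alpha)) ^+ 2 =
    p%:R `^ (1 - 2 * beta - 2 * alpha).
  rewrite exprMn !powRX -[X in X * _]powRr1 ?(ltW p0)// !powR_expR// -!expRD.
  by congr expR; ring.
rewrite mulNr; apply: (@le_trans _ _ (2 * (p%:R *
    expR (- (p%:R `^ (1 - 2 * beta - 2 * alpha) / 8))))).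
  rewrite mulrCA ler_wpM2l// ler_wpM2r ?expR_ge0//.
  by rewrite ler_nat.
by near: p; apply: near_expR_powR_le => //; [lra|rewrite divr_gt0].
Unshelve. all: by end_near. Qed.

Let th p : R := Num.sqrt (n p)%:R * p%:R `^ (- alpha) / 4.

Let near_ln_dominated (delta C A : R) : 0 < delta ->
  \forall p \near \oo, C * (1 + ln p%:R + A) <= p%:R `^ delta / 8.
Proof.
move=> d0; near=> p; rewrite ler_pdivlMr//.
have : (8 * C) * ((1 + A) + ln p%:R) <= p%:R `^ delta.
  by near: p; exact: near_powR_ge_ln.
by lra.
Unshelve. all: by end_near. Qed.

Let size_ratio (p : nat) (a : R) : (1 < p)%N -> p%:R `^ theta <= 2 * (n p)%:R ->
  p%:R `^ a <= 2 * ((n p)%:R * p%:R `^ (a - theta)).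
Proof.
move=> p1 tn; have p0 : 0 < p%:R :> R by rewrite ltr0n ltnW.
have -> : p%:R `^ a = p%:R `^ theta * p%:R `^ (a - theta) :> R.
  by rewrite !powR_expR// -expRD; congr expR; ring.
by rewrite mulrA ler_wpM2r// powR_ge0.
Qed.

Let le_of_half (a b x : R) : 0 <= a -> a <= b -> b <= 2 * x -> 2 * (a / 8) <= x.
Proof. lra. Qed.

Let half_le (a g x : R) : 2 * a <= g -> g <= 2 * x -> a <= x.
Proof. lra. Qed.

Let opp_half_le (g x : R) : g <= 2 * x -> - x / 128 <= - (g / 256).
Proof. lra. Qed.

Let error_sum (e eta kappa x : R) : 0 < kappa -> 8 * eta <= e / 4 ->
  6 * kappa <= e / 4 -> x <= e / 4 ->
  8 * eta + (5 * kappa + x) <= e /\ 8 * eta + (5 * kappa + kappa + x) <= e.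
Proof. by move=> ? ? ? ?; split; lra. Qed.

(** The choice D = p^delta / 8 makes every signal-to-noise condition a comparison of exponents. In
    8, a factor 2 covers the rounding of n and a factor 4 the square of the loss [#|S|] > p eps /
    2. *)
Let near_spectral (delta eta kappa : R) : 0 < delta ->
  delta <= 1 - beta - 2 * alpha -> delta <= theta - 2 * alpha -> 0 < kappa ->
  \forall p \near \oo, [/\ 16 ^+ 4 / eta ^+ 2 * (1 + ln p%:R + kappa^-1) <= p%:R `^ delta / 8,
    2 * (p%:R `^ delta / 8) <= p%:R * p%:R `^ (- beta) * p%:R `^ (- alpha) ^+ 2,
    p%:R `^ delta / 8 <= (n p)%:R * p%:R `^ (- alpha) ^+ 2 &
    32 <= kappa * p%:R ^+ 2].
Proof.
move=> d0 dab dta kap0; near=> p.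
have [n0 np p1 tn] : [/\ (0 < n p)%N, (n p <= p)%N, (1 < p)%N &
    p%:R `^ theta <= 2 * (n p)%:R :> R] by near: p; exact: near_sample_size.
have p0 : 0 < p%:R :> R by rewrite ltr0n ltnW.
have p1R : 1 <= p%:R :> R by rewrite ler1n ltnW.
have pd0 : 0 <= p%:R `^ delta by exact: powR_ge0.
have d1 : p%:R `^ delta <= p%:R `^ (1 - beta - 2 * alpha) by exact: ler_powR.
have d2 : p%:R `^ delta <= p%:R `^ (theta - 2 * alpha) by exact: ler_powR.
split.
- by near: p; exact: near_ln_dominated.
- rewrite pepsE// powRX; have -> : p%:R `^ (1 - beta) * p%:R `^ (2%:R * - alpha) =
      p%:R `^ (1 - beta - 2 * alpha) :> R.
    by rewrite !powR_expR// -expRD; congr expR; ring.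
  lra.
- have := size_ratio (theta - 2 * alpha) p1 tn; rewrite powRX.
  have -> : theta - 2 * alpha - theta = 2%:R * - alpha by ring.
  lra.
have : kappa^-1 * 32 <= p%:R `^ 1 by near: p; exact: near_powR_ge.
rewrite powRr1 ?(ltW p0)// ler_pdivrMl// => hk; apply: le_trans hk _.
by rewrite ler_wpM2l ?(ltW kap0)// expr2 ler_peMl// ltW.
Unshelve. all: by end_near. Qed.

Let error_parameters (e : R) : 0 < e -> exists eta kappa : R,
  [/\ 0 < eta, 16 * eta <= 3, 8 * eta <= e / 4 &
    [/\ 0 < kappa, kappa <= 1 & 6 * kappa <= e / 4]].
Proof.
move=> e0; exists (Num.min (8^-1) (e / 32)), (Num.min 1 (e / 24)).
have eta8 : Num.min (8^-1) (e / 32) <= 8^-1 by rewrite ge_min lexx.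
have etae : Num.min (8^-1) (e / 32) <= e / 32 by rewrite ge_min lexx orbT.
have kap1 : Num.min 1 (e / 24) <= 1 by rewrite ge_min lexx.
have kape : Num.min 1 (e / 24) <= e / 24 by rewrite ge_min lexx orbT.
split; [|by lra|by lra|split; [|by []|by lra]].
  by rewrite lt_min; apply/andP; split=> //; rewrite divr_gt0.
by rewrite lt_min ltr01 divr_gt0.
Qed.

Lemma classical_pca_cvg
    (xi : forall p : nat, 'M[R]_(n p, p) -> 'cV[R]_(n p)) :
  (1 - theta) / 2 < beta -> alpha < (1 + theta - 2 * beta) / 4 ->
  (forall p A, first_left_singular_vector A (xi p A)) ->
  (forall p, mx_borel_vec (xi p)) ->
  hamm (@ell p) (fun w => sgn_mx (vote_sign (th p) (xi p) (X p w) *: xi p (X p w)))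
    @[p --> \oo] --> 0.
Proof.
move=> tb ab svd bxi; apply: hamm_cvg0 => e e0.
have [eta [kappa [eta0 eta3 etae [kap0 kap1 kape]]]] := error_parameters e0.
(* Exponents of s tau^2, n tau^2 and n s^2 tau^4 / p. The third is positive by the bound on alpha;
   this bound makes the first positive as theta < 1, and the second as beta > (1 - theta) / 2. *)
pose delta := Num.min (1 - beta - 2 * alpha)
  (Num.min (theta - 2 * alpha) (theta + 1 - 2 * beta - 4 * alpha)).
have d0 : 0 < delta.
  by have := theta_lt1; rewrite !lt_min => t1; apply/andP; split; [|apply/andP; split]; lra.
have d1 : delta <= 1 - beta - 2 * alpha by rewrite ge_min lexx.
have d2 : delta <= theta - 2 * alpha by rewrite !ge_min lexx orbT.
have d3 : delta <= theta + 1 - 2 * beta - 4 * alpha by rewrite !ge_min lexx !orbT.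
near=> p.
have [n0 np p1 tn] : [/\ (0 < n p)%N, (n p <= p)%N, (1 < p)%N &
    p%:R `^ theta <= 2 * (n p)%:R :> R] by near: p; exact: near_sample_size.
have p0 : 0 < p%:R :> R by rewrite ltr0n ltnW.
have p1R : 1 <= p%:R :> R by rewrite ler1n ltnW.
have few : expR (- (p%:R * p%:R `^ (- beta)) / 20) <= e / 4.
  by near: p; apply: near_few; rewrite divr_gt0.
have [D1 D2 D3 D4] : [/\ 16 ^+ 4 / eta ^+ 2 * (1 + ln p%:R + kappa^-1) <= p%:R `^ delta / 8,
    2 * (p%:R `^ delta / 8) <= p%:R * p%:R `^ (- beta) * p%:R `^ (- alpha) ^+ 2,
    p%:R `^ delta / 8 <= (n p)%:R * p%:R `^ (- alpha) ^+ 2 &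
    32 <= kappa * p%:R ^+ 2] by near: p; exact: near_spectral.
apply: le_trans (classical_pca_hamm (arw p) (powR_ge0 _ _) (powR_neg_le1 p1 beta_gt0)
  (powR_gt0 _ p0) n0 np p1 eta0 eta3 kap0 kap1 D1 D2 D3 D4 _ (svd p) (bxi p)) _; last first.
  by have [] := error_sum kap0 etae kape few.
have -> : (n p)%:R * (p%:R * p%:R `^ (- beta)) ^+ 2 * p%:R `^ (- alpha) ^+ 4 =
    (n p)%:R * p%:R `^ (theta + 1 - 2 * beta - 4 * alpha - theta) * p%:R :> R.
  rewrite pepsE// !powRX -[X in _ = _ * X]powRr1 ?(ltW p0)// !powR_expR//.
  by rewrite -!mulrA -!expRD; congr (_ * expR _); ring.
rewrite ler_wpM2r ?(ltW p0)//.
have := size_ratio (theta + 1 - 2 * beta - 4 * alpha) p1 tn.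
have : p%:R `^ delta <= p%:R `^ (theta + 1 - 2 * beta - 4 * alpha) by exact: ler_powR.
by lra.
Unshelve. all: by end_near. Qed.

Lemma if_pca_cvg (q : R)
    (xi : forall p : nat, 'M[R]_(n p, p) -> 'cV[R]_(n p)) :
  3 <= q -> alpha < theta / 4 -> alpha < (1 - beta) / 2 ->
  (forall p A, first_left_singular_vector (if_submx q A) (xi p A)) ->
  (forall p, mx_borel_vec (xi p)) ->
  hamm (@ell p) (fun w => sgn_mx (vote_sign (th p) (xi p) (X p w) *: xi p (X p w)))
    @[p --> \oo] --> 0.
Proof.
move=> q3 at4 ab svd bxi; apply: hamm_cvg0 => e e0.
have [eta [kappa [eta0 eta3 etae [kap0 kap1 kape]]]] := error_parameters e0.
(* The last exponent is now that of n s tau^4, since only s columns are kept.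
   [alpha < (1 - beta) / 2] makes s tau^2 large; [alpha < theta / 4] makes n tau^4 a positive power
   of p, as selection demands. *)
pose delta := Num.min (1 - beta - 2 * alpha)
  (Num.min (theta - 2 * alpha) (theta + 1 - beta - 4 * alpha)).
have d0 : 0 < delta.
  have := beta_lt1; have := alpha_gt0.
  by rewrite !lt_min => a0 b1; apply/andP; split; [|apply/andP; split]; lra.
have ta0 : 0 < theta - 4 * alpha by lra.
have d1 : delta <= 1 - beta - 2 * alpha by rewrite ge_min lexx.
have d2 : delta <= theta - 2 * alpha by rewrite !ge_min lexx orbT.
have d3 : delta <= theta + 1 - beta - 4 * alpha by rewrite !ge_min lexx !orbT.
near=> p.
have [n0 np p1 tn] : [/\ (0 < n p)%N, (n p <= p)%N, (1 < p)%N &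
    p%:R `^ theta <= 2 * (n p)%:R :> R] by near: p; exact: near_sample_size.
have p0 : 0 < p%:R :> R by rewrite ltr0n ltnW.
have p1R : 1 <= p%:R :> R by rewrite ler1n ltnW.
have few : expR (- (p%:R * p%:R `^ (- beta)) / 20) <= e / 4.
  by near: p; apply: near_few; rewrite divr_gt0.
have [D1 D2 D3 D4] : [/\ 16 ^+ 4 / eta ^+ 2 * (1 + ln p%:R + kappa^-1) <= p%:R `^ delta / 8,
    2 * (p%:R `^ delta / 8) <= p%:R * p%:R `^ (- beta) * p%:R `^ (- alpha) ^+ 2,
    p%:R `^ delta / 8 <= (n p)%:R * p%:R `^ (- alpha) ^+ 2 &
    32 <= kappa * p%:R ^+ 2] by near: p; exact: near_spectral.
have nt4 : p%:R `^ (theta - 4 * alpha) <= 2 * ((n p)%:R * p%:R `^ (- alpha) ^+ 4).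
  have := size_ratio (theta - 4 * alpha) p1 tn; rewrite powRX.
  by have -> : theta - 4 * alpha - theta = 4%:R * - alpha by ring.
have tau_large : 16 * q * ln p%:R <= (n p)%:R * p%:R `^ (- alpha) ^+ 4.
  have h : 2 * (16 * q) * (0 + ln p%:R) <= p%:R `^ (theta - 4 * alpha).
    by near: p; exact: near_powR_ge_ln.
  by rewrite add0r -mulrA in h; exact: half_le h nt4.
have small_null : expR (- (ln p%:R / 2)) <= kappa.
  have : kappa^-1 <= p%:R `^ (2^-1) by near: p; exact: near_powR_ge.
  rewrite powR_expR// [2^-1 * _]mulrC -[kappa in _ <= kappa]invrK expRN.
  by rewrite lef_pV2 ?posrE ?invr_gt0 ?expR_gt0.
have small_signal : 2 * p%:R * expR (- ((n p)%:R * p%:R `^ (- alpha) ^+ 4) / 128) <= kappa.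
  apply: (@le_trans _ _ (2 * (p%:R * expR (- (p%:R `^ (theta - 4 * alpha) / 256))))).
    rewrite -mulrA ler_wpM2l// ler_wpM2l ?(ltW p0)// ler_expR.
    exact: opp_half_le.
  by near: p; apply: near_expR_powR_le.
have D5 : 2 * (p%:R `^ delta / 8) <=
    (n p)%:R * (p%:R * p%:R `^ (- beta)) * p%:R `^ (- alpha) ^+ 4.
  have -> : (n p)%:R * (p%:R * p%:R `^ (- beta)) * p%:R `^ (- alpha) ^+ 4 =
      (n p)%:R * p%:R `^ (theta + 1 - beta - 4 * alpha - theta) :> R.
    rewrite pepsE// !powRX !powR_expR// -mulrA -expRD.
    by congr (_ * expR _); ring.
  apply: le_of_half (powR_ge0 _ _) _ (size_ratio _ p1 tn).
  exact: ler_powR.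
have h := if_pca_hamm (arw p) (powR_ge0 _ _) (powR_neg_le1 p1 beta_gt0)
  (powR_gt0 _ p0) n0 np p1 eta0 eta3 kap0 kap1 D1 D2 D3 D4 q3
  (powR_neg_le1 p1 alpha_gt0).
apply: le_trans (h tau_large small_null small_signal _ D5 (svd p) (bxi p)) _.
by have [] := error_sum kap0 etae kape few.
Unshelve. all: by end_near. Qed.

End Regimes.

Theorem theorem1p3 (R : realType) (theta beta alpha : R)
    (theta_gt0 : 0 < theta) (theta_lt1 : theta < 1)
    (beta_gt0 : 0 < beta) (beta_lt1 : beta < 1)
    (alpha_gt0 : 0 < alpha) (alpha_lt : alpha < eta_clu theta beta)
    (n : nat -> nat)
    (n_round : forall p : nat, `|(n p)%:R - p%:R `^ theta| < 1)
    (d : nat -> measure_display) (T : forall p : nat, measurableType (d p))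
    (P : forall p : nat, probability (T p) R)
    (ell : forall p : nat, 'I_(n p) -> {RV (P p) >-> R})
    (mu : forall p : nat, 'I_p -> {RV (P p) >-> R})
    (Z : forall p : nat, 'I_(n p) -> 'I_p -> {RV (P p) >-> R})
    (arw : forall p : nat,
      arw_model (p%:R `^ (- beta)) (p%:R `^ (- alpha)) (ell p) (mu p) (Z p)) :
  let X := fun (p : nat) (w : T p) => arw_data (ell p) (mu p) (Z p) w in
  [/\ (beta < (1 - theta) / 2 ->
        hamm (ell p) (fun w => simple_aggregation (X p w)) @[p --> \oo] --> 0),
      ((1 - theta) / 2 < beta -> beta < 1 / 2 ->
        forall xi : forall p : nat, 'M[R]_(n p, p) -> 'cV[R]_(n p),
          (forall p A, first_left_singular_vector A (xi p A)) ->
          (forall p, mx_borel_vec (xi p)) ->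
        exists s : forall p : nat, 'M[R]_(n p, p) -> R,
          (forall p, sign_rule (s p)) /\
          hamm (ell p) (fun w => sgn_mx (s p (X p w) *: xi p (X p w)))
            @[p --> \oo] --> 0)
    & (1 / 2 < beta -> forall q : R, 3 <= q ->
        forall xi : forall p : nat, 'M[R]_(n p, p) -> 'cV[R]_(n p),
          (forall p A, first_left_singular_vector (if_submx q A) (xi p A)) ->
          (forall p, mx_borel_vec (xi p)) ->
        exists s : forall p : nat, 'M[R]_(n p, p) -> R,
          (forall p, sign_rule (s p)) /\
          hamm (ell p) (fun w => sgn_mx (s p (X p w) *: xi p (X p w)))
            @[p --> \oo] --> 0)].
Proof.
have bk : forall p (xi : 'M[R]_(n p, p) -> 'cV[R]_(n p)), mx_borel_vec xi ->
    sign_rule (vote_sign (Num.sqrt (n p)%:R * p%:R `^ (- alpha) / 4) xi).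
  by move=> p xi bxi; exact: vote_sign_rule.
move=> X; rewrite /eta_clu in alpha_lt; split.
- move=> h; apply: (simple_aggregation_cvg theta_gt0 theta_lt1 beta_gt0 beta_lt1 n_round arw).
  by rewrite ifT ?(ltW h)// in alpha_lt.
- move=> h1 h2 xi svd bxi; exists (fun p => vote_sign
    (Num.sqrt (n p)%:R * p%:R `^ (- alpha) / 4) (xi p)).
  split; first by move=> p; exact: bk.
  rewrite leNgt h1/= (ltW h2) in alpha_lt.
  exact: (classical_pca_cvg theta_gt0 theta_lt1 beta_gt0 beta_lt1 n_round arw).
move=> h q q3 xi svd bxi; exists (fun p => vote_sign
  (Num.sqrt (n p)%:R * p%:R `^ (- alpha) / 4) (xi p)).
split; first by move=> p; exact: bk.
have h1 : (1 - theta) / 2 < beta by lra.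
rewrite leNgt h1/= leNgt h/= in alpha_lt.
(* For beta > 1/2 the curve is the minimum of theta / 4 and (1 - beta) / 2, which cross at beta = 1
   - theta / 2, so both bounds hold on either branch. *)
apply: (if_pca_cvg theta_gt0 theta_lt1 beta_gt0 beta_lt1 alpha_gt0 n_round arw q3 _ _ svd bxi).
  by move: alpha_lt; case: (leP beta (1 - theta / 2)) => ? ?; lra.
by move: alpha_lt; case: (leP beta (1 - theta / 2)) => ? ?; lra.
Qed.
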